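(* Let $\mu$ be a strongly almost periodic measure on $\mathbb{R}^d$. Then $\mu$ is Fourier transformable if and only if its Fourier–Bohr series $\mathcal{F}_{\mathsf d}(\mu)$ is a translation bounded measure. Moreover, in this case $\widehat\mu=\mathcal{F}_{\mathsf d}(\mu)$.
   Context: Here $X=\mathbb{R}^d$ with Lebesgue measure, and $\widehat{\mathbb{R}^d}$ is identified with $\mathbb{R}^d$ via the characters $\chi_y(x)=e^{2\pi i x\cdot y}$. $C_c(X)$: continuous compactly supported functions; $C_u(X)$: bounded uniformly continuous functions, with sup norm. $\check f(y)=\int f(x)e^{2\pi i x\cdot y}\,dx$; $\widetilde f(x)=\overline{f(-x)}$; $f*g$ is convolution. Measures. A measure on $X$ is a linear functional $\mu:C_c(X)\to\mathbb{C}$ such that for each compact $K\subset X$ there is $C_K$ with $|\mu(f)|\le C_K\|f\|_\infty$ for all $f\in C_c(X)$ supported in $K$ (a complex Radon measure, possibly unbounded); $|\mu|$ is its variation. $\mu$ is translation bounded if $\sup_{x\in X}|\mu|(x+K)<\infty$ for every compact $K$. $(f*\mu)(x)=\int f(x-y)\,d\mu(y)$. Fourier transformability. A measure $\mu$ is Fourier transformable if there is a measure $\widehat\mu$ on $\mathbb{R}^d$ (its Fourier transform) such that for all $f\in C_c(\mathbb{R}^d)$: $|\check f|^2\in L^1(|\widehat\mu|)$ and $\langle\mu,f*\widetilde f\rangle=\langle\widehat\mu,|\check f|^2\rangle$. Almost periodicity. $f\in C_u(X)$ is strongly (resp. weakly) almost periodic if the closure of the set of its translates is compact in the norm topology (resp.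 weak topology) of $(C_u(X),\|\cdot\|_\infty)$. A translation bounded measure $\mu$ is strongly (resp. weakly) almost periodic if $f*\mu$ is so for every $f\in C_c(X)$. A weakly almost periodic function $f$ has a mean $M(f)$, the limit of its averages along any Følner sequence. A weakly almost periodic measure $\mu$ has a mean $M(\mu)$, the number with $M(\mu*f)=M(\mu)\int_X f(t)\,dt$ for all $f\in C_c(X)$. Fourier–Bohr series. A formal sum is an expression $\omega=\sum_{y\in\mathbb{R}^d}\omega_y\delta_y$ with $\omega_y\in\mathbb{C}$; it is a measure if $\sum_y|f(y)\omega_y|<\infty$ for all $f\in C_c(\mathbb{R}^d)$ and $f\mapsto\sum_y f(y)\omega_y$ is a measure (it is then identified with this pure point measure). For a weakly almost periodic $\mu$, $c_y(\mu)=M(\overline{\chi_y}\mu)$ and $\mathcal{F}_{\mathsf d}(\mu)=\sum_{y\in\mathbb{R}^d}c_y(\mu)\delta_y$. *)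

(* Defs.v *)
From HB Require Import structures.
From mathcomp Require Import all_boot all_order all_algebra.
From mathcomp Require Import all_classical all_reals all_analysis.
From mathcomp Require Import complex.
From mathcomp.analysis.showcase Require summability.

Set Implicit Arguments.
Unset Strict Implicit.
Unset Printing Implicit Defensive.

Import Order.TTheory GRing.Theory Num.Theory.
Import numFieldNormedType.Exports.
Import Normc.

Local Open Scope classical_set_scope.
Local Open Scope ring_scope.

(* The library has no d-dimensional Lebesgue measure. It is built here on the
   product sigma-algebra of d.-tuple R, as an iterated product of the
   one-dimensional one, and used on 'rV[R]_d through row_of_tuple. *)
Section lebesgue_tuple.
Context {R : realType}.
Local Notation RT := (measurableTypeR R).

Definition consT n (p : RT * n.-tuple RT) : n.+1.-tuple RT :=
  [tuple of p.1 :: p.2].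

Lemma measurable_consT n : measurable_fun setT (@consT n).
Proof. exact: measurable_cons. Qed.

Section lebesgue_step.
Variables (n : nat) (m : {sigma_finite_measure set (n.-tuple RT) -> \bar R}).

Definition lebesgue_step : set (n.+1.-tuple RT) -> \bar R :=
  pushforward (@lebesgue_measure R \x m)%E (@consT n).

HB.instance Definition _ := Measure.copy lebesgue_step
  (measure_function_pushforward__canonical__measure_function_Measure
     (@lebesgue_measure R \x m)%E (@measurable_consT n)).

Lemma lebesgue_step_sigma_finite : sigma_finite setT lebesgue_step.
Proof.
have /sigma_finiteP[F [TF ndF Foo]] := sigma_finiteT (@lebesgue_measure R).
have /sigma_finiteP[G [TG ndG Goo]] := sigma_finiteT m.
pose tl (t : n.+1.-tuple RT) : n.-tuple RT := [tuple of behead t].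
exists (fun k => (@tnth _ RT ^~ ord0) @^-1` F k `&` tl @^-1` G k).
  apply/esym; rewrite -subTset => t _.
  have [i _ Fi] : (\bigcup_k F k) (tnth t ord0) by rewrite -TF.
  have [j _ Gj] : (\bigcup_k G k) (tl t) by rewrite -TG.
  exists (maxn i j) => //; split.
  - by have /subsetPset := ndF _ _ (leq_maxl i j); apply.
  - by have /subsetPset := ndG _ _ (leq_maxr i j); apply.
move=> k; have [mF Fk] := Foo k; have [mG Gk] := Goo k; split.
  apply: measurableI; rewrite -[X in measurable X]setTI.
  - exact: measurable_tnth.
  - exact: measurable_behead.
rewrite /lebesgue_step /pushforward.
rewrite (_ : _ @^-1` _ = F k `*` G k).
  by rewrite product_measure1E// lte_mul_pinfty// ge0_fin_numE.
apply/seteqP; split => -[x t] /= [] Fx; rewrite /tl/=;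
  by rewrite (_ : [tuple of _] = t)//; exact: val_inj.
Qed.

HB.instance Definition _ := Measure_isSigmaFinite.Build _ _ _ lebesgue_step
  lebesgue_step_sigma_finite.

End lebesgue_step.

Fixpoint lebesgue_tuple n : {sigma_finite_measure set (n.-tuple RT) -> \bar R} :=
  if n is n'.+1 then lebesgue_step (lebesgue_tuple n')
  else dirac ([tuple] : 0.-tuple RT).

End lebesgue_tuple.

Section euclidean.
Context {R : realType} {d : nat}.
Local Notation C := (R[i]^o).
Local Notation V := ('rV[R]_d).
Implicit Types (f g h : V -> C) (A K : set V) (x y : V).

Definition row_of_tuple (t : d.-tuple (measurableTypeR R)) : V :=
  \row_i (tnth t i : R).

Definition borel A : Prop := measurable (row_of_tuple @^-1` A).

Definition vol A : \bar R := lebesgue_tuple d (row_of_tuple @^-1` A).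

Definition integral_on A f : C :=
  Complex (\int[lebesgue_tuple d]_(t in row_of_tuple @^-1` A)
             complex.Re (f (row_of_tuple t)))
          (\int[lebesgue_tuple d]_(t in row_of_tuple @^-1` A)
             complex.Im (f (row_of_tuple t))).

Definition integral_Rd f : C := integral_on setT f.

Definition dotp x y : R := \sum_(i < d) x ord0 i * y ord0 i.

Definition chi y x : C :=
  Complex (cos (2 * pi * dotp x y)) (sin (2 * pi * dotp x y)).

Definition fcheck f y : C := integral_Rd (fun x => f x * chi y x).

Definition ftilde f x : C := conjc (f (- x)).

Definition convolution f g x : C := integral_Rd (fun y => f y * g (x - y)).

Definition supp {K : numFieldType} {W : normedModType K} (f : V -> W) : set V :=
  closure [set x | f x != 0].

Definition Cc {K : numFieldType} {W : normedModType K} (f : V -> W) : Prop :=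
  continuous f /\ compact (supp f).

Definition sup_norm f : R := sup (range (fun x => normc (f x))).

Definition Cu f : Prop :=
  (exists M : R, forall x, normc (f x) <= M) /\ unif_continuous f.

(* A functional on Cc is represented by a function defined on all of V -> C,
   of which only the values on Cc are meaningful; see eq_on_Cc. *)
Definition is_measure (mu : (V -> C) -> C) : Prop :=
  (forall (a : C) f g, Cc f -> Cc g ->
     mu (fun x => a * f x + g x) = a * mu f + mu g) /\
  (forall K, compact K -> exists M : R, forall f, Cc f -> supp f `<=` K ->
     normc (mu f) <= M * sup_norm f).

Definition eq_on_Cc (mu nu : (V -> C) -> C) : Prop :=
  forall f, Cc f -> mu f = nu f.

Local Open Scope ereal_scope.

(* Variation and integration in the sense of Bourbaki: |mu|(g) for g in Cc
   nonnegative, then the upper integral |mu|^* of lower semicontinuous and of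
   arbitrary functions with values in [0, +oo]. *)
Definition abs_measure (mu : (V -> C) -> C) (g : V -> R) : \bar R :=
  ereal_sup [set (normc (mu h))%:E |
    h in [set h : V -> C | Cc h /\ forall x, (normc (h x) <= g x)%R]].

Definition upper_integral_lsc (mu : (V -> C) -> C) (G : V -> \bar R) : \bar R :=
  ereal_sup [set abs_measure mu g |
    g in [set g : V -> R |
      Cc g /\ (forall x, (0 <= g x)%R /\ (g x)%:E <= G x)]].

Definition upper_integral (mu : (V -> C) -> C) (F : V -> \bar R) : \bar R :=
  ereal_inf [set upper_integral_lsc mu G |
    G in [set G | lower_semicontinuous G /\ forall x, F x <= G x]].

Definition variation_set (mu : (V -> C) -> C) A : \bar R :=
  upper_integral mu (fun x => (\1_A x)%:E).

(* L^1(|mu|) is the closure of Cc for the seminorm |mu|^*(|.|), and mu is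
   extended to it by continuity. *)
Definition L1_dist (mu : (V -> C) -> C) f g : \bar R :=
  upper_integral mu (fun x => (normc (f x - g x)%R)%:E).

Definition in_L1 (mu : (V -> C) -> C) f : Prop :=
  forall e : R, (0 < e)%R -> exists2 h, Cc h & L1_dist mu f h < e%:E.

Definition pairing (mu : (V -> C) -> C) f : C :=
  xget (0%R : C) [set z : C | exists h_ : nat -> V -> C,
    [/\ forall n, Cc (h_ n),
        (fun n => L1_dist mu f (h_ n)) @ \oo --> 0 &
        (fun n => mu (h_ n)) @ \oo --> z]].

Definition translation_bounded (mu : (V -> C) -> C) : Prop :=
  forall K, compact K ->
    ereal_sup [set variation_set mu [set (x + k)%R | k in K] | x in setT] < +oo.

Local Close Scope ereal_scope.

Definition conv_measure f (mu : (V -> C) -> C) x : C := mu (fun y => f (x - y)).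

Definition is_fourier_transform (mu nu : (V -> C) -> C) : Prop :=
  is_measure nu /\
  forall f, Cc f ->
    let f2 : V -> C := fun y => Complex (normc (fcheck f y) ^+ 2) 0 in
    in_L1 nu f2 /\ mu (convolution f (ftilde f)) = pairing nu f2.

Definition fourier_transformable (mu : (V -> C) -> C) : Prop :=
  exists nu, is_fourier_transform mu nu.

Definition translates f : set {uniform V -> C} :=
  [set (fun x => f (x - t)) | t in [set: V]].

(* Cu is closed for uniform convergence, so that the closure of the translates
   in Cu is the closure in {uniform V -> C}. *)
Definition strongly_ap_fun f : Prop := Cu f /\ compact (closure (translates f)).

Definition strongly_ap (mu : (V -> C) -> C) : Prop :=
  [/\ is_measure mu, translation_bounded mu &
      forall f, Cc f -> strongly_ap_fun (conv_measure f mu)].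

Definition folner (A_ : nat -> set V) : Prop :=
  [/\ forall n, borel (A_ n) /\ compact (closure (A_ n)),
      forall n, (0 < vol (A_ n))%E &
      forall x, (fun n => fine (vol (A_ n `+` [set x + a | a in A_ n])) /
                          fine (vol (A_ n))) @ \oo --> (0 : R)].

Definition has_mean f (m : C) : Prop :=
  forall A_ : nat -> set V, folner A_ ->
    (fun n => Complex (fine (vol (A_ n)))^-1 0 * integral_on (A_ n) f : C)
      @ \oo --> m.

(* The mean is uniquely determined when it exists, as cubes form a Folner
   sequence; functions (and below measures) without a mean get the junk value
   0. *)
Definition mean f : C := xget (0 : C) [set m | has_mean f m].

Definition mean_measure (mu : (V -> C) -> C) : C :=
  xget (0 : C) [set m : C |
    forall f, Cc f -> mean (conv_measure f mu) = m * integral_Rd f].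

Definition fourier_bohr (mu : (V -> C) -> C) y : C :=
  mean_measure (fun f => mu (fun x => conjc (chi y x) * f x)).

(* The sum over V is unconditional: the limit of the finite partial sums. *)
Definition formal_sum (w : V -> C) f : C :=
  summability.sum (fun y : V => f y * w y : C).

Definition formal_sum_is_measure (w : V -> C) : Prop :=
  (forall f, Cc f -> (\esum_(y in [set: V]) (normc (f y * w y))%:E < +oo)%E) /\
  is_measure (formal_sum w).

End euclidean.

(* Main.v *)
Require Import Defs.
From mathcomp Require Import all_boot all_order all_algebra.
From mathcomp Require Import perm finmap.
From mathcomp Require Import all_classical all_reals all_analysis.
From mathcomp Require Import complex.
From mathcomp Require Import measurable_realfun.
From mathcomp Require Import ring lra.
Set Implicit Arguments.
Unset Strict Implicit.
Unset Printing Implicit Defensive.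
Import Order.TTheory GRing.Theory Num.Theory.
Import numFieldNormedType.Exports.
Import Normc.
Local Open Scope classical_set_scope.
Local Open Scope ring_scope.

(** Write c_y for the Fourier-Bohr coefficients of mu. For f in Cc, the function
    [autocorrelation mu f] is almost periodic, has the value mu (f * f~) at the
    origin, and has the Fourier coefficients c_y |fcheck f y|^2
    ([autocorrelation0], [amean_autocorrelation]). That mu is the inverse Fourier
    transform of the sum of the c_y delta_y thus means that the Fourier series of
    this function converges to it at the origin.

    Means are handled as uniform limits of averages over finite lists of
    translations ([amean]). They exist for all almost periodic functions and
    agree with the means along Folner sequences ([amean_exists], [mean_amean]).
    The core of harmonic analysis that is needed is that an almost periodic
    function whose coefficients all vanish is zero ([ap_uniqueness]); it follows
    from the Plancherel inequality on large cubes ([msq_convolution]). Hence an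
    almost periodic function with absolutely summable coefficients is the sum of
    its Fourier series ([ap_fourier_series]), and both directions of the theorem
    are reduced to absolute summability.

    If the formal sum is a translation bounded measure, then the sums of |c_y|
    over unit cubes are uniformly bounded ([translation_bounded_sums]). The large
    sieve inequality ([large_sieve]) then bounds the sum of |c_y| |fcheck f y|^2,
    and the Fourier series at the origin gives the identity that defines a Fourier
    transform ([fourier_transform_fourier_bohr]).

    Conversely let nu be a Fourier transform of mu. By polarization,
    [autocorrelation mu f x] is the integral of chi_x F with respect to nu, where
    F = |fcheck f|^2 ([integral_chi_sqr_fcheck]). A finite combination of its
    coefficients is the mean of its product with a trigonometric polynomial, and
    thus nearly the integral of F against a function that is bounded by a fixed
    constant where F has its mass; so the coefficients are absolutely summable
    ([abs_summable_coef]). Therefore F nu and the sum of the c_y F(y) delta_y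
    agree on trigonometric polynomials, and by Fejer's theorem on Cc
    ([fejer_approx], [integral_mul_coef]). As F may be chosen to be positive on
    any given cube, nu is the formal sum ([fourier_transform_formal_sum]). If its
    masses of unit cubes were unbounded, a superposition of modulated copies of f
    would violate the summability of the coefficients ([fourier_bohr_translates]);
    so it is translation bounded ([translation_bounded_fourier_bohr]). *)

(** * Measure preserving maps of the product space *)

Section rigid.
Context {R : realType}.
Local Notation RT := (measurableTypeR R).

Definition measure_preserving d (T : measurableType d) (m : set T -> \bar R)
    (phi : T -> T) :=
  measurable_fun setT phi /\
  forall A, measurable A -> m (phi @^-1` A) = m A.

Lemma measure_preservingN :
  measure_preserving (@lebesgue_measure R) (-%R : RT -> RT).
Proof.
have mN : measurable_fun (setT : set RT) (-%R : RT -> RT) := oppr_measurable (D := [set: R]).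
split; first by [].
move=> A mA; exact: lebesgue_measureN.
Qed.

Lemma measure_preservingD (b : R) :
  measure_preserving (@lebesgue_measure R) ((fun x => x + b) : RT -> RT).
Proof.
have mf : measurable_fun (setT : set RT) ((fun x : R => x + b) : RT -> RT).
  have H : measurable_fun [set: R] (fun x : R => x + b).
    by apply: measurable_funD; [exact: measurable_id|exact: measurable_cst].
  exact H.
split=> // A mA; pose m' := pushforward (@lebesgue_measure R) ((fun x => x + b) : RT -> RT).
pose M := measure_function_pushforward__canonical__measure_function_Measure (@lebesgue_measure R) mf.
apply/esym; apply: (@lebesgue_measure_unique R M) => // _ [[u v]] _ <-.
rewrite /= /pushforward.
rewrite (_ : _ @^-1` _ = `]u - b, v - b]%classic); last first.
  by apply/seteqP; split=> x /=; rewrite !in_itv/= -ltrBlDr -lerBrDr.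
by rewrite !lebesgue_measure_itv/= !lte_fin ltrD2r -!EFinD opprB addrA subrK.
Qed.

Definition tuple_map n (phi : 'I_n -> RT -> RT) (t : n.-tuple RT) : n.-tuple RT :=
  [tuple phi i (tnth t i) | i < n].

Lemma measurable_tuple_map n (phi : 'I_n -> RT -> RT) :
  (forall i, measurable_fun setT (phi i)) -> measurable_fun setT (tuple_map phi).
Proof.
move=> mphi; apply/measurable_fun_tnthP => i.
rewrite (_ : _ \o _ = phi i \o (@tnth _ RT ^~ i)); last first.
  by apply/funext => t /=; rewrite tnth_mktuple.
apply: measurableT_comp => //; exact: measurable_tnth.
Qed.

Lemma tuple_map_consT n (phi : 'I_n.+1 -> RT -> RT) (p : RT * n.-tuple RT) :
  tuple_map phi (consT p) =
  consT (phi ord0 p.1, tuple_map (fun i => phi (lift ord0 i)) p.2).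
Proof.
apply: eq_from_tnth => i; rewrite tnth_mktuple.
case: (unliftP ord0 i) => [j ->|->]; rewrite /consT ?tnth0 ?tnthS//.
by rewrite tnth_mktuple.
Qed.

(** By induction on the dimension: the coordinatewise map is undone in the inner
    integral by the induction hypothesis, and in the outer one by a change of
    variables on the line. *)
Lemma lebesgue_tuple_preserving n (phi : 'I_n -> RT -> RT) :
  (forall i, measure_preserving (@lebesgue_measure R) (phi i)) ->
  measure_preserving (lebesgue_tuple n) (tuple_map phi).
Proof.
move=> Hphi; split; first by apply: measurable_tuple_map => i; case: (Hphi i).
elim: n => [|n IH] in phi Hphi *.
  move=> A mA; congr (_ _); apply/seteqP; split => t /=; by rewrite (tuple0 (tuple_map _ _)) (tuple0 t).
move=> A mA; rewrite /= /lebesgue_step /pushforward.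
have mB : measurable (@consT R n @^-1` A).
  by rewrite -[X in measurable X]setTI; exact: measurable_consT.
set B := _ @^-1` A in mB.
have [mphi0 phi0] := Hphi ord0.
have mtl : measurable_fun setT (tuple_map (fun i => phi (lift ord0 i))).
  by apply: measurable_tuple_map => i; case: (Hphi (lift ord0 i)).
have -> : @consT R n @^-1` (tuple_map phi @^-1` A) =
    (fun p => (phi ord0 p.1, tuple_map (fun i => phi (lift ord0 i)) p.2)) @^-1` B.
  by apply/seteqP; split => p /=; rewrite /B /= tuple_map_consT.
rewrite /= /product_measure1.
transitivity (\int[lebesgue_measure]_x lebesgue_tuple n (xsection B (phi ord0 x)))%E.
  apply: eq_integral => x _.
  rewrite -(IH (fun i => phi (lift ord0 i))); last first.
  - exact: measurable_xsection.
  - by move=> i; exact: Hphi.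
  congr (lebesgue_tuple n _); apply/seteqP; split => t /=; by rewrite /xsection /= !inE.
have mF : measurable_fun setT (fun x : RT => lebesgue_tuple n (xsection B x) : \bar R).
  exact: measurable_fun_xsection.
rewrite -[LHS](ge0_integral_pushforward mphi0 lebesgue_measure measurableT mF) //.
by apply: eq_measure_integral => C mC _; exact: phi0.
Qed.

End rigid.
(** * Complex numbers and row vectors *)

Section complex_modulus.
Context {R : realType}.
Local Notation C := R[i].
Implicit Types z w : C.

Lemma normc_def z : normc z = Num.sqrt (complex.Re z ^+ 2 + complex.Im z ^+ 2).
Proof. by case: z. Qed.

Lemma normc_ge0 z : 0 <= normc z.
Proof. by rewrite normc_def sqrtr_ge0. Qed.

Lemma sqr_normc z : normc z ^+ 2 = complex.Re z ^+ 2 + complex.Im z ^+ 2.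
Proof. by rewrite normc_def sqr_sqrtr// addr_ge0// sqr_ge0. Qed.

Lemma normcD z w : normc (z + w) <= normc z + normc w.
Proof. exact: le_normcD. Qed.

Lemma normcNE z : normc (- z) = normc z.
Proof. exact: normcN. Qed.

Lemma normcBC z w : normc (z - w) = normc (w - z).
Proof. by rewrite -normcNE opprB. Qed.

Lemma normcB z w : normc (z - w) <= normc z + normc w.
Proof. by rewrite -(normcNE w); exact: normcD. Qed.

Lemma normcM2 z w : normc (z * w) = normc z * normc w.
Proof. exact: normcM. Qed.

Lemma normc_dist z w : normc z <= normc w + normc (z - w).
Proof. by rewrite -{1}(subrK w z) addrC; exact: normcD. Qed.

Lemma normc_tri u z w : normc (z - w) <= normc (z - u) + normc (u - w).
Proof. by have -> : z - w = (z - u) + (u - w) by [rewrite addrA subrK]; exact: normcD. Qed.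

Lemma normcJ z : normc (conjc z) = normc z.
Proof. by case: z => a b; rewrite /= sqrrN. Qed.

Lemma mulcJ z : z * conjc z = Complex (normc z ^+ 2) 0.
Proof. by rewrite sqr_normc; case: z => a b; simpc; congr Complex; ring. Qed.

Lemma normc_real (r : R) : normc (Complex r 0) = `|r|.
Proof. by rewrite normc_def/= expr0n/= addr0 sqrtr_sqr. Qed.

Lemma Re_le_normc z : `|complex.Re z| <= normc z.
Proof.
by rewrite -(@ler_pXn2r _ 2)// ?nnegrE ?normc_ge0// real_normK ?num_real// sqr_normc
  lerDl sqr_ge0.
Qed.

Lemma Im_le_normc z : `|complex.Im z| <= normc z.
Proof.
by rewrite -(@ler_pXn2r _ 2)// ?nnegrE ?normc_ge0// real_normK ?num_real// sqr_normc
  lerDr sqr_ge0.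
Qed.

Lemma normc_le_sum z : normc z <= `|complex.Re z| + `|complex.Im z|.
Proof.
rewrite -(@ler_pXn2r _ 2)// ?nnegrE ?normc_ge0 ?addr_ge0// sqr_normc sqrrD.
by rewrite !real_normK ?num_real// lerD2r lerDl mulrn_wge0// mulr_ge0.
Qed.

Lemma normc_le0 z : normc z <= 0 -> z = 0.
Proof. by move=> H; apply: eq0_normc; apply/eqP; rewrite eq_le H normc_ge0. Qed.

Lemma normc_sum I (s : seq I) (P : pred I) (F : I -> C) :
  normc (\sum_(i <- s | P i) F i) <= \sum_(i <- s | P i) normc (F i).
Proof.
elim/big_ind2: _ => [|x a y b xa yb|//]; first by rewrite normc0.
by apply: (le_trans (normcD _ _)); exact: lerD.
Qed.

Lemma ReD z w : complex.Re (z + w) = complex.Re z + complex.Re w.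
Proof. by case: z => a b; case: w. Qed.
Lemma ImD z w : complex.Im (z + w) = complex.Im z + complex.Im w.
Proof. by case: z => a b; case: w. Qed.
Lemma ReN z : complex.Re (- z) = - complex.Re z.
Proof. by case: z. Qed.
Lemma ImN z : complex.Im (- z) = - complex.Im z.
Proof. by case: z. Qed.
Lemma ReM z w : complex.Re (z * w) =
  complex.Re z * complex.Re w - complex.Im z * complex.Im w.
Proof. by case: z => a b; case: w. Qed.
Lemma ImM z w : complex.Im (z * w) =
  complex.Re z * complex.Im w + complex.Im z * complex.Re w.
Proof. by case: z => a b; case: w => c d /=. Qed.
Lemma ReJ z : complex.Re (conjc z) = complex.Re z.
Proof. by case: z. Qed.
Lemma ImJ z : complex.Im (conjc z) = - complex.Im z.
Proof. by case: z. Qed.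
Lemma complexE z : z = Complex (complex.Re z) (complex.Im z).
Proof. by case: z. Qed.
Lemma conjcD z w : conjc (z + w) = conjc z + conjc w.
Proof. by rewrite (complexE (conjc (z + w))) (complexE (conjc z + conjc w))
  !(ReD, ImD, ReJ, ImJ) opprD. Qed.
Lemma conjcM2 z w : conjc (z * w) = conjc z * conjc w.
Proof. by rewrite (complexE (conjc (z * w))) (complexE (conjc z * conjc w))
  !(ReM, ImM, ReJ, ImJ); congr Complex; ring. Qed.
Lemma conjcN2 z : conjc (- z) = - conjc z.
Proof. by case: z. Qed.
Lemma conjcB z w : conjc (z - w) = conjc z - conjc w.
Proof. by rewrite conjcD conjcN2. Qed.
Lemma conjcK2 z : conjc (conjc z) = z.
Proof. by case: z => a b /=; rewrite opprK. Qed.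
Lemma conjc_sum I (s : seq I) (P : pred I) (F : I -> C) :
  conjc (\sum_(i <- s | P i) F i) = \sum_(i <- s | P i) conjc (F i).
Proof. by elim/big_rec2: _ => [|i y1 y2 _ <-]; [rewrite (complexE (conjc 0))/= oppr0|rewrite conjcD]. Qed.

Lemma Re_sum I (s : seq I) (P : pred I) (F : I -> C) :
  complex.Re (\sum_(i <- s | P i) F i) = \sum_(i <- s | P i) complex.Re (F i).
Proof. by elim/big_rec2: _ => [//|i y1 y2 _ <-]; rewrite ReD. Qed.

Lemma ReZ (k : R) z : complex.Re (Complex k 0 * z) = k * complex.Re z.
Proof. by case: z => u v; simpc. Qed.

End complex_modulus.

Section rowvectors.
Context {R : realType} {d : nat}.
Local Notation V := 'rV[R]_d.

Lemma coord_le_norm (x : V) i : `|x ord0 i| <= `|x|.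
Proof.
rewrite [leRHS]mx_normrE; apply: (le_bigmax_cond _ (fun ij => `|x ij.1 ij.2|) (j := (ord0, i))) => //.
Qed.

Lemma rV_norm_le (x : V) (r : R) : 0 <= r ->
  (`|x| <= r) <-> (forall i, `|x ord0 i| <= r).
Proof.
move=> r0; split=> [H i|H]; first exact: le_trans (coord_le_norm _ _) H.
by rewrite [leLHS]mx_normrE; apply: bigmax_le => // -[i j] _ /=; rewrite ord1.
Qed.

Lemma rV_norm_lt (x : V) (r : R) : 0 < r ->
  (`|x| < r) <-> (forall i, `|x ord0 i| < r).
Proof.
move=> r0; split=> [H i|H]; first exact: le_lt_trans (coord_le_norm _ _) H.
by rewrite [ltLHS]mx_normrE; apply: bigmax_lt => // -[i j] _ /=; rewrite ord1.
Qed.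

End rowvectors.

#[global] Arguments normc : simpl never.
(** * Integrals of real functions over Borel sets *)

Section borel_integral.
Context {R : realType} {d : nat}.
Local Notation V := 'rV[R]_d.
Local Notation RT := (measurableTypeR R).
Local Notation C := (R[i]^o).
Local Notation leb := (lebesgue_tuple d : set (d.-tuple RT) -> \bar R).
Local Notation row := (@row_of_tuple R d).

Lemma borel_box (x : V) (e : R) : 0 < e -> borel [set y : V | `|y - x| < e].
Proof.
move=> e0; rewrite /borel.
rewrite (_ : _ @^-1` _ = \bigcap_(i in [set: 'I_d])
    ((fun t => tnth t i) @^-1` [set r : R | `|r - x ord0 i| < e])); last first.
  apply/seteqP; split => t /=.
    by move/(rV_norm_lt _ e0) => H i _ /=; have := H i; rewrite !mxE.
  by move=> H; apply/(rV_norm_lt _ e0) => i; have := H i I; rewrite /= !mxE.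
apply: fin_bigcap_measurable => [|i _]; first exact: finite_finset.
rewrite -[X in measurable X]setTI.
apply: (measurable_tnth (T := RT) i) => //.
have : measurable (ball (x ord0 i) e) by exact: measurable_ball.
by congr measurable; apply/seteqP; split => r /=; rewrite /ball/= distrC.
Qed.

(** An open set is the countable union of the rational boxes that it contains. *)
Lemma borel_open (U : set V) : open U -> borel U.
Proof.
move=> oU; rewrite /borel.
pose q (p : 'rV[rat]_d) : V := \row_i ratr (p ord0 i).
pose B (u : 'rV[rat]_d * nat) : set V := [set y | `|y - q u.1| < u.2.+1%:R^-1].
pose F u : set (d.-tuple RT) :=
  if `[< B u `<=` U >] then row @^-1` B u else set0.
rewrite (_ : _ @^-1` _ = \bigcup_u F u).
  apply: countable_bigcupT_measurable; first exact: countableP.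
  move=> u; rewrite /F; case: asboolP => // _.
  by apply: borel_box; rewrite invr_gt0.
apply/seteqP; split => t /=; last first.
  by move=> [u _]; rewrite /F; case: asboolP => //= BU Bt; exact: BU.
move=> Ut; have /nbhs_ballP[e /= e0 He] : nbhs (row t) U by exact: open_nbhs_nbhs.
have [k Hk] : exists k : nat, k.+1%:R^-1 < e / 2.
  have e20 : 0 < e / 2 by rewrite divr_gt0.
  have := ltr_add_invr (y := 0) e20; case=> k; rewrite add0r => ?; by exists k.
have Hq (x : R) : exists r : rat, `|x - ratr r| < k.+1%:R^-1.
  have : 0 < k.+1%:R^-1 :> R by rewrite invr_gt0.
  move: (k.+1%:R^-1) => c kp.
  have /rat_in_itvoo[r] : x - c < x + c by lra.
  rewrite in_itv/= => /andP[H1 H2]; exists r.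
  by rewrite ltr_norml; apply/andP; split; lra.
pose p : 'rV[rat]_d := \row_i xget 0 [set r : rat | `|tnth t i - ratr r| < k.+1%:R^-1].
have Hp : B (p, k) (row t).
  rewrite /B /=; apply/rV_norm_lt => [|i]; first by rewrite invr_gt0.
  rewrite !mxE; case: xgetP => [r _ //|H].
  by have [r Hr] := Hq (tnth t i); have := H r.
exists (p, k) => //; rewrite /F; case: asboolP => // -[] y By.
apply: He; rewrite -ball_normE /=.
rewrite -(subrK (q p) (row t)) -addrA (le_lt_trans (ler_normD _ _))//.
have -> : e = e / 2 + e / 2 by lra.
apply: ltrD; first exact: lt_trans Hp Hk.
by rewrite distrC; exact: lt_trans By Hk.
Qed.

Lemma borelC (A : set V) : borel A -> borel (~` A).
Proof. by rewrite /borel preimage_setC; exact: measurableC. Qed.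

Lemma borelI (A B : set V) : borel A -> borel B -> borel (A `&` B).
Proof. by rewrite /borel preimage_setI; exact: measurableI. Qed.

Lemma borelD (A B : set V) : borel A -> borel B -> borel (A `\` B).
Proof. by rewrite /borel !setDE => mA mB; apply: borelI => //; exact: borelC. Qed.

Lemma borel_closed (A : set V) : closed A -> borel A.
Proof. by move=> cA; rewrite -(setCK A); apply: borelC; apply: borel_open; exact: closed_openC. Qed.

Lemma continuous_measurable_row (g : V -> R) : continuous g ->
  measurable_fun (setT : set (d.-tuple RT)) (fun t => g (row t) : R).
Proof.
move=> cg.
have H : measurable_fun (setT : set (d.-tuple RT)) ((fun t => g (row t)) : _ -> RT).
  apply: (measurability (RGenOpens.G (R := R))).
    exact: RGenOpens.measurableE.
  move=> _ [B [x [y ->]] <-]; rewrite setTI.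
  have : borel (g @^-1` `]x, y[%classic).
    apply: borel_open; apply: open_comp => [? _|]; first exact: cg.
    exact: interval_open.
  by [].
exact H.
Qed.

(** Translations and the reflection act coordinatewise, so that the invariance of
    the volume reduces to dimension one. *)
Definition translate_tuple (x : V) : d.-tuple RT -> d.-tuple RT :=
  tuple_map (fun i (r : R) => r + x ord0 i).

Lemma row_translate x t : row (translate_tuple x t) = row t + x.
Proof. by apply/rowP => i; rewrite !mxE tnth_mktuple. Qed.

Lemma preserving_translate x : measure_preserving leb (translate_tuple x).
Proof. by apply: lebesgue_tuple_preserving => i; exact: measure_preservingD. Qed.

Definition oppose_tuple : d.-tuple RT -> d.-tuple RT :=
  tuple_map (fun i (r : R) => - r).

Lemma row_oppose t : row (oppose_tuple t) = - row t.
Proof. by apply/rowP => i; rewrite !mxE tnth_mktuple. Qed.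

Lemma preserving_oppose : measure_preserving leb oppose_tuple.
Proof. by apply: lebesgue_tuple_preserving => i; exact: measure_preservingN. Qed.

Definition rint (A : set V) (g : V -> R) : R :=
  \int[lebesgue_tuple d]_(t in row @^-1` A) g (row t).

Definition bcont (g : V -> R) := continuous g /\ exists M, forall x, `|g x| <= M.

Lemma integral_onE A (f : V -> C) : integral_on A f =
  Complex (rint A (fun x => complex.Re (f x))) (rint A (fun x => complex.Im (f x))).
Proof. by []. Qed.

Lemma bcont_integrable A g : borel A -> (vol A < +oo)%E -> bcont g ->
  (lebesgue_tuple d).-integrable (row @^-1` A) (EFin \o (fun t => g (row t))).
Proof.
move=> mA vA [cg [M gM]]; apply: measurable_bounded_integrable => //.
  apply: (@measurable_funS _ _ _ _ setT) => //; exact: continuous_measurable_row.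
exists M; split; first exact: num_real.
by move=> e Me t _ /=; apply: le_trans (ltW Me).
Qed.

Section finite_volume.
Variables (A : set V) (mA : borel A) (vA : (vol A < +oo)%E).

Lemma rintD f g : bcont f -> bcont g ->
  rint A (fun x => f x + g x) = rint A f + rint A g.
Proof. by move=> bf bg; apply: RintegralD => //; exact: bcont_integrable. Qed.

Lemma rintZ c f : bcont f -> rint A (fun x => c * f x) = c * rint A f.
Proof. by move=> bf; apply: RintegralZl => //; exact: bcont_integrable. Qed.

Lemma rint_le f g : bcont f -> bcont g -> (forall x, A x -> f x <= g x) ->
  rint A f <= rint A g.
Proof.
move=> bf bg fg; apply: le_Rintegral => //; try exact: bcont_integrable.
by move=> t At; exact: fg.
Qed.

Lemma rint_cst c : rint A (fun=> c) = c * fine (vol A).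
Proof. exact: Rintegral_cst. Qed.

End finite_volume.

Lemma rint_ge0 A g : (forall x, A x -> 0 <= g x) -> 0 <= rint A g.
Proof. by move=> g0; apply: Rintegral_ge0 => t At; exact: g0. Qed.

Lemma rint_eq A f g : (forall x, A x -> f x = g x) -> rint A f = rint A g.
Proof. by move=> fg; apply: eq_Rintegral => t; rewrite inE => At; exact: fg. Qed.

Lemma rint_supp A B g : A `<=` B -> (forall x, ~ A x -> g x = 0) ->
  rint B g = rint A g.
Proof.
move=> AB g0; rewrite /rint Rintegral_mkcond [RHS]Rintegral_mkcond.
congr (Rintegral _ _ _); apply/funext => t; rewrite !patchE /=.
have [At|nAt] := pselect (A (row t)).
  by rewrite !mem_set//; exact: AB.
by rewrite (memNset (A := row @^-1` A))//; case: ifP => // _; exact: g0.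
Qed.

Lemma rint_split A B g : borel A -> borel B -> (vol A < +oo)%E -> bcont g ->
  rint A g = rint (A `&` B) g + rint (A `\` B) g.
Proof.
move=> mA mB vA bg; rewrite -[in LHS](setUIDK A B) /rint preimage_setU Rintegral_setU //.
- exact: borelI.
- exact: borelD.
- by rewrite -preimage_setU setUIDK; exact: bcont_integrable.
- rewrite disj_set2E; apply/eqP; rewrite -preimage_setI -subset0 => t [[_ Bt]].
  by case.
Qed.

Lemma rint_preserving (phi : d.-tuple RT -> d.-tuple RT) (psi : V -> V) A g :
  measure_preserving leb phi -> (forall t, row (phi t) = psi (row t)) ->
  borel A -> (vol (psi @^-1` A) < +oo)%E -> bcont g ->
  rint (psi @^-1` A) (g \o psi) = rint A g.
Proof.
move=> [mphi pphi] rphi mA vA [cg [M gM]]; rewrite /rint /Rintegral; congr fine.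
have E : row @^-1` (psi @^-1` A) = phi @^-1` (row @^-1` A).
  by apply/seteqP; split => t /=; rewrite rphi.
rewrite E.
transitivity (\int[lebesgue_tuple d]_(t in phi @^-1` (row @^-1` A))
   ((fun t => (g (row t))%:E) \o phi) t)%E.
  by apply: eq_integral => t _ /=; rewrite rphi.
rewrite -(integral_pushforward mphi) //.
- by apply: eq_measure_integral => B mB _; exact: pphi.
- by apply/measurable_EFinP; exact: continuous_measurable_row.
- apply: measurable_bounded_integrable => //.
  + by rewrite -[X in measurable X]setTI; exact: mphi.
  + by rewrite -E.
  + apply: (@measurable_funS _ _ _ _ setT) => //.
    have := continuous_measurable_row cg => H; exact: measurableT_comp H mphi.
  + exists M; split; first exact: num_real.
    by move=> e Me t _ /=; apply: le_trans (ltW Me).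
Qed.

Lemma vol_preserving (phi : d.-tuple RT -> d.-tuple RT) (psi : V -> V) A :
  measure_preserving leb phi -> (forall t, row (phi t) = psi (row t)) ->
  borel A -> borel (psi @^-1` A) /\ vol (psi @^-1` A) = vol A.
Proof.
move=> [mphi pphi] rphi mA; rewrite /borel /vol.
have -> : row @^-1` (psi @^-1` A) = phi @^-1` (row @^-1` A).
  by apply/seteqP; split => t /=; rewrite rphi.
by split; [rewrite -[X in measurable X]setTI; exact: mphi|exact: pphi].
Qed.

Lemma vol_translate (x : V) (A : set V) : borel A ->
  borel [set y : V | A (y + x)] /\ vol [set y : V | A (y + x)] = vol A.
Proof.
move=> mA; apply: (vol_preserving (psi := fun y => y + x) (preserving_translate x)) => //.
exact: row_translate.
Qed.

Lemma rint_translate (x : V) (A : set V) g : borel A -> (vol A < +oo)%E -> bcont g ->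
  rint [set y : V | A (y + x)] (fun y => g (y + x)) = rint A g.
Proof.
move=> mA vA bg.
apply: (rint_preserving (psi := fun y => y + x) (preserving_translate x)) => //.
- exact: row_translate.
- by have [_ ->] := vol_translate x mA.
Qed.

Lemma rint_oppose (A : set V) g : borel A -> (vol A < +oo)%E -> bcont g ->
  rint [set y : V | A (- y)] (fun y => g (- y)) = rint A g.
Proof.
move=> mA vA bg.
apply: (rint_preserving (psi := fun y => - y) preserving_oppose) => //.
- exact: row_oppose.
- have [_] := vol_preserving (psi := fun y => - y) preserving_oppose row_oppose mA.
  by rewrite /preimage => ->.
Qed.

End borel_integral.
(** * Integrals of trigonometric functions over cubes *)

Section cubes.
Context {R : realType}.
Local Notation RT := (measurableTypeR R).

Lemma Rintegral_tensor d1 d2 (T1 : measurableType d1) (T2 : measurableType d2)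
    (m1 : {sigma_finite_measure set T1 -> \bar R})
    (m2 : {sigma_finite_measure set T2 -> \bar R})
    (A : set T1) (B : set T2) (f : T1 -> R) (g : T2 -> R) (M : R) :
  measurable A -> measurable B -> (m1 A < +oo)%E -> (m2 B < +oo)%E ->
  measurable_fun setT f -> measurable_fun setT g ->
  (forall x, `|f x| <= M) -> (forall x, `|g x| <= M) ->
  \int[(m1 \x m2)%E]_(p in A `*` B) (f p.1 * g p.2) =
  \int[m1]_(x in A) f x * \int[m2]_(y in B) g y.
Proof.
move=> mA mB fA fB mf mg fM gM.
have mfg : measurable_fun setT (fun p : T1 * T2 => f p.1 * g p.2).
  apply: measurable_funM; [exact: (measurableT_comp mf measurable_fst)|exact: (measurableT_comp mg measurable_snd)].
have vAB : ((m1 \x m2)%E (A `*` B) < +oo)%E.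
  by rewrite product_measure1E// lte_mul_pinfty// ge0_fin_numE.
have iAB : (m1 \x m2)%E.-integrable (A `*` B) (EFin \o (fun p : T1 * T2 => f p.1 * g p.2)).
  apply: measurable_bounded_integrable; first exact: measurableX.
  - exact: vAB.
  - exact: measurable_funS mfg.
  - exists (M * M); split; first exact: num_real.
    move=> e Me p _ /=; apply: le_trans (ltW Me); rewrite normrM; exact: ler_pM.
have mAB : measurable (A `*` B) by exact: measurableX.
rewrite /Rintegral integral_mkcond.
rewrite -integral12_prod_meas1; last first.
  by rewrite -(integrable_mkcond _ mAB).
have ig : m2.-integrable B (EFin \o g).
  apply: measurable_bounded_integrable => //; first exact: measurable_funS mg.
  by exists M; split; [exact: num_real|move=> e Me y _ /=; apply: le_trans (ltW Me)].
have jf : m1.-integrable A (EFin \o f).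
  apply: measurable_bounded_integrable => //; first exact: measurable_funS mf.
  by exists M; split; [exact: num_real|move=> e Me y _ /=; apply: le_trans (ltW Me)].
pose c := \int[m2]_(y in B) g y.
transitivity (fine (\int[m1]_x (((fun x => c%:E * (f x)%:E) \_ A) x))%E).
  congr fine; apply: eq_integral => x _; rewrite /fubini_F patchE.
  case: ifPn => xA.
    rewrite /c /Rintegral fineK; last by apply: integrable_fin_num.
    rewrite muleC -integralZl // [in RHS]integral_mkcond.
    apply: eq_integral => y _; rewrite !patchE.
    have -> : ((x, y) \in A `*` B) = (y \in B).
      by apply/idP/idP => [/set_mem[_ yB]|yB]; [exact: mem_set|apply: mem_set; split; exact: set_mem].
    by case: ifP.
  apply: integral0_eq => y _; rewrite patchE ifF //.
  by apply/negbTE/negP; rewrite inE => -[xA' _]; move/negP: xA; apply; rewrite inE.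
rewrite -integral_mkcond integralZl // fineM //; first by rewrite mulrC.
exact: integrable_fin_num.
Qed.

Definition dirichlet (r a : R) : R :=
  \int[lebesgue_measure]_(x in `[- r, r]%classic) cos (a * x).

Lemma dirichletE r a : 0 < r -> a != 0 -> dirichlet r a = 2 * sin (a * r) / a.
Proof.
move=> r0 a0; rewrite /dirichlet /Rintegral.
have cM : continuous (fun x : R => a * x) by move=> x; exact: mulrl_continuous.
have cF : continuous (fun x : R => sin (a * x) / a).
  move=> x; apply: (@cvgMr_tmp _ _ _ _ (fun x => sin (a * x))).
  apply: (cvg_comp (fun x => a * x) sin (cM x)); exact: continuous_sin.
have dF (x : R) : is_derive x 1 (fun x : R => sin (a * x) / a) (cos (a * x)).
  have -> : (fun x : R => sin (a * x) / a) = a^-1 *: (sin \o (fun x => a * x)).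
    by apply/funext => z /=; rewrite [RHS]mulrC.
  have -> : cos (a * x) = a^-1 *: (cos (a * x) * a).
    by rewrite /GRing.scale/= mulrCA mulVf// mulr1.
  apply: is_deriveZ; apply: is_derive1_comp.
  have -> : ( *%R a) = a *: (id : R -> R) by apply/funext.
  by rewrite -{2}[a]mulr1; apply: is_deriveZ.
rewrite (@continuous_FTC2 _ _ (fun x => sin (a * x) / a)) /=.
- by rewrite mulrN sinN; field.
- by lra.
- apply: continuous_subspaceT => x.
  by apply: (cvg_comp (fun x => a * x) cos (cM x)); exact: continuous_cos.
- split; first by move=> x _; have [] := dF x.
  + by apply: cvg_at_right_filter; exact: cF.
  + by apply: cvg_at_left_filter; exact: cF.
- move=> x _ /=; rewrite derive1E; exact: (@derive_val _ _ _ _ _ _ _ (dF x)).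
Qed.

Lemma lebesgue_measure_sym_itv r : 0 <= r ->
  @lebesgue_measure R `[- r, r]%classic = (2 * r)%:E.
Proof.
move=> r0; rewrite lebesgue_measure_itv /= lte_fin.
case: ltP => [|rr]; first by rewrite -EFinD /= opprK => _; congr EFin; ring.
have -> : r = 0 by apply/eqP; rewrite eq_le r0 andbT; lra.
by rewrite mulr0.
Qed.

Lemma Rintegral_sin_odd (r a : R) :
  \int[lebesgue_measure]_(x in `[- r, r]%classic) sin (a * x) = 0.
Proof.
suff : \int[lebesgue_measure]_(x in `[- r, r]%classic) sin (a * x) =
       - \int[lebesgue_measure]_(x in `[- r, r]%classic) sin (a * x) by lra.
case: (lerP 0 r) => r0; last first.
  by rewrite set_itv_ge ?Rintegral_set0 ?oppr0// -leNgt bnd_simp; lra.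
have cs : continuous (fun x : R => sin (a * x)).
  move=> x; apply: (cvg_comp (fun x => a * x) sin); [exact: mulrl_continuous|exact: continuous_sin].
rewrite {1}/Rintegral.
have := @integration_by_substitution_oppr R (fun x => sin (a * x)) (- r) r.
rewrite opprK => ->; [|by lra|exact: continuous_subspaceT].
transitivity (\int[lebesgue_measure]_(x in `[- r, r]%classic) (- 1 * sin (a * x))).
  rewrite /Rintegral; congr fine; apply: eq_integral => x _ /=.
  by rewrite mulrN sinN mulN1r.
rewrite RintegralZl ?mulN1r//.
apply: measurable_bounded_integrable => //.
- by have := ltry (2 * r); rewrite -lebesgue_measure_sym_itv.
- apply: (@measurable_funS _ _ _ _ setT) => //; exact: continuous_measurable_fun.
- exists 1; split; first exact: num_real.
  move=> e Me y _ /=; apply: le_trans (ltW Me).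
  by rewrite ler_norml sin_geN1 sin_le1.
Qed.

Definition box n (r : R) : set (n.-tuple RT) :=
  [set t | forall i, - r <= (tnth t i : R) <= r].
Arguments box : clear implicits.

Lemma box_consT n r : @consT R n @^-1` box n.+1 r = `[- r, r]%classic `*` box n r.
Proof.
apply/seteqP; split => -[x t] /= H.
  split; first by have := H ord0; rewrite /consT tnth0 /= in_itv.
  by move=> i; have := H (lift ord0 i); rewrite /consT tnthS.
move=> i; case: (unliftP ord0 i) => [j ->|->]; rewrite /consT ?tnth0 ?tnthS//; first exact: H.2.
by have := H.1; rewrite /= in_itv.
Qed.

Lemma measurable_box n r : measurable (box n r).
Proof.
rewrite (_ : box n r = \bigcap_(i in [set: 'I_n])
   ((fun t : n.-tuple RT => tnth t i) @^-1` `[- r, r]%classic)); last first.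
  apply/seteqP; split => t /= H i; first by move=> _; rewrite /= in_itv /=; exact: H.
  by have := H i I; rewrite /= in_itv.
apply: fin_bigcap_measurable => [|i _]; first exact: finite_finset.
rewrite -[X in measurable X]setTI; exact: (measurable_tnth (T := RT) i).
Qed.

Lemma lebesgue_tuple_box n r : 0 <= r ->
  lebesgue_tuple n (box n r) = ((2 * r) ^+ n)%:E.
Proof.
move=> r0; elim: n => [|n IH].
  rewrite /= diracE expr0 mem_set// => i; by case: i.
rewrite /= /lebesgue_step /pushforward box_consT product_measure1E//; last exact: measurable_box.
rewrite IH (_ : lebesgue_measure_lebesgue_measure__canonical__measure_function_Measure R _ = (2 * r)%:E); last exact: lebesgue_measure_sym_itv.
by rewrite -EFinM exprS.
Qed.

Definition tdot n (th : 'I_n -> R) (t : n.-tuple RT) : R :=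
  \sum_(i < n) th i * (tnth t i : R).

Lemma measurable_tdot n (th : 'I_n -> R) : measurable_fun setT (tdot th).
Proof.
rewrite /tdot; apply: measurable_sum => i.
have H : measurable_fun (setT : set (n.-tuple RT)) (fun t => tnth t i : R).
  have H0 := measurable_tnth (T := RT) i; exact H0.
by apply: measurable_funM.
Qed.

Lemma tdot_consT n (th : 'I_n.+1 -> R) x (t : n.-tuple RT) :
  tdot th (consT (x, t)) = th ord0 * x + tdot (fun i => th (lift ord0 i)) t.
Proof.
rewrite /tdot big_ord_recl /consT tnth0; congr (_ + _).
by apply: eq_bigr => i _; rewrite tnthS.
Qed.

Lemma Rintegral_lebesgue_step n (A : set (n.+1.-tuple RT)) (f : n.+1.-tuple RT -> R) M :
  measurable A -> (lebesgue_tuple n.+1 A < +oo)%E ->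
  measurable_fun setT f -> (forall t, `|f t| <= M) ->
  \int[lebesgue_tuple n.+1]_(t in A) f t =
  \int[(@lebesgue_measure R \x lebesgue_tuple n)%E]_(p in @consT R n @^-1` A) f (consT p).
Proof.
move=> mA vA mf fM; rewrite /Rintegral; congr fine.
have mc := @measurable_consT R n.
rewrite -(integral_pushforward mc (f := EFin \o f)) //.
- exact/measurable_EFinP.
- apply: measurable_bounded_integrable => //.
  + by rewrite -[X in measurable X]setTI; exact: mc.
  + apply: (@measurable_funS _ _ _ _ setT) => //; exact: measurableT_comp mf mc.
  + by exists M; split; [exact: num_real|move=> e Me y _ /=; apply: le_trans (ltW Me)].
Qed.

(** The addition theorems split off one coordinate at a time; the terms with a
    sine vanish because the cube is symmetric. *)
Lemma Rintegral_box_trig n r (th : 'I_n -> R) : 0 <= r ->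
  \int[lebesgue_tuple n]_(t in box n r) cos (tdot th t) = \prod_(i < n) dirichlet r (th i)
  /\ \int[lebesgue_tuple n]_(t in box n r) sin (tdot th t) = 0.
Proof.
move=> r0; elim: n => [|n IH] in th *.
  have tb : tdot th = fun=> 0 by apply/funext => t; rewrite /tdot big_ord0.
  rewrite tb cos0 sin0 big_ord0 !Rintegral_cst; try exact: measurable_box.
  rewrite (_ : fine _ = fine 1%E) ?mul1r ?mul0r//.
  by congr fine; have := lebesgue_tuple_box 0 r0; rewrite expr0.
set th' := fun i => th (lift ord0 i).
have [IHc IHs] := IH th'.
have mI : measurable (`[- r, r]%classic : set RT) by [].
have fI : (@lebesgue_measure R (`[- r, r]%classic)%R < +oo)%E.
  by have := ltry (2 * r); rewrite -lebesgue_measure_sym_itv.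
have fB : (lebesgue_tuple n (box n r) < +oo)%E by rewrite lebesgue_tuple_box// ltry.
have mC : measurable_fun setT (fun x : RT => cos (th ord0 * x) : R).
  have H : measurable_fun [set: R] (fun x : R => cos (th ord0 * x)).
    apply: continuous_measurable_fun => x.
    by apply: (cvg_comp (fun x => th ord0 * x) cos); [exact: mulrl_continuous|exact: continuous_cos].
  exact H.
have mS : measurable_fun setT (fun x : RT => sin (th ord0 * x) : R).
  have H : measurable_fun [set: R] (fun x : R => sin (th ord0 * x)).
    apply: continuous_measurable_fun => x.
    by apply: (cvg_comp (fun x => th ord0 * x) sin); [exact: mulrl_continuous|exact: continuous_sin].
  exact H.
have mcos : measurable_fun [set: R] (@cos R) by apply: continuous_measurable_fun; exact: continuous_cos.
have msin : measurable_fun [set: R] (@sin R) by apply: continuous_measurable_fun; exact: continuous_sin.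
have mcd k (h : 'I_k -> R) : measurable_fun setT (fun t => cos (tdot h t)).
  exact: measurableT_comp mcos (measurable_tdot h).
have msd k (h : 'I_k -> R) : measurable_fun setT (fun t => sin (tdot h t)).
  exact: measurableT_comp msin (measurable_tdot h).
have cb (x : R) : `|cos x| <= 1 by rewrite ler_norml cos_geN1 cos_le1.
have sb (x : R) : `|sin x| <= 1 by rewrite ler_norml sin_geN1 sin_le1.
have ten (f : RT -> R) (g : n.-tuple RT -> R) := @Rintegral_tensor _ _ _ _
  (@lebesgue_measure R) (lebesgue_tuple n) `[- r, r]%classic (box n r) f g 1 mI (@measurable_box n r) fI fB.
have vp : ((@lebesgue_measure R \x lebesgue_tuple n)%E ((`[- r, r]%classic)%R `*` box n r) < +oo)%E.
  by rewrite product_measure1E//; [rewrite lte_mul_pinfty// ge0_fin_numE|exact: measurable_box].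
have ip (f : RT -> R) (g : n.-tuple RT -> R) : measurable_fun setT f -> measurable_fun setT g ->
    (forall x, `|f x| <= 1) -> (forall x, `|g x| <= 1) ->
    (@lebesgue_measure R \x lebesgue_tuple n)%E.-integrable (`[- r, r]%classic `*` box n r)
      (EFin \o (fun p => f p.1 * g p.2)).
  move=> mf mg fM gM; apply: measurable_bounded_integrable => //.
  - by apply: measurableX => //; exact: measurable_box.
  - apply: (@measurable_funS _ _ _ _ setT) => //.
    by apply: measurable_funM; [exact: (measurableT_comp mf measurable_fst)|exact: (measurableT_comp mg measurable_snd)].
  - exists 1; split; first exact: num_real.
    by move=> e Me p _ /=; apply: le_trans (ltW Me); rewrite normrM -[1]mulr1; exact: ler_pM.
have mpB : measurable (`[- r, r]%classic `*` box n r : set (RT * n.-tuple RT)).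
  by apply: measurableX => //; exact: measurable_box.
have step (f : n.+1.-tuple RT -> R) : measurable_fun setT f -> (forall t, `|f t| <= 1) ->
    \int[lebesgue_tuple n.+1]_(t in box n.+1 r) f t =
    \int[(@lebesgue_measure R \x lebesgue_tuple n)%E]_(p in `[- r, r]%classic `*` box n r) f (consT p).
  move=> mf fM; rewrite -box_consT; apply: (Rintegral_lebesgue_step _ _ mf fM); first exact: measurable_box.
  by have := ltry ((2 * r) ^+ n.+1); rewrite -lebesgue_tuple_box.
have mc' := mcd _ th'; have ms' := msd _ th'.
have cb' t : `|cos (tdot th' t)| <= 1 by exact: cb.
have sb' t : `|sin (tdot th' t)| <= 1 by exact: sb.
have cb0 x : `|cos (th ord0 * x)| <= 1 by exact: cb.
have sb0 x : `|sin (th ord0 * x)| <= 1 by exact: sb.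
split.
  rewrite step; [|exact: mcd|by move=> t; exact: cb].
  under eq_Rintegral => p _ do rewrite {1}(surjective_pairing p) tdot_consT cosD -/th'.
  rewrite RintegralB //; [|exact: (ip _ _ mC mc' cb0 cb')|exact: (ip _ _ mS ms' sb0 sb')].
  rewrite (ten _ _ mC mc' cb0 cb') (ten _ _ mS ms' sb0 sb').
  by rewrite IHs mulr0 subr0 big_ord_recl IHc.
rewrite step; [|exact: msd|by move=> t; exact: sb].
under eq_Rintegral => p _ do rewrite {1}(surjective_pairing p) tdot_consT sinD -/th'.
rewrite RintegralD //; [|exact: (ip _ _ mS mc' sb0 cb')|exact: (ip _ _ mC ms' cb0 sb')].
rewrite (ten _ _ mS mc' sb0 cb') (ten _ _ mC ms' cb0 sb').
by rewrite IHs mulr0 addr0 Rintegral_sin_odd mul0r.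
Qed.

End cubes.
(** * Bounded uniformly continuous functions *)

Section function_classes.
Context {R : realType} {d : nat}.
Local Notation V := 'rV[R]_d.
Local Notation C := (R[i]^o).
Implicit Types (f g h : V -> C) (x y t : V).

Lemma cvg_normcP T (F : set_system T) {FF : Filter F} (u : T -> C) (l : C) :
  u @ F --> l <-> forall e : R, 0 < e -> \forall t \near F, normc (u t - l) < e.
Proof.
split=> [/cvgrPdist_lt H e e0|H].
  have /H : (0 : R[i]) < Complex e 0 by rewrite ltcE /= eqxx.
  apply: filterS => t; rewrite -[ `|_|]/(Complex (normc (l - u t)) 0) ltcE /= => /andP[_].
  by rewrite normcBC.
apply/cvgrPdist_lt => e; rewrite ltcE => /andP[/eqP e1 e0].
have := H _ e0; apply: filterS => t.
by rewrite -[ `|_|]/(Complex (normc (l - u t)) 0) ltcE /= e1 eqxx /= normcBC.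
Qed.

Definition bdd f := exists M : R, forall x, normc (f x) <= M.

Definition ucont f := forall e : R, 0 < e ->
  exists2 del, 0 < del & forall x y, `|x - y| < del -> normc (f x - f y) <= e.

Definition buc f := bdd f /\ ucont f.

Definition vanish (r : R) f := forall x, r < `|x| -> f x = 0.

Lemma ucont_continuous f : ucont f -> continuous f.
Proof.
move=> uf x; apply/(@cvg_normcP _ (nbhs x) (nbhs_filter x)) => e e0.
have [del del0 H] := uf (e / 2) ltac:(by rewrite divr_gt0).
apply/nbhs_ballP; exists del => // y /=; rewrite -ball_normE /= => xy.
rewrite normcBC; apply: le_lt_trans (H _ _ xy) _; lra.
Qed.

Lemma compact_ball (r : R) : compact [set x : V | `|x| <= r].
Proof.
apply: bounded_closed_compact.
  exists r; split; first exact: num_real.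
  by move=> M rM x /= xr; exact: le_trans xr (ltW rM).
rewrite (_ : [set _ | _] = (@Num.norm R V) @^-1` [set s | s <= r])//.
apply: closed_comp; [by move=> x _; exact: norm_continuous|exact: closed_le].
Qed.

Lemma vanish_compact {K : numFieldType} {W : normedModType K} (r : R) (f : V -> W) :
  (forall x, r < `|x| -> f x = 0) -> compact (supp f) /\ supp f `<=` [set x | `|x| <= r].
Proof.
move=> fr; have S : supp f `<=` [set x : V | `|x| <= r].
  have cl : closed [set x : V | `|x| <= r].
    rewrite (_ : [set _ | _] = (@Num.norm R V) @^-1` [set s | s <= r])//.
    by apply: closed_comp; [move=> x _; exact: norm_continuous|exact: closed_le].
  rewrite [X in _ `<=` X](closure_id _).1 //; apply: closure_subset => x /=.
  by apply: contra_neqT; rewrite -ltNge => /fr.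
split=> //; apply: (@subclosed_compact _ _ [set x : V | `|x| <= r]) => //; [exact: closed_closure|exact: compact_ball].
Qed.

Lemma supp_vanish {K : numFieldType} {W : normedModType K} (r : R) (f : V -> W) :
  supp f `<=` [set x | `|x| <= r] -> forall x, r < `|x| -> f x = 0.
Proof.
move=> S x rx; apply/eqP/negP => /negP fx.
by have := S x (@subset_closure _ _ x fx); rewrite /= leNgt rx.
Qed.

Lemma compact_vanish {K : numFieldType} {W : normedModType K} (f : V -> W) :
  compact (supp f) -> exists2 r : R, 0 <= r & forall x, r < `|x| -> f x = 0.
Proof.
move=> /compact_bounded [M [_ HM]].
exists (Num.max 0 (M + 1)); first by rewrite le_max lexx.
apply: supp_vanish => x fx /=; apply: HM => //.
by rewrite lt_max ltrDl ltr01 orbT.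
Qed.

Lemma continuous_near f x : continuous f -> forall e : R, 0 < e ->
  \forall y \near x, normc (f y - f x) < e.
Proof. by move=> cf e e0; have /(@cvg_normcP _ (nbhs x) (nbhs_filter x)) := cf x; apply. Qed.

(** Heine's theorem on a slightly larger ball: two close points of which one lies
    outside of that ball are both outside of the support. *)
Lemma vanish_ucont (r : R) f : continuous f -> vanish r f -> ucont f.
Proof.
move=> cf fr e e0.
have e20 : 0 < e / 2 by rewrite divr_gt0.
have /compact_near_coveringP/(_ R (0^'+) (fun del x =>
    forall y, `|x - y| < del -> normc (f x - f y) < e) _) := @compact_ball (r + 1).
case.
  move=> x _.
  have /nbhs_ballP[a /= a0 Ha] := continuous_near x cf e20.
  have a20 : 0 < a / 2 by rewrite divr_gt0.
  exists (ball x (a / 2), [set del | del < a / 2]).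
    split => /=; first exact: nbhsx_ballx.
    exact: nbhs_right_lt.
  move=> [x' del] /= [xx' dela] y x'y.
  have H1 : normc (f x' - f x) < e / 2.
    by apply: Ha; apply: le_ball xx'; lra.
  have H2 : normc (f y - f x) < e / 2.
    apply: Ha; rewrite -ball_normE /=; move: xx'; rewrite -ball_normE /= => xx'.
    rewrite -(subrK x' x) -addrA (le_lt_trans (ler_normD _ _))//; lra.
  apply: le_lt_trans (normc_tri (f x) _ _) _; rewrite (normcBC (f x)); lra.
move=> a /= a0 Ha; exists (Num.min (a / 2) 1); first by rewrite lt_min ltr01 divr_gt0.
move=> x y; rewrite lt_min => /andP[xya xy1].
have [xr|xr] := lerP (`|x|) (r + 1).
  apply/ltW; have := Ha (a / 2); apply => //=; rewrite ?divr_gt0//.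
  by rewrite sub0r normrN gtr0_norm ?divr_gt0//; lra.
rewrite !fr ?subrr ?normc0 ?ltW//; last by lra.
have : `|x| <= `|y| + `|x - y| by rewrite -{1}(subrK y x) addrC ler_normD.
lra.
Qed.

Lemma CcP f : Cc f <-> ucont f /\ exists2 r, 0 <= r & vanish r f.
Proof.
split=> [[cf /compact_vanish[r r0 fr]]|[uf [r r0 fr]]].
  by split; [exact: vanish_ucont cf fr|exists r].
by split; [exact: ucont_continuous|exact: (vanish_compact fr).1].
Qed.

Lemma Cc_bound f : Cc f -> exists2 M, 0 <= M & forall x, normc (f x) <= M.
Proof.
move=> [cf cs].
have [r r0 fr] := compact_vanish cs.
have cN : continuous (fun x => normc (f x)).
  move=> x; apply/(@cvgrPdist_le _ _ _ (nbhs x) (nbhs_filter x)) => e e0.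
  have := continuous_near x cf e0; apply: filterS => y H.
  apply: le_trans (ltW H); have H1 := normc_dist (f x) (f y).
  have H2 := normc_dist (f y) (f x); rewrite normcBC in H1.
  by rewrite ler_norml; apply/andP; split; lra.
have /compact_bounded[M [_ HM]] : compact ((fun x => normc (f x)) @` [set x : V | `|x| <= r]).
  by apply: continuous_compact; [exact: continuous_subspaceT|exact: compact_ball].
exists (Num.max 0 (M + 1)); first by rewrite le_max lexx.
move=> x; have [xr|xr] := lerP (`|x|) r; last by rewrite fr// normc0 le_max lexx.
have := HM (Num.max 0 (M + 1)); rewrite lt_max ltrDl ltr01 orbT => /(_ isT (normc (f x))).
by rewrite /= ger0_norm ?normc_ge0//; apply; exists x.
Qed.

Lemma Cc_buc f : Cc f -> buc f.
Proof. by move=> cf; split; [have [M _ ?] := Cc_bound cf; exists M|exact: ((CcP f).1 cf).1]. Qed.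

Lemma bddW f : bdd f -> exists2 M, 0 < M & forall x, normc (f x) <= M.
Proof.
move=> [M fM]; exists (`|M| + 1) => [|x]; first by rewrite ltr_wpDl.
by apply: le_trans (fM x) _; rewrite (le_trans (ler_norm _))// lerDl.
Qed.

Lemma buc_cst (c : C) : buc (fun=> c).
Proof.
split; first by exists (normc c).
by move=> e e0; exists 1 => // x y _; rewrite subrr normc0 ltW.
Qed.

Lemma bucD f g : buc f -> buc g -> buc (fun x => f x + g x).
Proof.
move=> [[M fM] uf] [[N gN] ug]; split.
  by exists (M + N) => x; apply: le_trans (normcD _ _) _; exact: lerD.
move=> e e0; have e20 : 0 < e / 2 by rewrite divr_gt0.
have [a a0 Ha] := uf _ e20; have [b b0 Hb] := ug _ e20.
exists (Num.min a b) => [|x y]; first by rewrite lt_min a0.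
rewrite lt_min => /andP[xa xb]; rewrite opprD addrACA.
by apply: le_trans (normcD _ _) _; have := Ha _ _ xa; have := Hb _ _ xb; lra.
Qed.

Lemma bucM f g : buc f -> buc g -> buc (fun x => f x * g x).
Proof.
move=> [/bddW[M M0 fM] uf] [/bddW[N N0 gN] ug]; split.
  exists (M * N) => x; rewrite normcM2; apply: ler_pM; rewrite ?normc_ge0//.
move=> e e0.
have eN0 : 0 < e / (2 * N) by rewrite divr_gt0// mulr_gt0.
have eM0 : 0 < e / (2 * M) by rewrite divr_gt0// mulr_gt0.
have [a a0 Ha] := uf _ eN0; have [b b0 Hb] := ug _ eM0.
exists (Num.min a b) => [|x y]; first by rewrite lt_min a0.
rewrite lt_min => /andP[xa xb].
have -> : f x * g x - f y * g y = (f x - f y) * g x + f y * (g x - g y) by ring.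
apply: le_trans (normcD _ _) _; rewrite !normcM2.
have H1 : normc (f x - f y) * normc (g x) <= e / (2 * N) * N.
  by apply: ler_pM; rewrite ?normc_ge0//; exact: Ha.
have H2 : normc (f y) * normc (g x - g y) <= M * (e / (2 * M)).
  by apply: ler_pM; rewrite ?normc_ge0//; exact: Hb.
apply: le_trans (lerD H1 H2) _.
have -> : e / (2 * N) * N = e / 2 by field; rewrite gt_eqF.
have -> : M * (e / (2 * M)) = e / 2 by field; rewrite gt_eqF.
lra.
Qed.

Lemma bucZ (c : C) f : buc f -> buc (fun x => c * f x).
Proof. by move=> bf; apply: bucM => //; exact: buc_cst. Qed.

Lemma bucN f : buc f -> buc (fun x => - f x).
Proof.
move=> bf; have := bucZ (- 1) bf.
by under [in X in buc X -> _]eq_fun do rewrite mulN1r.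
Qed.

Lemma bucB f g : buc f -> buc g -> buc (fun x => f x - g x).
Proof. by move=> bf bg; apply: bucD => //; exact: bucN. Qed.

Lemma buc_conj f : buc f -> buc (fun x => conjc (f x)).
Proof.
move=> [[M fM] uf]; split; first by exists M => x; rewrite normcJ.
move=> e e0; have [a a0 Ha] := uf _ e0; exists a => // x y xy.
by rewrite -conjcB normcJ; exact: Ha.
Qed.

Lemma buc_sum I (s : seq I) (F : I -> V -> C) : (forall i, buc (F i)) ->
  buc (fun x => \sum_(i <- s) F i x).
Proof.
move=> bF; elim: s => [|i s IH].
  by under eq_fun do rewrite big_nil; exact: buc_cst.
by under eq_fun do rewrite big_cons; exact: bucD.
Qed.

(** Serves the translations and the reflections of the space at once. *)
Lemma buc_isometry (psi : V -> V) f : (forall x y, `|psi x - psi y| = `|x - y|) ->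
  buc f -> buc (fun x => f (psi x)).
Proof.
move=> Hpsi [[M fM] uf]; split; first by exists M.
by move=> e e0; have [a a0 Ha] := uf _ e0; exists a => // x y xy; apply: Ha; rewrite Hpsi.
Qed.

Lemma buc_translate t f : buc f -> buc (fun x => f (x - t)).
Proof. by apply: buc_isometry => x y; rewrite opprB addrA subrK. Qed.

Lemma buc_reflect t f : buc f -> buc (fun x => f (t - x)).
Proof. by apply: buc_isometry => x y; rewrite opprB addrC addrA subrK distrC. Qed.

Lemma buc_normc f : buc f -> buc (fun x => Complex (normc (f x)) 0).
Proof.
move=> [[M fM] uf]; split.
  by exists M => x; rewrite normc_real ger0_norm ?normc_ge0.
move=> e e0; have [a a0 Ha] := uf _ e0; exists a => // x y xy.
have -> : Complex (normc (f x)) 0 - Complex (normc (f y)) 0 =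
  Complex (normc (f x) - normc (f y)) 0 by simpc.
rewrite normc_real; apply: le_trans (Ha _ _ xy).
have H1 := normc_dist (f x) (f y); have H2 := normc_dist (f y) (f x).
by rewrite normcBC in H2; rewrite ler_norml; apply/andP; split; lra.
Qed.

Lemma buc_lipschitz (phi : R -> R) f : (forall a b, `|phi a - phi b| <= `|a - b|) ->
  buc f -> buc (fun x => Complex (phi (complex.Re (f x))) 0).
Proof.
move=> L [[M fM] uf]; split.
  exists (M + `|phi 0|) => x; rewrite normc_real.
  have := L (complex.Re (f x)) 0; rewrite subr0 => H.
  rewrite -(subrK (phi 0) (phi _)) (le_trans (ler_normD _ _))// lerD2r.
  by apply: le_trans H _; apply: le_trans (Re_le_normc _) _.
move=> e e0; have [a a0 Ha] := uf _ e0; exists a => // x y xy.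
have -> : Complex (phi (complex.Re (f x))) 0 - Complex (phi (complex.Re (f y))) 0 =
  Complex (phi (complex.Re (f x)) - phi (complex.Re (f y))) 0 by simpc.
rewrite normc_real; apply: le_trans (L _ _) _; apply: le_trans (Ha _ _ xy).
by rewrite -ReN -ReD; exact: Re_le_normc.
Qed.

Lemma buc_Re f : buc f -> bcont (fun x => complex.Re (f x)).
Proof.
move=> [[M fM] uf]; split; last by exists M => x; apply: le_trans (Re_le_normc _) _.
move=> x; apply/(@cvgrPdist_lt _ _ _ (nbhs x) (nbhs_filter x)) => e e0.
have := continuous_near x (ucont_continuous uf) e0; apply: filterS => y.
by apply: le_lt_trans; rewrite normcBC -ReN -ReD; exact: Re_le_normc.
Qed.

Lemma buc_Im f : buc f -> bcont (fun x => complex.Im (f x)).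
Proof.
move=> [[M fM] uf]; split; last by exists M => x; apply: le_trans (Im_le_normc _) _.
move=> x; apply/(@cvgrPdist_lt _ _ _ (nbhs x) (nbhs_filter x)) => e e0.
have := continuous_near x (ucont_continuous uf) e0; apply: filterS => y.
by apply: le_lt_trans; rewrite normcBC -ImN -ImD; exact: Im_le_normc.
Qed.

Lemma CcM f g : Cc f -> buc g -> Cc (fun x => f x * g x).
Proof.
move=> cf bg; apply/CcP; split; first exact: (bucM (Cc_buc cf) bg).2.
by have [_ [r r0 fr]] := (CcP f).1 cf; exists r => // x /fr ->; rewrite mul0r.
Qed.

Lemma CcMl f g : buc g -> Cc f -> Cc (fun x => g x * f x).
Proof. by move=> bg cf; under eq_fun do rewrite mulrC; exact: CcM. Qed.

Lemma CcD f g : Cc f -> Cc g -> Cc (fun x => f x + g x).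
Proof.
move=> cf cg; apply/CcP; split; first exact: (bucD (Cc_buc cf) (Cc_buc cg)).2.
have [_ [r r0 fr]] := (CcP f).1 cf; have [_ [s s0 gs]] := (CcP g).1 cg.
exists (Num.max r s) => [|x]; first by rewrite le_max r0.
by rewrite gt_max => /andP[/fr -> /gs ->]; rewrite addr0.
Qed.

Lemma CcZ (c : C) f : Cc f -> Cc (fun x => c * f x).
Proof. by move=> cf; apply: CcMl => //; exact: buc_cst. Qed.

Lemma CcN f : Cc f -> Cc (fun x => - f x).
Proof. by move=> /(CcZ (- 1)); under eq_fun do rewrite mulN1r. Qed.

Lemma CcB f g : Cc f -> Cc g -> Cc (fun x => f x - g x).
Proof. by move=> cf cg; apply: CcD => //; exact: CcN. Qed.

Lemma Cc0 : Cc ((fun=> 0) : V -> C).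
Proof.
by apply/CcP; split; [exact: (buc_cst 0).2|exists 0].
Qed.

Lemma Cc_sum I (s : seq I) (F : I -> V -> C) : (forall i, Cc (F i)) ->
  Cc (fun x => \sum_(i <- s) F i x).
Proof.
move=> bF; elim: s => [|i s IH].
  by under eq_fun do rewrite big_nil; exact: Cc0.
by under eq_fun do rewrite big_cons; exact: CcD.
Qed.

Lemma Cc_conj f : Cc f -> Cc (fun x => conjc (f x) : C).
Proof.
move=> cf; apply/CcP; split; first exact: (buc_conj (Cc_buc cf)).2.
by have [_ [r r0 fr]] := (CcP f).1 cf; exists r => // x /fr ->; rewrite /= oppr0.
Qed.

Lemma Cc_translate t f : Cc f -> Cc (fun x => f (x - t)).
Proof.
move=> cf; apply/CcP; split; first exact: (buc_translate t (Cc_buc cf)).2.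
have [_ [r r0 fr]] := (CcP f).1 cf; exists (r + `|t|) => [|x xr]; first by rewrite addr_ge0.
apply: fr; have : `|x| <= `|x - t| + `|t| by rewrite -{1}(subrK t x) ler_normD.
lra.
Qed.

Lemma Cc_reflect t f : Cc f -> Cc (fun x => f (t - x)).
Proof.
move=> cf; apply/CcP; split; first exact: (buc_reflect t (Cc_buc cf)).2.
have [_ [r r0 fr]] := (CcP f).1 cf; exists (r + `|t|) => [|x xr]; first by rewrite addr_ge0.
apply: fr; have : `|x| <= `|t - x| + `|t|.
  by rewrite -{1}(subKr t x) (le_trans (ler_normB _ _))// addrC.
lra.
Qed.

Lemma Cc_ftilde f : Cc f -> Cc (ftilde f).
Proof.
move=> cf; rewrite /ftilde.
have := Cc_conj (Cc_reflect 0 cf).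
by under eq_fun do rewrite sub0r.
Qed.

Lemma Cc_normc f : Cc f -> Cc (fun x => Complex (normc (f x)) 0 : C).
Proof.
move=> cf; apply/CcP; split; first exact: (buc_normc (Cc_buc cf)).2.
by have [_ [r r0 fr]] := (CcP f).1 cf; exists r => // x /fr ->; rewrite normc0.
Qed.

End function_classes.
(** * Integrals of complex functions *)

Section complex_integral.
Context {R : realType} {d : nat}.
Local Notation V := 'rV[R]_d.
Local Notation C := (R[i]^o).
Implicit Types (f g h : V -> C) (x y t : V) (A B : set V).

Definition cube (r : R) : set V := [set x | `|x| <= r].

Lemma borel_cube r : borel (cube r).
Proof.
apply: borel_closed; rewrite /cube (_ : [set _ | _] = (@Num.norm R V) @^-1` [set s | s <= r])//.
by apply: closed_comp; [move=> x _; exact: norm_continuous|exact: closed_le].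
Qed.

Lemma row_cube r : 0 <= r -> @row_of_tuple R d @^-1` cube r = @box R d r.
Proof.
move=> r0; apply/seteqP; split => t /=; rewrite /cube/=.
  by move/(rV_norm_le _ r0) => H i; have := H i; rewrite !mxE ler_norml.
by move=> H; apply/(rV_norm_le _ r0) => i; rewrite !mxE ler_norml; exact: H.
Qed.

Lemma vol_cube r : 0 <= r -> vol (cube r) = ((2 * r) ^+ d)%:E.
Proof. by move=> r0; rewrite /vol row_cube//; exact: lebesgue_tuple_box. Qed.

Lemma vol_cube_fin r : (vol (cube r) < +oo)%E.
Proof.
have [r0|r0] := leP 0 r; first by rewrite vol_cube// ltry.
rewrite /vol (_ : cube r = set0) ?preimage_set0 ?measure0//.
rewrite -subset0 => x /=; rewrite /cube/= => xr.
by have := le_lt_trans xr r0; rewrite ltNge normr_ge0.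
Qed.

Lemma Re_integral_on A f :
  complex.Re (integral_on A f) = rint A (fun x => complex.Re (f x)).
Proof. by []. Qed.

Lemma bcontZ s (g : V -> R) : bcont g -> bcont (fun x => s * g x).
Proof.
move=> [cg [M gM]]; split; last first.
  by exists (`|s| * M) => x; rewrite normrM ler_wpM2l.
move=> x; have := cg x; exact: (@cvgMl_tmp _ _ (nbhs x) (nbhs_filter x)).
Qed.

Lemma integral_on_eq A f g : (forall x, A x -> f x = g x) ->
  integral_on A f = integral_on A g.
Proof.
by move=> fg; rewrite !integral_onE; congr Complex; apply: rint_eq => x /fg ->.
Qed.

Section finite_volume.
Variables (A : set V) (mA : borel A) (vA : (vol A < +oo)%E).

Lemma integral_onD f g : buc f -> buc g ->
  integral_on A (fun x => f x + g x) = integral_on A f + integral_on A g.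
Proof.
move=> bf bg; rewrite !integral_onE; simpc; congr Complex.
- by rewrite -(rintD mA vA (buc_Re bf) (buc_Re bg)); apply: rint_eq => x _; rewrite ReD.
- by rewrite -(rintD mA vA (buc_Im bf) (buc_Im bg)); apply: rint_eq => x _; rewrite ImD.
Qed.

Lemma integral_onZ (c : C) f : buc f ->
  integral_on A (fun x => c * f x) = c * integral_on A f.
Proof.
move=> bf; case: c => a b; rewrite !integral_onE; simpc.
have [r1 r2] := (buc_Re bf, buc_Im bf).
congr Complex.
- rewrite -mulNr -!(rintZ mA vA)// -(rintD mA vA); [|exact: bcontZ|exact: bcontZ].
  by apply: rint_eq => x _; case: (f x) => u v /=; rewrite mulNr.
- rewrite -!(rintZ mA vA)// -(rintD mA vA); [|exact: bcontZ|exact: bcontZ].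
  by apply: rint_eq => x _; case: (f x) => u v /=.
Qed.

Lemma integral_onN f : buc f -> integral_on A (fun x => - f x) = - integral_on A f.
Proof.
move=> bf; rewrite -mulN1r -integral_onZ//.
by apply: integral_on_eq => x _; rewrite mulN1r.
Qed.

Lemma integral_onB f g : buc f -> buc g ->
  integral_on A (fun x => f x - g x) = integral_on A f - integral_on A g.
Proof. by move=> bf bg; rewrite integral_onD ?integral_onN//; exact: bucN. Qed.

Lemma integral_on_sum I (s : seq I) (F : I -> V -> C) : (forall i, buc (F i)) ->
  integral_on A (fun x => \sum_(i <- s) F i x) = \sum_(i <- s) integral_on A (F i).
Proof.
move=> bF; elim: s => [|i s IH].
  rewrite big_nil integral_onE; congr Complex;
    by rewrite (rint_eq (g := fun=> 0)) ?rint_cst ?mul0r// => x _; rewrite big_nil.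
rewrite big_cons -IH -integral_onD//; last exact: buc_sum.
by apply: integral_on_eq => x _; rewrite big_cons.
Qed.

Lemma integral_on_cst (c : C) : integral_on A (fun=> c) = c * Complex (fine (vol A)) 0.
Proof. by rewrite integral_onE !rint_cst//; case: c => a b; simpc. Qed.

(** The triangle inequality for complex integrals follows from the real one
    applied to the integrand rotated by the phase of the integral. *)
Lemma normc_integral_on_le f (g : V -> R) : buc f -> bcont g ->
  (forall x, A x -> normc (f x) <= g x) -> normc (integral_on A f) <= rint A g.
Proof.
move=> bf bg fg; have [z zE] : exists z, z = integral_on A f by exists (integral_on A f).
rewrite -zE; have I0 : 0 <= rint A g.
  by apply: rint_ge0 => x Ax; apply: le_trans (fg x Ax); exact: normc_ge0.
have [z0|z0] := leP (normc z) 0; first exact: le_trans z0 I0.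
rewrite -(ler_pM2l z0) -expr2.
have <- : complex.Re (integral_on A (fun x => conjc z * f x)) = normc z ^+ 2.
  by rewrite integral_onZ// -zE mulrC mulcJ.
rewrite Re_integral_on -rintZ//.
apply: rint_le => //; [exact: buc_Re (bucZ _ bf)|exact: bcontZ|].
move=> x Ax; apply: le_trans (ler_norm _) _; apply: le_trans (Re_le_normc _) _.
by rewrite normcM2 normcJ ler_wpM2l ?normc_ge0//; exact: fg.
Qed.

Lemma normc_integral_on f M : buc f -> (forall x, A x -> normc (f x) <= M) ->
  normc (integral_on A f) <= M * fine (vol A).
Proof.
move=> bf fM; rewrite -rint_cst//; apply: normc_integral_on_le => //.
by split; [exact: cst_continuous|exists `|M|].
Qed.

End finite_volume.

Lemma integral_on_supp A B f : A `<=` B -> (forall x, ~ A x -> f x = 0) ->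
  integral_on B f = integral_on A f.
Proof.
by move=> AB f0; rewrite !integral_onE; congr Complex; apply: rint_supp => // x /f0 ->.
Qed.

Lemma integral_Rd_cube r f : vanish r f -> integral_Rd f = integral_on (cube r) f.
Proof.
move=> fr; apply: integral_on_supp => // x; rewrite /cube /= => xr.
by apply: fr; rewrite ltNge; apply/negP.
Qed.

Lemma integral_on_split A B f : borel A -> borel B -> (vol A < +oo)%E -> buc f ->
  integral_on A f = integral_on (A `&` B) f + integral_on (A `\` B) f.
Proof.
move=> mA mB vA bf; rewrite !integral_onE; simpc; congr Complex; apply: rint_split => //.
- exact: buc_Re.
- exact: buc_Im.
Qed.

Lemma integral_on_translate t A f : borel A -> (vol A < +oo)%E -> buc f ->
  integral_on [set y : V | A (y + t)] (fun y => f (y + t)) = integral_on A f.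
Proof.
move=> mA vA bf; rewrite !integral_onE; congr Complex.
- by rewrite -(rint_translate t mA vA (buc_Re bf)).
- by rewrite -(rint_translate t mA vA (buc_Im bf)).
Qed.

Lemma integral_on_oppose A f : borel A -> (vol A < +oo)%E -> buc f ->
  integral_on [set y : V | A (- y)] (fun y => f (- y)) = integral_on A f.
Proof.
move=> mA vA bf; rewrite !integral_onE; congr Complex.
- by rewrite -(rint_oppose mA vA (buc_Re bf)).
- by rewrite -(rint_oppose mA vA (buc_Im bf)).
Qed.

Lemma integral_Rd_translate t f : Cc f -> integral_Rd (fun x => f (x + t)) = integral_Rd f.
Proof.
move=> cf; have [_ [r r0 fr]] := (CcP f).1 cf.
rewrite (integral_Rd_cube fr) -(integral_on_translate t (borel_cube r) (vol_cube_fin r) (Cc_buc cf)).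
apply: integral_on_supp => // x /= xr; apply: fr.
by rewrite ltNge; apply/negP.
Qed.

Lemma integral_Rd_oppose f : Cc f -> integral_Rd (fun x => f (- x)) = integral_Rd f.
Proof.
move=> cf; have [_ [r r0 fr]] := (CcP f).1 cf.
rewrite (integral_Rd_cube fr) -(integral_on_oppose (borel_cube r) (vol_cube_fin r) (Cc_buc cf)).
apply: integral_on_supp => // x /= xr; apply: fr.
by rewrite ltNge; apply/negP.
Qed.

Lemma vanish_le r s f : r <= s -> vanish r f -> vanish s f.
Proof. by move=> rs fr x sx; apply: fr; exact: le_lt_trans sx. Qed.

Lemma integral_RdD f g : Cc f -> Cc g ->
  integral_Rd (fun x => f x + g x) = integral_Rd f + integral_Rd g.
Proof.
move=> cf cg; have [_ [r r0 fr]] := (CcP f).1 cf; have [_ [s s0 gs]] := (CcP g).1 cg.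
have fm : vanish (Num.max r s) f by apply: vanish_le fr; rewrite le_max lexx.
have gm : vanish (Num.max r s) g by apply: vanish_le gs; rewrite le_max lexx orbT.
rewrite (integral_Rd_cube fm) (integral_Rd_cube gm) -integral_onD; first last.
- exact: Cc_buc.
- exact: Cc_buc.
- exact: vol_cube_fin.
- exact: borel_cube.
by rewrite -integral_Rd_cube// => x xm; rewrite fm// gm// addr0.
Qed.

Lemma integral_RdZ (c : C) f : Cc f -> integral_Rd (fun x => c * f x) = c * integral_Rd f.
Proof.
move=> cf; have [_ [r r0 fr]] := (CcP f).1 cf.
rewrite (integral_Rd_cube fr) -integral_onZ; [|exact: borel_cube|exact: vol_cube_fin|exact: Cc_buc].
by rewrite -integral_Rd_cube// => x xm; rewrite fr// mulr0.
Qed.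

Lemma integral_Rd_ext f g : f =1 g -> integral_Rd f = integral_Rd g.
Proof. by move=> fg; congr integral_Rd; apply/funext. Qed.

Lemma integral_RdN f : Cc f -> integral_Rd (fun x => - f x) = - integral_Rd f.
Proof.
move=> cf; rewrite -mulN1r -integral_RdZ//.
by apply: integral_Rd_ext => x; rewrite mulN1r.
Qed.

Lemma integral_RdB f g : Cc f -> Cc g ->
  integral_Rd (fun x => f x - g x) = integral_Rd f - integral_Rd g.
Proof. by move=> cf cg; rewrite integral_RdD ?integral_RdN//; exact: CcN. Qed.

Lemma integral_Rd0 : integral_Rd ((fun=> 0) : V -> C) = 0.
Proof.
transitivity (integral_Rd (fun x : V => 0 * ((fun=> 0) : V -> C) x)).
  by apply: integral_Rd_ext => x; rewrite mul0r.
by rewrite integral_RdZ ?mul0r//; exact: Cc0.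
Qed.

Lemma integral_Rd_sum I (s : seq I) (F : I -> V -> C) : (forall i, Cc (F i)) ->
  integral_Rd (fun x => \sum_(i <- s) F i x) = \sum_(i <- s) integral_Rd (F i).
Proof.
move=> bF; elim: s => [|i s IH].
  rewrite big_nil; transitivity (integral_Rd ((fun=> 0) : V -> C)).
    by apply: integral_Rd_ext => x; rewrite big_nil.
  exact: integral_Rd0.
rewrite big_cons -IH -integral_RdD//; last exact: Cc_sum.
by apply: integral_Rd_ext => x; rewrite big_cons.
Qed.

Definition nint f : R := complex.Re (integral_Rd (fun x => Complex (normc (f x)) 0)).

Lemma nintE r f : vanish r f -> nint f = rint (cube r) (fun x => normc (f x)).
Proof.
move=> fr; rewrite /nint (integral_Rd_cube (r := r)) ?integral_onE//.
by move=> x /fr ->; rewrite normc0.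
Qed.

Lemma nint_ge0 f : 0 <= nint f.
Proof. by rewrite /nint /integral_Rd integral_onE /=; apply: rint_ge0 => x _; exact: normc_ge0. Qed.

Lemma normc_integral_Rd_le f g : Cc f -> Cc g ->
  (forall x, normc (f x) <= complex.Re (g x)) ->
  normc (integral_Rd f) <= complex.Re (integral_Rd g).
Proof.
move=> cf cg fg; have [_ [r r0 fr]] := (CcP f).1 cf; have [_ [s s0 gs]] := (CcP g).1 cg.
have fm : vanish (Num.max r s) f by apply: vanish_le fr; rewrite le_max lexx.
have gm : vanish (Num.max r s) g by apply: vanish_le gs; rewrite le_max lexx orbT.
rewrite (integral_Rd_cube fm) (integral_Rd_cube gm) [in leRHS]integral_onE /=.
apply: normc_integral_on_le => //; [exact: borel_cube|exact: vol_cube_fin|exact: Cc_buc|].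
exact: buc_Re (Cc_buc cg).
Qed.

Lemma integral_Rd_conj f : Cc f ->
  integral_Rd (fun x => conjc (f x)) = conjc (integral_Rd f).
Proof.
move=> cf; have [_ [r r0 fr]] := (CcP f).1 cf.
have cfr : vanish r (fun x => conjc (f x)) by move=> x /fr ->; rewrite /= oppr0.
rewrite (integral_Rd_cube fr) (integral_Rd_cube cfr) !integral_onE /=; congr Complex.
- by apply: rint_eq => x _; rewrite ReJ.
- rewrite -mulN1r -rintZ; [|exact: borel_cube|exact: vol_cube_fin|exact: buc_Im (Cc_buc cf)].
  by apply: rint_eq => x _; rewrite ImJ mulN1r.
Qed.

End complex_integral.

#[global] Arguments integral_on : simpl never.
#[global] Arguments integral_Rd : simpl never.
(** * Characters and Riemann sums *)

Section characters.
Context {R : realType} {d : nat}.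
Local Notation V := 'rV[R]_d.
Local Notation C := (R[i]^o).
Implicit Types (f g h : V -> C) (x y t : V) (A B : set V).

Lemma dotpC x y : dotp x y = dotp y x.
Proof. by apply: eq_bigr => i _; rewrite mulrC. Qed.

Lemma dotpDl x x' y : dotp (x + x') y = dotp x y + dotp x' y.
Proof. by rewrite -big_split; apply: eq_bigr => i _; rewrite mxE mulrDl. Qed.

Lemma dotpNl x y : dotp (- x) y = - dotp x y.
Proof. by rewrite -sumrN; apply: eq_bigr => i _; rewrite mxE mulNr. Qed.

Lemma dotp0l y : dotp 0 y = 0.
Proof. by apply: big1 => i _; rewrite mxE mul0r. Qed.

Lemma dotp_le x y : `|dotp x y| <= d%:R * (`|x| * `|y|).
Proof.
apply: le_trans (ler_norm_sum _ _ _) _.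
have -> : d%:R * (`|x| * `|y|) = \sum_(i < d) `|x| * `|y|.
  by rewrite sumr_const card_ord mulr_natl.
by apply: ler_sum => i _; rewrite normrM; apply: ler_pM => //; exact: coord_le_norm.
Qed.

Lemma chiC x y : chi y x = chi x y.
Proof. by rewrite /chi dotpC. Qed.

Lemma chiD y x x' : chi y (x + x') = chi y x * chi y x'.
Proof.
rewrite /chi dotpDl mulrDr cosD sinD; apply/eqP; rewrite eq_complex /=.
by apply/andP; split; apply/eqP; ring.
Qed.

Lemma chi0 y : chi y 0 = 1.
Proof. by rewrite /chi dotp0l mulr0 cos0 sin0. Qed.

Lemma chiN y x : chi y (- x) = conjc (chi y x).
Proof. by rewrite /chi dotpNl mulrN cosN sinN. Qed.

Lemma chiB y x x' : chi y (x - x') = chi y x * conjc (chi y x').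
Proof. by rewrite chiD chiN. Qed.

Lemma chiNl y x : chi (- y) x = conjc (chi y x).
Proof. by rewrite chiC chiN chiC. Qed.

Lemma chiDl y y' x : chi (y + y') x = chi y x * chi y' x.
Proof. by rewrite chiC chiD !(chiC x). Qed.

Lemma chiBl y y' x : chi (y - y') x = chi y x * conjc (chi y' x).
Proof. by rewrite chiC chiB !(chiC x). Qed.

Lemma normc_chi y x : normc (chi y x) = 1.
Proof. by rewrite normc_def /= cos2Dsin2 sqrtr1. Qed.

Lemma chi_conj y x : chi y x * conjc (chi y x) = 1.
Proof. by rewrite mulcJ normc_chi expr1n. Qed.

(** Stated symmetrically in x and y, since it gives the uniform continuity both of
    characters and of Fourier transforms. *)
Lemma chi_near1 (e : R) : 0 < e ->
  exists2 del, 0 < del & forall x y, `|x| * `|y| < del -> normc (chi y x - 1) <= e.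
Proof.
move=> e0; have e20 : 0 < e / 2 by rewrite divr_gt0.
have /cvgrPdist_lt/(_ _ e20) := @continuous_cos R 0.
move=> /nbhs_ballP[a /= a0 Ha].
have /cvgrPdist_lt/(_ _ e20) := @continuous_sin R 0.
move=> /nbhs_ballP[b /= b0 Hb].
have c0 : 0 < Num.min a b by rewrite lt_min a0.
have pi0 := pi_gt0 R.
have D0 : 0 < 2 * pi * (d%:R + 1) :> R by rewrite !mulr_gt0// ltr_wpDl// ler0n.
exists (Num.min a b / (2 * pi * (d%:R + 1))); first by rewrite divr_gt0.
move=> x y; rewrite ltr_pdivlMr// => xy.
have H : `|2 * pi * dotp x y| < Num.min a b.
  apply: le_lt_trans xy; rewrite normrM gtr0_norm ?mulr_gt0//.
  rewrite [leRHS]mulrC -[leRHS]mulrA ler_pM2l ?mulr_gt0//.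
  apply: le_trans (dotp_le _ _) _.
  by rewrite ler_wpM2r ?mulr_ge0// lerDl.
move: H; rewrite lt_min => /andP[Ha' Hb'].
have H1 : `|1 - cos (2 * pi * dotp x y)| < e / 2.
  by have := Ha (2 * pi * dotp x y); rewrite /ball/= sub0r normrN cos0; apply.
have H2 : `|sin (2 * pi * dotp x y)| < e / 2.
  have := Hb (2 * pi * dotp x y); rewrite /ball/= sub0r normrN sin0 => /(_ Hb').
  by rewrite sub0r normrN.
apply: le_trans (normc_le_sum _) _.
rewrite ReD ImD ReN ImN /= oppr0 addr0 distrC; lra.
Qed.

Lemma buc_chi y : buc (chi y).
Proof.
split; first by exists 1 => x; rewrite normc_chi.
move=> e e0; have [a a0 Ha] := chi_near1 e0.
exists (a / (`|y| + 1)) => [|x x' xx']; first by rewrite divr_gt0// ltr_wpDl.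
have -> : chi y x - chi y x' = chi y x' * (chi y (x - x') - 1).
  rewrite mulrBr mulr1 chiB mulrCA chi_conj mulr1//.
rewrite normcM2 normc_chi mul1r; apply: Ha.
move: xx'; rewrite ltr_pdivlMr ?ltr_wpDl//; apply: le_lt_trans.
by rewrite ler_wpM2l// lerDl.
Qed.

Lemma integral_cube_chi r y : 0 <= r -> integral_on (cube r) (chi y) =
  Complex (\prod_(i < d) dirichlet r (2 * pi * y ord0 i)) 0.
Proof.
move=> r0; rewrite integral_onE /rint.
have [H1 H2] := Rintegral_box_trig (fun i => 2 * pi * y ord0 i) r0.
have E (t : d.-tuple (measurableTypeR R)) : 2 * pi * dotp (row_of_tuple t) y = tdot (fun i => 2 * pi * y ord0 i) t.
  rewrite /dotp /tdot mulr_sumr; apply: eq_bigr => i _; rewrite mxE.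
  by rewrite mulrA mulrAC.
rewrite row_cube// -H1 -H2; congr Complex; apply: eq_Rintegral => t _; by rewrite /chi /= E.
Qed.

Lemma compact_net (A : set V) (U : V -> set V) : compact A ->
  (forall x, A x -> open (U x) /\ U x x) ->
  exists s : seq V, (forall x, x \in s -> A x) /\ forall x, A x -> exists2 c, c \in s & U c x.
Proof.
rewrite compact_cover => cA AU.
have [|x Ax|D AD cD] := cA V A U; first by move=> x /AU[].
  by exists x => //; have [] := AU x Ax.
exists (finmap.enum_fset D); split=> [x xD|x /cD [c cD' Ux]].
  by have := AD x; rewrite inE; apply.
by exists c.
Qed.

Lemma open_ball_norm c (e : R) : open [set x : V | `|x - c| < e].
Proof.
have [e0|e0] := ltP 0 e; last first.
  rewrite (_ : [set _ | _] = set0); first exact: open0.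
  by rewrite -subset0 => x /= xc; have := lt_le_trans xc e0; rewrite ltNge normr_ge0.
rewrite (_ : [set _ | _] = ball c e); first exact: ball_open.
by apply/seteqP; split => x /=; rewrite -ball_normE/= distrC.
Qed.

Lemma rint_eq0 (g : V -> R) : rint (set0 : set V) g = 0.
Proof. by rewrite /rint preimage_set0 Rintegral_set0. Qed.

Lemma integral_on0 f : integral_on (set0 : set V) f = 0.
Proof. by rewrite integral_onE !rint_eq0. Qed.

(** Riemann sums: with respect to a weight, an integral over a bounded set is a
    finite combination of values of the integrand, with an error controlled by
    the oscillation alone; so one combination serves a whole family of
    integrands. *)
Lemma riemann_sum_step f (l : seq V) (del : R) A :
  buc f -> borel A -> (vol A < +oo)%E ->
  (forall x, A x -> exists2 c, c \in l & `|x - c| < del / 2) ->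
  exists s : seq (C * V),
    [/\ forall p, p \in s -> A p.2,
        \sum_(p <- s) normc p.1 <= rint A (fun x => normc (f x)) &
        forall (k : V -> C) (e : R), 0 <= e -> buc (fun x => f x * k x) ->
          (forall x y, A x -> A y -> `|x - y| < del -> normc (k x - k y) <= e) ->
          normc (integral_on A (fun x => f x * k x) - \sum_(p <- s) p.1 * k p.2)
            <= e * rint A (fun x => normc (f x))].
Proof.
move=> bf; have bN : bcont (fun x => normc (f x)) := buc_Re (buc_normc bf).
elim: l A => [|c l IH] A mA vA Hl.
  have -> : A = set0 by rewrite -subset0 => x /Hl[].
  exists [::]; split; first by [].
    by rewrite big_nil rint_eq0.
  by move=> k e e0 _ _; rewrite integral_on0 big_nil subr0 normc0 rint_eq0 mulr0.
pose B := [set x : V | `|x - c| < del / 2].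
have mB : borel B by apply: borel_open; exact: open_ball_norm.
have vAB : (vol (A `\` B) < +oo)%E.
  apply: le_lt_trans vA; apply: le_measure; rewrite ?inE//; first exact: borelD.
  by move=> t [].
have vAI : (vol (A `&` B) < +oo)%E.
  apply: le_lt_trans vA; apply: le_measure; rewrite ?inE//; first exact: borelI.
  by move=> t [].
have [||s [sA sN Hs]] := IH (A `\` B) _ vAB; first exact: borelD.
  move=> x [Ax nBx]; have [b] := Hl x Ax; rewrite inE => /orP[/eqP ->|bl] xb //.
  by exists b.
have NA := rint_split mA mB vA bN.
have [E0|[a [Aa Ba]]] : A `&` B = set0 \/ exists a, A a /\ B a.
- have [->|/set0P[a [? ?]]] := eqVneq (A `&` B) set0; [by left|by right; exists a].
- rewrite E0 rint_eq0 add0r in NA; exists s; rewrite NA; split=> //.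
    by move=> p /sA[].
  move=> k e e0 bk Hk; rewrite (integral_on_split mA mB vA bk) E0 integral_on0 add0r.
  apply: Hs => // x y [Ax _] [Ay _]; exact: Hk.
exists ((integral_on (A `&` B) f, a) :: s); split.
- by move=> p; rewrite inE => /orP[/eqP ->|/sA[]].
- rewrite big_cons NA; apply: lerD => //=; apply: normc_integral_on_le => //; exact: borelI.
- move=> k e e0 bk Hk; rewrite (integral_on_split mA mB vA bk) big_cons /= opprD addrACA NA mulrDr.
  apply: le_trans (normcD _ _) _; apply: lerD; last first.
    by apply: Hs => // x y [Ax _] [Ay _]; exact: Hk.
  have mI := borelI mA mB.
  rewrite [_ * k a]mulrC -integral_onZ// -integral_onB//; last exact: bucZ.
  rewrite -rintZ//; apply: normc_integral_on_le => //.
  - by apply: bucB => //; exact: bucZ.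
  - exact: bcontZ.
  - move=> x [Ax Bx]; rewrite [k a * _]mulrC -mulrBr normcM2 mulrC ler_wpM2r ?normc_ge0//.
    apply: Hk => //; rewrite -(subrK c x) -addrA (le_lt_trans (ler_normD _ _))//.
    by move: Bx Ba; rewrite /B /= => H1 H2; rewrite [ `|c - a|]distrC; lra.
Qed.

Lemma riemann_sum f r (del : R) : ucont f -> vanish r f -> 0 < del ->
  exists s : seq (C * V),
    [/\ forall p, p \in s -> `|p.2| <= r,
        \sum_(p <- s) normc p.1 <= nint f &
        forall (k : V -> C) (e : R), 0 <= e -> Cc (fun x => f x * k x) ->
          (forall x y, `|x| <= r -> `|y| <= r -> `|x - y| < del -> normc (k x - k y) <= e) ->
          normc (integral_Rd (fun x => f x * k x) - \sum_(p <- s) p.1 * k p.2)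
            <= e * nint f].
Proof.
move=> uf fr del0; have del20 : 0 < del / 2 by rewrite divr_gt0.
have cf : Cc f.
  apply/CcP; split=> //; exists (Num.max 0 r); first by rewrite le_max lexx.
  by apply: vanish_le fr; rewrite le_max lexx orbT.
have [l [_ Hl]] := @compact_net (cube r) (fun c => [set x | `|x - c| < del / 2]) (@compact_ball R d r)
  (fun x _ => conj (@open_ball_norm x _) (ltac:(by rewrite /= subrr normr0) : `|x - x| < del / 2)).
have [s [sA sN Hs]] := riemann_sum_step (Cc_buc cf) (borel_cube r) (vol_cube_fin r) Hl.
exists s; rewrite (nintE fr); split=> // k e e0 ck Hk.
rewrite (@integral_Rd_cube _ _ r); last by move=> x xr; rewrite fr// mul0r.
by apply: Hs => //; exact: Cc_buc.
Qed.

End characters.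
(** * Measures and convolutions *)

Section measures.
Context {R : realType} {d : nat}.
Local Notation V := 'rV[R]_d.
Local Notation C := (R[i]^o).
Implicit Types (f g h : V -> C) (x y t : V) (A B : set V) (nu : (V -> C) -> C).

Lemma sup_norm_le f (M : R) : (forall x, normc (f x) <= M) -> sup_norm f <= M.
Proof. by move=> fM; apply: ge_sup; [exists (normc (f 0)), 0|move=> _ [x _ <-]]. Qed.

Lemma le_sup_norm f x : bdd f -> normc (f x) <= sup_norm f.
Proof.
move=> [M fM]; apply: sup_upper_bound; last by exists x.
by split; [exists (normc (f 0)), 0|exists M => _ [y _ <-]].
Qed.

Section linear.
Variables (nu : (V -> C) -> C) (mnu : is_measure nu).

Lemma meas_bound r : exists2 M, 0 <= M & forall h (B : R), Cc h -> vanish r h ->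
  (forall x, normc (h x) <= B) -> normc (nu h) <= M * B.
Proof.
have [_ /(_ _ (@compact_ball R d r))[M HM]] := mnu.
exists (Num.max M 0) => [|h B ch hr hB]; first by rewrite le_max lexx orbT.
have S0 : 0 <= sup_norm h.
  by apply: le_trans (le_sup_norm 0 (Cc_buc ch).1); exact: normc_ge0.
apply: le_trans (HM h ch (vanish_compact hr).2) _.
apply: (@le_trans _ _ (Num.max M 0 * sup_norm h)).
  by apply: ler_wpM2r => //; rewrite le_max lexx.
by apply: ler_wpM2l; [rewrite le_max lexx orbT|exact: sup_norm_le].
Qed.

Lemma measZD (a : C) f g : Cc f -> Cc g -> nu (fun x => a * f x + g x) = a * nu f + nu g.
Proof. by case: mnu => H _; exact: H. Qed.

Lemma meas0 : nu (fun=> 0) = 0.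
Proof.
have := measZD (- 1) Cc0 Cc0; under eq_fun do rewrite mulr0 addr0.
by rewrite mulN1r addNr.
Qed.

Lemma measD f g : Cc f -> Cc g -> nu (fun x => f x + g x) = nu f + nu g.
Proof. by move=> cf cg; have := measZD 1 cf cg; under eq_fun do rewrite mul1r; rewrite mul1r. Qed.

Lemma measZ (a : C) f : Cc f -> nu (fun x => a * f x) = a * nu f.
Proof.
by move=> cf; have := measZD a cf Cc0; under eq_fun do rewrite addr0; rewrite meas0 addr0.
Qed.

Lemma measN f : Cc f -> nu (fun x => - f x) = - nu f.
Proof. by move=> cf; have := measZ (- 1) cf; under eq_fun do rewrite mulN1r; rewrite mulN1r. Qed.

Lemma measB f g : Cc f -> Cc g -> nu (fun x => f x - g x) = nu f - nu g.
Proof. by move=> cf cg; rewrite measD ?measN//; exact: CcN. Qed.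

Lemma meas_sum I (s : seq I) (F : I -> V -> C) : (forall i, Cc (F i)) ->
  nu (fun x => \sum_(i <- s) F i x) = \sum_(i <- s) nu (F i).
Proof.
move=> cF; elim: s => [|i s IH].
  by rewrite big_nil; under eq_fun do rewrite big_nil; exact: meas0.
rewrite big_cons -IH -measD//; last exact: Cc_sum.
by under eq_fun do rewrite big_cons.
Qed.

End linear.

Lemma is_measureI nu :
  (forall (a : C) f g, Cc f -> Cc g -> nu (fun x => a * f x + g x) = a * nu f + nu g) ->
  (forall r, exists M, forall h (B : R), Cc h -> vanish r h ->
    (forall x, normc (h x) <= B) -> normc (nu h) <= M * B) -> is_measure nu.
Proof.
move=> L H; split=> // K /compact_bounded [r [_ Hr]].
have [M HM] := H (r + 1); exists M => f cf fK; apply: HM => //.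
  apply: supp_vanish => x /fK Kx /=; apply: Hr => //; lra.
by move=> x; apply: le_sup_norm; exact: (Cc_buc cf).1.
Qed.

(** Local uniform continuity. As a measure is only bounded on functions supported
    in a fixed compact set, this is all that holds in general for the pairings
    of a measure with the translates of a function; see [luc_meas]. *)
Definition luc (k : V -> C) := forall r e : R, 0 < e ->
  exists2 del, 0 < del & forall x y, `|x| <= r -> `|y| <= r -> `|x - y| < del ->
    normc (k x - k y) <= e.

Lemma Cc_luc f k : Cc f -> luc k -> Cc (fun x => f x * k x).
Proof.
move=> cf uk; have [uf [r r0 fr]] := (CcP f).1 cf.
split; last by apply: (vanish_compact (r := r) _).1 => x /fr ->; rewrite mul0r.
move=> x; apply/(@cvg_normcP _ _ (nbhs x) (nbhs_filter x)) => e e0.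
have [M M0 fM] := Cc_bound cf; pose K := normc (k x) + 1.
have K0 : 0 < K by rewrite ltr_wpDl// normc_ge0.
have eM : 0 < e / (4 * (M + 1)) by rewrite divr_gt0// mulr_gt0// ltr_wpDl.
have eK : 0 < e / (4 * K) by rewrite divr_gt0// mulr_gt0.
have [a a0 Ha] := uk (`|x| + 1) _ eM; have [b b0 Hb] := uf _ eK.
apply/nbhs_ballP; exists (Num.min 1 (Num.min a b)).
  by rewrite /= !lt_min ltr01 a0.
move=> y; rewrite -ball_normE /= distrC !lt_min => /and3P[xy1 xya xyb].
have -> : f y * k y - f x * k x = f y * (k y - k x) + (f y - f x) * k x by ring.
apply: le_lt_trans (normcD _ _) _; rewrite !normcM2.
have yx : `|y| <= `|x| + 1.
  by rewrite -(subrK x y) addrC (le_trans (ler_normD _ _))// lerD2l ltW.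
have H1 : normc (f y) * normc (k y - k x) <= (M + 1) * (e / (4 * (M + 1))).
  apply: ler_pM; rewrite ?normc_ge0//; first by apply: le_trans (fM y) _; lra.
  by apply: Ha => //; lra.
have H2 : normc (f y - f x) * normc (k x) <= e / (4 * K) * K.
  by apply: ler_pM; rewrite ?normc_ge0//; [exact: Hb|rewrite /K lerDl].
have E1 : (M + 1) * (e / (4 * (M + 1))) = e / 4 by field; rewrite gt_eqF// ltr_wpDl.
have E2 : e / (4 * K) * K = e / 4 by field; rewrite gt_eqF.
rewrite E1 in H1; rewrite E2 in H2; lra.
Qed.

Lemma vanish_translate r s t f : vanish r f -> `|t| <= s -> vanish (r + s) (fun z => f (z - t)).
Proof.
move=> fr ts x xr; apply: fr; have : `|x| <= `|x - t| + `|t| by rewrite -{1}(subrK t x) ler_normD.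
lra.
Qed.

Lemma luc_meas nu g : is_measure nu -> Cc g -> luc (fun y => nu (fun z => g (z - y))).
Proof.
move=> mnu cg r e e0; have [ug [s s0 gs]] := (CcP g).1 cg.
have [M M0 HM] := meas_bound mnu (s + r).
have e1 : 0 < e / (M + 1) by rewrite divr_gt0// ltr_wpDl.
have [del del0 Hd] := ug _ e1; exists del => // x y xr yr xy.
rewrite -measB//; [|exact: Cc_translate|exact: Cc_translate].
apply: le_trans (HM _ (e / (M + 1)) _ _ _) _.
- by apply: CcB; exact: Cc_translate.
- by move=> z zr; rewrite !(vanish_translate gs _ zr)// subrr.
- by move=> z; apply: Hd; rewrite opprB addrC addrA subrK distrC.
- by rewrite mulrCA ger_pMr// ler_pdivrMr ?ltr_wpDl// mul1r lerDl.
Qed.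

Lemma Cc_conv_integrand f g x : Cc f -> Cc g -> Cc (fun y => f y * g (x - y)).
Proof. by move=> cf cg; apply: CcM => //; apply: buc_reflect; exact: Cc_buc. Qed.

Lemma normc_integral_mul f k (B : R) : Cc f -> Cc (fun x => f x * k x) ->
  (forall x, f x != 0 -> normc (k x) <= B) ->
  normc (integral_Rd (fun x => f x * k x)) <= B * nint f.
Proof.
move=> cf cfk kB; have cN := Cc_normc cf.
have -> : B * nint f = complex.Re (integral_Rd (fun x => Complex B 0 * Complex (normc (f x)) 0)).
  by rewrite integral_RdZ// /nint; case: (integral_Rd _) => u v; simpc.
apply: normc_integral_Rd_le; [exact: cfk|exact: CcZ|].
move=> x; rewrite normcM2 ReM /= mul0r subr0 mulrC.
have [->|fx] := eqVneq (f x) 0; first by rewrite normc0 !mulr0.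
by rewrite ler_wpM2r ?normc_ge0// kB.
Qed.

Lemma vanish_conv r s f g : vanish r f -> vanish s g -> vanish (r + s) (convolution f g).
Proof.
move=> fr gs x xrs; rewrite -[RHS](@integral_Rd0 R d); apply: integral_Rd_ext => y.
have [yr|yr] := ltP r (`|y|); first by rewrite fr// mul0r.
rewrite gs ?mulr0//; have : `|x| <= `|x - y| + `|y| by rewrite -{1}(subrK y x) ler_normD.
lra.
Qed.

Lemma Cc_conv f g : Cc f -> Cc g -> Cc (convolution f g).
Proof.
move=> cf cg; have [uf [r r0 fr]] := (CcP f).1 cf; have [ug [s s0 gs]] := (CcP g).1 cg.
apply/CcP; split; last by exists (r + s); [exact: addr_ge0|exact: vanish_conv].
move=> e e0; have e1 : 0 < e / (nint f + 1) by rewrite divr_gt0// ltr_wpDl// nint_ge0.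
have [del del0 Hd] := ug _ e1; exists del => // x x' xx'.
rewrite -integral_RdB; [|exact: Cc_conv_integrand|exact: Cc_conv_integrand].
have E y : f y * g (x - y) - f y * g (x' - y) = f y * (g (x - y) - g (x' - y)) by rewrite mulrBr.
rewrite (integral_Rd_ext E); apply: le_trans (normc_integral_mul (B := e / (nint f + 1)) cf _ _) _.
- by under eq_fun do rewrite -E; apply: CcB; exact: Cc_conv_integrand.
- by move=> y _; apply: Hd; rewrite opprB addrA subrK.
- by rewrite mulrAC -mulrA ger_pMr// ler_pdivrMr ?ltr_wpDl ?nint_ge0// mul1r lerDl.
Qed.

Lemma convC f g x : Cc f -> Cc g -> convolution f g x = convolution g f x.
Proof.
move=> cf cg; have cI := Cc_conv_integrand x cf cg.
have cT : Cc (fun y => f (y + x) * g (x - (y + x))).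
  have := Cc_translate (- x) cI; by under eq_fun do rewrite opprK.
rewrite /convolution -(integral_Rd_translate x cI) -(integral_Rd_oppose cT).
apply: integral_Rd_ext => y; rewrite mulrC (addrC (- y)); congr (_ * _).
by rewrite opprB addrC subrK.
Qed.

(** Fubini's theorem for a measure and the Lebesgue measure. Finite combinations
    of translates of g, supported in a fixed compact set, approximate the
    convolution uniformly, and a measure is continuous for this convergence. *)
Lemma meas_conv nu f g : is_measure nu -> Cc f -> Cc g ->
  nu (convolution f g) = integral_Rd (fun y => f y * nu (fun z => g (z - y))).
Proof.
move=> mnu cf cg; have [uf [r r0 fr]] := (CcP f).1 cf; have [ug [s s0 gs]] := (CcP g).1 cg.
have [M M0 HM] := meas_bound mnu (r + s).
have lk := luc_meas mnu cg; have cfk := Cc_luc cf lk.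
apply/subr0_eq/normc_le0/ler_addgt0Pl => e e0; rewrite addr0.
pose a := e / ((nint f + 1) * (M + 1)).
have D0 : 0 < (nint f + 1) * (M + 1) by rewrite mulr_gt0// ltr_wpDl// nint_ge0.
have a0 : 0 < a / 2 by rewrite !divr_gt0.
have [d1 d10 H1] := ug _ a0; have [d2 d20 H2] := lk r _ a0.
have a10 : 0 < a / 2 by [].
have d0 : 0 < Num.min d1 d2 by rewrite lt_min d10.
have [l [lr lN Hl]] := riemann_sum uf fr d0.
pose S (k : V -> C) := \sum_(p <- l) p.1 * k p.2.
have K1 : normc (integral_Rd (fun y => f y * nu (fun z => g (z - y))) - S (fun y => nu (fun z => g (z - y)))) <= a / 2 * nint f.
  apply: Hl => //; first exact: ltW.
  by move=> x y xr yr; rewrite lt_min => /andP[_ ?]; exact: H2.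
have K2 x : normc (convolution f g x - S (fun y => g (x - y))) <= a / 2 * nint f.
  apply: Hl => //; [exact: ltW|exact: Cc_conv_integrand|].
  move=> y y' _ _; rewrite lt_min => /andP[yy _]; apply: H1.
  by rewrite opprB addrC addrA subrK distrC.
have cS : Cc (fun x => S (fun y => g (x - y))).
  by apply: Cc_sum => p; apply: CcZ; exact: Cc_translate.
have SE : nu (fun x => S (fun y => g (x - y))) = S (fun y => nu (fun z => g (z - y))).
  rewrite /S meas_sum//; last by move=> p; apply: CcZ; exact: Cc_translate.
  by apply: eq_bigr => p _; rewrite measZ//; exact: Cc_translate.
have K3 : normc (nu (convolution f g) - S (fun y => nu (fun z => g (z - y)))) <= M * (a / 2 * nint f).
  have cfg := Cc_conv cf cg.
  rewrite -SE -(measB mnu cfg cS).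
  apply: HM; [exact: CcB| |exact: K2].
  move=> x xr; rewrite (vanish_conv fr gs)// /S big_seq big1 ?subrr// => p pl.
  have := vanish_translate gs (lr p pl) (x := x); rewrite addrC => -> //.
  by rewrite mulr0.
apply: le_trans (normc_tri (S (fun y => nu (fun z => g (z - y)))) _ _) _.
rewrite [X in _ + X]normcBC; apply: le_trans (lerD K3 K1) _.
have -> : M * (a / 2 * nint f) + a / 2 * nint f = ((M + 1) * nint f / 2) * a by field.
have -> : e = (nint f + 1) * (M + 1) * a by rewrite /a mulrC divfK// gt_eqF.
apply: ler_wpM2r; first by have := a0; lra.
have := nint_ge0 f; have : 0 <= nint f * M by rewrite mulr_ge0// nint_ge0.
nra.
Qed.

Lemma is_measure_density u : buc u -> is_measure (fun f => integral_Rd (fun x => f x * u x)).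
Proof.
move=> bu; apply: is_measureI => [a f g cf cg|r].
  rewrite -integral_RdZ; last exact: CcM.
  rewrite -integral_RdD; [|by apply: CcZ; exact: CcM|exact: CcM].
  by apply: integral_Rd_ext => x; rewrite mulrDl mulrA.
have [M M0 uM] := bddW bu.1; exists (M * fine (vol (@cube R d r))) => h B ch hr hB.
have B0 : 0 <= B by apply: le_trans (hB 0); exact: normc_ge0.
rewrite (@integral_Rd_cube _ _ r); last by move=> x /hr ->; rewrite mul0r.
rewrite mulrAC; apply: normc_integral_on; [exact: borel_cube|exact: vol_cube_fin|exact/Cc_buc/CcM|].
move=> x _; rewrite normcM2 mulrC; apply: ler_pM; rewrite ?normc_ge0//.
Qed.

Lemma is_measure_reflect nu x : is_measure nu -> is_measure (fun f => nu (fun z => f (x - z))).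
Proof.
move=> mnu; apply: is_measureI => [a f g cf cg|r].
  by rewrite measZD//; exact: Cc_reflect.
have [M M0 HM] := meas_bound mnu (r + `|x|); exists M => h B ch hr hB.
apply: HM => [|z zr|z]; [exact: Cc_reflect| |exact: hB].
apply: hr; have : `|z| <= `|x - z| + `|x|.
  by rewrite -{1}(subKr x z) (le_trans (ler_normB _ _))// addrC.
lra.
Qed.

Lemma is_measure_mul nu u : is_measure nu -> buc u -> is_measure (fun f => nu (fun z => u z * f z)).
Proof.
move=> mnu bu; apply: is_measureI => [a f g cf cg|r].
  by rewrite -measZD; [congr nu; apply/funext => x; ring|done|exact: CcMl|exact: CcMl].
have [M M0 HM] := meas_bound mnu r; have [N N0 uN] := bddW bu.1; exists (M * N) => h B ch hr hB.
rewrite -mulrA; apply: HM => [|z zr|z]; [exact: CcMl|by rewrite hr// mulr0|].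
by rewrite normcM2; apply: ler_pM; rewrite ?normc_ge0.
Qed.

Lemma conv_measure_conv nu f g x : is_measure nu -> Cc f -> Cc g ->
  conv_measure (convolution f g) nu x =
  integral_Rd (fun y => f y * conv_measure g nu (x - y)).
Proof.
move=> mnu cf cg; rewrite /conv_measure (meas_conv (is_measure_reflect x mnu) cf cg).
apply: integral_Rd_ext => y; congr (_ * nu _).
by apply/funext => z; rewrite addrAC.
Qed.

Lemma fcheck_conv f g y : Cc f -> Cc g ->
  fcheck (convolution f g) y = fcheck f y * fcheck g y.
Proof.
move=> cf cg; rewrite /fcheck.
rewrite (meas_conv (is_measure_density (buc_chi y)) cf cg) mulrC -integral_RdZ; last by apply: CcM => //; exact: buc_chi.
apply: integral_Rd_ext => z; rewrite mulrCA; congr (_ * _).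
have cgc : Cc (fun x => g x * chi y x) by apply: CcM => //; exact: buc_chi.
rewrite mulrC -integral_RdZ// -[RHS](@integral_Rd_translate _ _ (- z)); last exact: CcZ.
apply: integral_Rd_ext => x; rewrite chiB mulrCA; congr (_ * _).
by rewrite mulrCA chi_conj mulr1.
Qed.

Lemma fcheck_ftilde f y : Cc f -> fcheck (ftilde f) y = conjc (fcheck f y).
Proof.
move=> cf; rewrite /fcheck.
have cc : Cc (fun x => f x * chi y x) by apply: CcM => //; exact: buc_chi.
rewrite -integral_Rd_conj// -[RHS]integral_Rd_oppose//; last exact: Cc_conj.
by apply: integral_Rd_ext => x; rewrite /ftilde conjcM2 chiN conjcK2.
Qed.

Lemma fcheck_autocorrelation f y : Cc f ->
  fcheck (convolution f (ftilde f)) y = Complex (normc (fcheck f y) ^+ 2) 0.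
Proof. by move=> cf; rewrite fcheck_conv ?fcheck_ftilde ?mulcJ//; exact: Cc_ftilde. Qed.

Lemma normc_fcheck f y : Cc f -> normc (fcheck f y) <= nint f.
Proof.
move=> cf; rewrite -[leRHS]mul1r; apply: normc_integral_mul => //.
  by apply: CcM => //; exact: buc_chi.
by move=> x _; rewrite normc_chi.
Qed.

Lemma buc_fcheck f : Cc f -> buc (fcheck f).
Proof.
move=> cf; have cc y : Cc (fun x => f x * chi y x) by apply: CcM => //; exact: buc_chi.
have [uf [r r0 fr]] := (CcP f).1 cf; split; first by exists (nint f) => y; exact: normc_fcheck.
move=> e e0; have e1 : 0 < e / (nint f + 1) by rewrite divr_gt0// ltr_wpDl// nint_ge0.
have [del del0 Hd] := @chi_near1 R d _ e1.
exists (del / (r + 1)) => [|y y' yy']; first by rewrite divr_gt0// ltr_wpDl.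
rewrite /fcheck -integral_RdB//.
have E x : f x * chi y x - f x * chi y' x = f x * (chi y x - chi y' x) by rewrite mulrBr.
rewrite (integral_Rd_ext E); apply: le_trans (normc_integral_mul (B := e / (nint f + 1)) cf _ _) _.
- by under eq_fun do rewrite -E; exact: CcB.
- move=> x fx; have xr : `|x| <= r.
    by rewrite leNgt; apply/negP => /fr fx0; rewrite fx0 eqxx in fx.
  have -> : chi y x - chi y' x = chi y' x * (chi (y - y') x - 1).
    by rewrite mulrBr mulr1 chiBl mulrCA chi_conj mulr1.
  rewrite normcM2 normc_chi mul1r; apply: Hd.
  move: yy'; rewrite ltr_pdivlMr ?ltr_wpDl//; apply: le_lt_trans.
  by rewrite mulrC ler_wpM2l//; lra.
- by rewrite mulrAC -mulrA ger_pMr// ler_pdivrMr ?ltr_wpDl ?nint_ge0// mul1r lerDl.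
Qed.

End measures.
(** * Uniform approximation by trigonometric polynomials *)

#[global] Arguments chi : simpl never.
Section trigonometric_approximation.
Context {R : realType} {d : nat}.
Local Notation V := 'rV[R]_d.
Local Notation C := (R[i]^o).
Implicit Types (f g h : V -> C) (x y t z : V).

Lemma sin_natpi n : sin (n%:R * pi) = 0 :> R.
Proof.
elim: n => [|n IH]; first by rewrite mul0r sin0.
by rewrite -natr1 mulrDl mul1r sinD IH mul0r sinpi mulr0 addr0.
Qed.

Lemma sin_intpi (k : int) : sin (k%:~R * pi) = 0 :> R.
Proof.
case: k => n; first exact: sin_natpi.
by rewrite NegzE mulrNz mulNr sinN sin_natpi oppr0.
Qed.

Lemma one_subr_cos (a : R) : 1 - cos (2 * a) = 2 * sin a ^+ 2.
Proof. by rewrite mulr_natl cos_mulr2n; have := cos2Dsin2 a; lra. Qed.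

(** The frequencies of the characters with period [2 * r] in each coordinate, that
    is of the characters of a torus. *)
Definition dual_lattice (r : R) y := forall i, exists k : int, y ord0 i * (2 * r) = k%:~R.

Lemma dual_latticeB r y y' : dual_lattice r y -> dual_lattice r y' -> dual_lattice r (y - y').
Proof.
move=> Hy Hy' i; have [k Hk] := Hy i; have [k' Hk'] := Hy' i.
by exists (k - k'); rewrite !mxE mulrBl Hk Hk' rmorphB.
Qed.

Definition cube_avg (r : R) f : C := Complex (((2 * r) ^+ d)^-1) 0 * integral_on (cube r) f.

Section avg.
Variables (r : R) (r0 : 0 < r).

Lemma cube_avgD f g : buc f -> buc g ->
  cube_avg r (fun x => f x + g x) = cube_avg r f + cube_avg r g.
Proof.
by move=> bf bg; rewrite /cube_avg (integral_onD (borel_cube r) (vol_cube_fin r) bf bg) mulrDr.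
Qed.

Lemma cube_avgZ c f : buc f -> cube_avg r (fun x => c * f x) = c * cube_avg r f.
Proof.
by move=> bf; rewrite /cube_avg (integral_onZ (borel_cube r) (vol_cube_fin r) c bf) mulrCA.
Qed.

Lemma cube_avgB f g : buc f -> buc g ->
  cube_avg r (fun x => f x - g x) = cube_avg r f - cube_avg r g.
Proof.
by move=> bf bg; rewrite /cube_avg (integral_onB (borel_cube r) (vol_cube_fin r) bf bg) mulrBr.
Qed.

Lemma cube_avg_sum I (s : seq I) (F : I -> V -> C) : (forall i, buc (F i)) ->
  cube_avg r (fun x => \sum_(i <- s) F i x) = \sum_(i <- s) cube_avg r (F i).
Proof.
by move=> bF; rewrite /cube_avg (integral_on_sum (borel_cube r) (vol_cube_fin r))// mulr_sumr.
Qed.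

Lemma cube_avg_eq f g : (forall x, `|x| <= r -> f x = g x) -> cube_avg r f = cube_avg r g.
Proof. by move=> fg; congr (_ * _); apply: integral_on_eq. Qed.

Let V0 : 0 < (2 * r) ^+ d. Proof. by rewrite exprn_gt0// mulr_gt0. Qed.

Lemma cube_avg_cst c : cube_avg r (fun=> c) = c.
Proof.
rewrite /cube_avg (integral_on_cst (borel_cube r)).
rewrite vol_cube ?ltW//= mulrCA -[RHS]mulr1; congr (_ * _).
by simpc; rewrite mulVf ?gt_eqF.
Qed.

Lemma normc_cube_avg f g : buc f -> buc g ->
  (forall x, `|x| <= r -> normc (f x) <= complex.Re (g x)) ->
  normc (cube_avg r f) <= complex.Re (cube_avg r g).
Proof.
move=> bf bg fg; rewrite /cube_avg normcM2 normc_real ReM /= mul0r subr0.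
have V1 : 0 <= (2 * r) ^- d by rewrite invr_ge0 ltW.
rewrite (ger0_norm V1); apply: (ler_wpM2l V1).
exact: (normc_integral_on_le (borel_cube r) (vol_cube_fin r) bf (buc_Re bg)).
Qed.

Lemma cube_avg_chi y : dual_lattice r y -> cube_avg r (chi y) = if y == 0 then 1 else 0.
Proof.
move=> ly; case: eqVneq => [->|y0].
  by rewrite -[RHS](cube_avg_cst 1); apply: cube_avg_eq => x _; rewrite chiC chi0.
have [i yi] : exists i, y ord0 i != 0.
  apply/existsP; apply: contraNT y0; rewrite negb_exists => /forallP H.
  by apply/eqP/rowP => i; rewrite mxE; apply/eqP; rewrite -[_ == _]negbK.
rewrite /cube_avg integral_cube_chi ?ltW// (bigD1 i)//= dirichletE//; last first.
  by rewrite mulf_neq0// mulf_neq0// gt_eqF// pi_gt0.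
have [k Hk] := ly i.
have -> : 2 * pi * y ord0 i * r = k%:~R * pi by rewrite -Hk; ring.
by rewrite sin_intpi mulr0 !mul0r -[Complex 0 0]/(0 : C) mulr0.
Qed.

Lemma cube_avg_chi_reflect y z : dual_lattice r y ->
  cube_avg r (fun t => chi y (z - t)) = if y == 0 then 1 else 0.
Proof.
move=> ly; transitivity (cube_avg r (fun t => chi y z * chi (- y) t)).
  by apply: cube_avg_eq => t _; rewrite chiB chiNl.
rewrite cube_avgZ; last exact: buc_chi.
rewrite cube_avg_chi; last by have := dual_latticeB (y := 0) _ ly; rewrite sub0r; apply => i; exists 0; rewrite mxE mul0r.
by rewrite oppr_eq0; case: eqVneq => [->|_]; rewrite ?mulr0// mulr1 chiC chi0.
Qed.

Section fejer.
Variable m : nat.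
Local Notation W := {ffun 'I_d -> 'I_m.+1}.
Local Notation n := (m.+1%:R : R).

Definition freq (j : W) : V := \row_i ((j i : nat)%:R / (2 * r)).

Let r20 : 2 * r != 0. Proof. by rewrite mulf_neq0// gt_eqF. Qed.

Lemma dual_lattice_freq j : dual_lattice r (freq j).
Proof. by move=> i; exists ((j i : nat)%:Z); rewrite mxE divfK. Qed.

Lemma freq_inj : injective freq.
Proof.
move=> j l /rowP H; apply/ffunP => i; have := H i; rewrite !mxE => /(mulIf _) E.
by apply: val_inj; apply: (@mulrIn R 1) => //; apply: E; rewrite invr_eq0.
Qed.

Definition fejer x : R := normc (\sum_(j : W) chi (freq j) x) ^+ 2 / n ^+ d.

Lemma fejer_ge0 x : 0 <= fejer x.
Proof. by rewrite divr_ge0 ?sqr_ge0 ?exprn_ge0 ?ler0n. Qed.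

Lemma fejerE x : Complex (fejer x) 0 =
  Complex ((n ^+ d)^-1) 0 * \sum_(j : W) \sum_(l : W) chi (freq j - freq l) x.
Proof.
have -> : \sum_(j : W) \sum_(l : W) chi (freq j - freq l) x =
    (\sum_(j : W) chi (freq j) x) * conjc (\sum_(j : W) chi (freq j) x) :> R[i].
  rewrite conjc_sum mulr_suml; apply: eq_bigr => j _; rewrite mulr_sumr.
  by apply: eq_bigr => l _; rewrite chiBl.
by rewrite mulcJ /fejer; simpc; rewrite mulrC.
Qed.

Lemma buc_fejer z : buc (fun t => Complex (fejer (z - t)) 0).
Proof.
under eq_fun do rewrite fejerE.
apply: bucZ; apply: buc_sum => j; apply: buc_sum => l; apply: buc_reflect; exact: buc_chi.
Qed.

Lemma cube_avg_fejer_mul y z : dual_lattice r y ->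
  cube_avg r (fun t => Complex (fejer (z - t)) 0 * chi y (z - t)) =
  Complex ((n ^+ d)^-1 * \sum_(j : W) \sum_(l : W) ((freq j - freq l + y == 0)%:R)) 0.
Proof.
move=> ly; transitivity (cube_avg r (fun t => Complex ((n ^+ d)^-1) 0 *
   \sum_(j : W) \sum_(l : W) chi (freq j - freq l + y) (z - t))).
  apply: cube_avg_eq => t _; rewrite fejerE -mulrA mulr_suml; congr (_ * _).
  by apply: eq_bigr => j _; rewrite mulr_suml; apply: eq_bigr => l _; rewrite -chiDl.
have bc j l : buc (fun t => chi (freq j - freq l + y) (z - t)).
  by apply: buc_reflect; exact: buc_chi.
rewrite cube_avgZ; last by apply: buc_sum => j; exact: buc_sum.
rewrite cube_avg_sum; last by move=> j; exact: buc_sum.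
have -> : \sum_(j : W) cube_avg r (fun t => \sum_(l : W) chi (freq j - freq l + y) (z - t)) =
    Complex (\sum_(j : W) \sum_(l : W) ((freq j - freq l + y == 0)%:R)) 0.
  rewrite -[RHS]/((_)%:C%C) rmorph_sum; apply: eq_bigr => j _.
  rewrite cube_avg_sum// rmorph_sum; apply: eq_bigr => l _.
  rewrite cube_avg_chi_reflect; first by case: eqP.
  rewrite -[y]opprK; apply: dual_latticeB.
    by apply: dual_latticeB; exact: dual_lattice_freq.
  by have := dual_latticeB (y := 0) _ ly; rewrite sub0r; apply => i; exists 0; rewrite mxE mul0r.
by simpc.
Qed.

Lemma cube_avg_fejer z : cube_avg r (fun t => Complex (fejer (z - t)) 0) = 1.
Proof.
have l0 : dual_lattice r 0 by move=> i; exists 0; rewrite mxE mul0r.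
have := cube_avg_fejer_mul z l0.
have -> : cube_avg r (fun t => Complex (fejer (z - t)) 0 * chi 0 (z - t)) =
    cube_avg r (fun t => Complex (fejer (z - t)) 0).
  by apply: cube_avg_eq => t _; rewrite chiC chi0 mulr1.
move=> ->; have -> : \sum_(j : W) \sum_(l : W) ((freq j - freq l + 0 == 0)%:R) = n ^+ d.
  transitivity (\sum_(j : W) (1 : R)).
    apply: eq_bigr => j _; rewrite (bigD1 j)//= addr0 subrr eqxx big1 ?addr0// => l lj.
    rewrite addr0 subr_eq0; case: eqVneq => // /freq_inj jl; by rewrite jl eqxx in lj.
  by rewrite sumr_const card_ffun !card_ord natrX.
by rewrite mulVf// expf_neq0// pnatr_eq0.
Qed.

Definition basis_freq (i : 'I_d) : V := \row_k ((k == i)%:R / (2 * r)).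

Lemma dual_lattice_basis i : dual_lattice r (basis_freq i).
Proof. by move=> k; exists ((k == i : nat)%:Z); rewrite mxE divfK//; case: eqP. Qed.

(** Adding a basis vector takes a proportion m / m.+1 of the frequencies of the
    kernel to frequencies of the kernel. *)
Lemma cube_avg_fejer_basis z i :
  1 - n^-1 <= complex.Re (cube_avg r (fun t => Complex (fejer (z - t)) 0 * chi (basis_freq i) (z - t))).
Proof.
rewrite cube_avg_fejer_mul /=; last exact: dual_lattice_basis.
have n0 : n != 0 by rewrite pnatr_eq0.
pose b (k : 'I_d) (c : 'I_m.+1) : R := if k == i then (c != ord_max)%:R else 1.
have E : \sum_(j : W) \prod_k b k (j k) = n ^+ d * (1 - n^-1).
  rewrite -bigA_distr_bigA /=.
  have Ei (k : 'I_d) : \sum_(c < m.+1) b k c = n * (if k == i then 1 - n^-1 else 1).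
    rewrite /b; case: eqP => _; last by rewrite sumr_const card_ord mulr1.
    rewrite big_ord_recr /= eqxx /= addr0 mulrBr mulr1 mulfV// -natr1 addrK.
    rewrite (eq_bigr (fun=> 1)) ?sumr_const ?card_ord// => c _.
    case: eqP => // /(congr1 val) /= cm; have := ltn_ord c; by rewrite cm ltnn.
  rewrite (eq_bigr _ (fun k _ => Ei k)) big_split /= prodr_const card_ord; congr (_ * _).
  by rewrite (bigD1 i)//= eqxx big1 ?mulr1// => k /negbTE ->.
have -> : 1 - n^-1 = (n ^+ d)^-1 * \sum_(j : W) \prod_k b k (j k).
  by rewrite E mulKf// expf_neq0.
rewrite ler_wpM2l ?invr_ge0 ?exprn_ge0 ?ler0n//.
apply: ler_sum => j _.
have -> : \prod_k b k (j k) = (j i != ord_max)%:R.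
  by rewrite (bigD1 i)//= /b eqxx big1 ?mulr1// => k /negbTE ->.
case: (eqVneq (j i) ord_max) => [_|ji] /=; first by apply: sumr_ge0 => l _; rewrite ler0n.
pose l : W := [ffun k => if k == i then inord (j i).+1 else j k].
rewrite (bigD1 l)//= (_ : (_ == 0) = true) /=; first by rewrite lerDl sumr_ge0.
apply/eqP/rowP => k; rewrite !mxE ffunE; case: (eqVneq k i) => [->|ki] /=; last by rewrite mul0r addr0 subrr.
have Hin : (inord (j i).+1 : 'I_m.+1) = (j i).+1 :> nat.
  rewrite inordK//; have := ltn_ord (j i); rewrite ltnS leq_eqVlt => /orP[/eqP E'|//].
  by exfalso; move/negP: ji; apply; apply/eqP/val_inj.
by rewrite Hin -natr1; field; rewrite gt_eqF.
Qed.

End fejer.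

(** Near the diagonal of the torus or at a definite distance from it, the
    oscillation of a function that vanishes near the boundary of the cube is
    controlled by the test functions of Korovkin's theorem. *)
Lemma korovkin_bound (rho e : R) f : ucont f -> vanish rho f -> 0 <= rho -> rho < r -> 0 < e ->
  exists2 K : R, 0 <= K & forall t z, `|t| <= r -> `|z| <= r ->
    normc (f z - f t) <= e + K * \sum_(i < d) (1 - complex.Re (chi (basis_freq i) (z - t))).
Proof.
move=> uf fv rho0 rhor e0.
have cf : Cc f by apply/CcP; split=> //; exists rho.
have [B B0 fB] := Cc_bound cf; have [del del0 Hd] := uf e e0.
pose eta := Num.min del (r - rho).
have eta0 : 0 < eta by rewrite lt_min del0 subr_gt0.
have etar : eta <= r by rewrite /eta ge_min; apply/orP; right; lra.
have pi0 := pi_gt0 R.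
pose a0 := pi * eta / (2 * r).
have a00 : 0 < a0 by rewrite /a0 divr_gt0 ?mulr_gt0.
have a0p : a0 <= pi - a0.
  have -> : pi - a0 = a0 + pi * (r - eta) / r by rewrite /a0; field; rewrite gt_eqF.
  rewrite lerDl; apply: divr_ge0; last exact: ltW.
  by apply: mulr_ge0; [exact: ltW|rewrite subr_ge0].
have [c cI Hc] := @EVT_min R sin _ _ a0p (continuous_subspaceT (@continuous_sin R)).
have sc0 : 0 < sin c.
  by apply: sin_gt0_pi; move: cI; rewrite in_itv/= => /andP[? ?]; apply/andP; split; lra.
pose K := (2 * B) / (2 * sin c ^+ 2).
have K0 : 0 <= K by rewrite /K; apply: divr_ge0; apply: mulr_ge0 => //; exact: sqr_ge0.
have term (u : R) : 1 - cos (2 * (pi * u / (2 * r))) = 2 * sin (pi * u / (2 * r)) ^+ 2.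
  exact: one_subr_cos.
exists K => // t z tr zr.
have T i : 1 - complex.Re (chi (basis_freq i) (z - t)) = 2 * sin (pi * (z - t) ord0 i / (2 * r)) ^+ 2.
  rewrite -term (_ : complex.Re _ = cos (2 * pi * dotp (z - t) (basis_freq i)))//; congr (1 - cos _).
  rewrite /dotp (bigD1 i)//= big1 ?addr0; last by move=> k ki; rewrite !mxE (negbTE ki) mul0r mulr0.
  by rewrite !mxE eqxx /=; field; rewrite gt_eqF.
have S0 : 0 <= \sum_(i < d) (1 - complex.Re (chi (basis_freq i) (z - t))).
  by apply: sumr_ge0 => i _; rewrite T mulr_ge0// sqr_ge0.
have [zt|zt] := ltP (`|z - t|) del.
  by apply: le_trans (Hd _ _ zt) _; rewrite lerDl mulr_ge0.
have [/existsP[i /andP[i1 i2]]|] := boolP [exists i, (eta <= `|(z - t) ord0 i|) && (`|(z - t) ord0 i| <= 2 * r - eta)].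
  apply: le_trans (normcB _ _) _; apply: (@le_trans _ _ (2 * B)); first by have := fB z; have := fB t; lra.
  apply: (@le_trans _ _ (K * (1 - complex.Re (chi (basis_freq i) (z - t))))); last first.
    apply: ler_wpDl; first exact: ltW.
    rewrite ler_wpM2l// (bigD1 i)//= lerDl; apply: sumr_ge0 => k _; by rewrite T mulr_ge0// sqr_ge0.
  rewrite T; set u := (z - t) ord0 i in i1 i2 *.
  have -> : sin (pi * u / (2 * r)) ^+ 2 = sin (pi * `|u| / (2 * r)) ^+ 2.
    by case: (lerP 0 u) => u0; [rewrite ger0_norm|rewrite ltr0_norm// mulrN mulNr sinN sqrrN].
  have : sin c <= sin (pi * `|u| / (2 * r)).
    apply: Hc; rewrite in_itv /= /a0 !ler_pM2r ?invr_gt0 ?mulr_gt0// ler_pM2l//; apply/andP; split=> //.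
    have -> : pi - pi * eta / (2 * r) = pi * (2 * r - eta) / (2 * r) by field; rewrite gt_eqF.
    by rewrite ler_pM2r ?invr_gt0 ?mulr_gt0// ler_pM2l.
  move=> sc; have sq : sin c ^+ 2 <= sin (pi * `|u| / (2 * r)) ^+ 2 by rewrite ler_pXn2r// ?nnegrE; lra.
  have D0 : 0 < 2 * sin c ^+ 2 by apply: mulr_gt0 => //; exact: exprn_gt0.
  have -> : 2 * B = K * (2 * sin c ^+ 2) by rewrite /K divfK// gt_eqF.
  by apply: ler_wpM2l => //; lra.
rewrite negb_exists => /forallP H.
have far : exists i, 2 * r - (r - rho) < `|(z - t) ord0 i|.
  have [|[i zi]] : `|z - t| = 0 \/ exists i, `|z - t| = `|(z - t) ord0 i|.
    have [E0|/mx_norm_neq0[[i0 i] /= zi]] := eqVneq (mx_norm (z - t)) 0; first by left; exact: E0.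
    by right; exists i; rewrite [LHS]zi; congr (`| _ |); rewrite (ord1 i0).
  - by move=> E; rewrite E in zt; lra.
  - exists i; have := H i; rewrite -zi (le_trans _ zt) /=; last by rewrite ge_min lexx.
    rewrite -ltNge => H1; apply: le_lt_trans H1; rewrite lerD2l lerN2 ge_min lexx orbT//.
have [i Hi] := far.
have Hz := le_trans (coord_le_norm z i) zr; have Ht := le_trans (coord_le_norm t i) tr.
have Hzt : `|(z - t) ord0 i| <= `|z ord0 i| + `|t ord0 i| by rewrite !mxE ler_normB.
have -> : f z = 0 by apply: fv; apply: lt_le_trans (coord_le_norm z i); lra.
have -> : f t = 0 by apply: fv; apply: lt_le_trans (coord_le_norm t i); lra.
by rewrite subrr normc0; apply: addr_ge0; [exact: ltW|exact: mulr_ge0].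
Qed.

Definition trig_poly (s : seq (C * V)) x : C := \sum_(p <- s) p.1 * chi p.2 x.

Lemma buc_trig_poly s : buc (trig_poly s).
Proof. by apply: buc_sum => p; apply: bucZ; exact: buc_chi. Qed.

(** The approximation is the convolution on the torus with the Fejer kernel. The
    kernel is positive and has average one, whence the bound B; and it integrates
    the test functions of [korovkin_bound] to at most 1 / m.+1. *)
Lemma fejer_approx (rho e B : R) f : ucont f -> vanish rho f -> 0 <= rho -> rho < r -> 0 < e ->
  (forall x, normc (f x) <= B) ->
  exists s : seq (C * V),
    [/\ forall p, p \in s -> dual_lattice r p.2,
        forall x, normc (trig_poly s x) <= B &
        forall x, `|x| <= r -> normc (f x - trig_poly s x) <= e].
Proof.
move=> uf fv rho0 rhor e0 fB.
have e20 : 0 < e / 2 by rewrite divr_gt0.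
have cf : Cc f by apply/CcP; split=> //; exists rho.
have bf := Cc_buc cf.
have [K K0 HK] := korovkin_bound uf fv rho0 rhor e20.
have [m Hm] : exists m : nat, K * d%:R * m.+1%:R^-1 <= e / 2.
  have p0 : 0 < e / 2 / (K * d%:R + 1) by rewrite divr_gt0// ltr_wpDl// mulr_ge0// ler0n.
  have := ltr_add_invr (y := 0) p0; case=> m; rewrite add0r => Hm; exists m.
  apply: (@le_trans _ _ ((K * d%:R + 1) * m.+1%:R^-1)).
    by rewrite ler_wpM2r ?invr_ge0 ?ler0n// lerDl.
  by rewrite mulrC -ler_pdivlMr ?ltW// ltr_wpDl// mulr_ge0// ler0n.
pose W := {ffun 'I_d -> 'I_m.+1}.
pose coef (p : W * W) : C := Complex ((m.+1%:R ^+ d)^-1) 0 *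
   cube_avg r (fun t => f t * conjc (chi (freq p.1 - freq p.2) t)).
pose s : seq (C * V) := [seq (coef p, freq p.1 - freq p.2) | p <- enum {: W * W}].
have sE z : trig_poly s z = cube_avg r (fun t => f t * Complex (fejer m (z - t)) 0).
  rewrite /trig_poly big_map big_enum /=.
  under [in RHS](@eq_fun V) => t do rewrite fejerE mulrCA.
  have bb (p : W * W) : buc (fun t => f t * chi (freq p.1 - freq p.2) (z - t)).
    by apply: bucM => //; apply: buc_reflect; exact: buc_chi.
  transitivity (Complex ((m.+1%:R ^+ d)^-1) 0 *
     cube_avg r (fun t => \sum_(p : W * W) f t * chi (freq p.1 - freq p.2) (z - t))).
    rewrite (cube_avg_sum _ bb). rewrite mulr_sumr; apply: eq_bigr => p _; rewrite /coef -mulrA; congr (_ * _).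
    rewrite mulrC -cube_avgZ; last first.
      by apply: bucM => //; apply: buc_conj; exact: buc_chi.
    by apply: cube_avg_eq => t _; rewrite chiB mulrCA.
  rewrite -cube_avgZ; last exact: buc_sum.
  apply: cube_avg_eq => t _; congr (_ * _); rewrite pair_big /= mulr_sumr.
  by apply: eq_bigr.
exists s; split.
- move=> p /mapP[q _ ->] /=; apply: dual_latticeB; exact: dual_lattice_freq.
- move=> z; rewrite sE.
  apply: le_trans (normc_cube_avg (g := fun t => Complex B 0 * Complex (fejer m (z - t)) 0) _ _ _) _.
  + by apply: bucM => //; exact: buc_fejer.
  + by apply: bucZ; exact: buc_fejer.
  + move=> x _; rewrite normcM2 ReM normc_real /= mul0r subr0 ger0_norm ?fejer_ge0//.
    by rewrite ler_wpM2r ?fejer_ge0.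
  + by rewrite cube_avgZ ?cube_avg_fejer ?mulr1//; exact: buc_fejer.
- move=> z zr; rewrite sE.
  have -> : f z = cube_avg r (fun t => f z * Complex (fejer m (z - t)) 0).
    by rewrite cube_avgZ ?cube_avg_fejer ?mulr1//; exact: buc_fejer.
  rewrite -cube_avgB; [|by apply: bucZ; exact: buc_fejer|by apply: bucM => //; exact: buc_fejer].
  pose G t := Complex (e / 2) 0 * Complex (fejer m (z - t)) 0 + \sum_(i < d) Complex K 0 *
     (Complex (fejer m (z - t)) 0 - Complex (fejer m (z - t)) 0 * chi (basis_freq i) (z - t)).
  have bfc i : buc (fun t => Complex (fejer m (z - t)) 0 * chi (basis_freq i) (z - t)).
    by apply: bucM; [exact: buc_fejer|apply: buc_reflect; exact: buc_chi].
  have bt i : buc (fun t => Complex K 0 * (Complex (fejer m (z - t)) 0 - Complex (fejer m (z - t)) 0 * chi (basis_freq i) (z - t))).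
    by apply: bucZ; apply: bucB => //; exact: buc_fejer.
  have bG : buc G by apply: bucD; [by apply: bucZ; exact: buc_fejer|exact: buc_sum].
  apply: le_trans (normc_cube_avg _ bG _) _.
  + apply: bucB; [by apply: bucZ; exact: buc_fejer|by apply: bucM => //; exact: buc_fejer].
  + move=> t tr; rewrite -mulrBl normcM2 normc_real ger0_norm ?fejer_ge0//.
    have -> : complex.Re (G t) = (e / 2 + K * \sum_(i < d) (1 - complex.Re (chi (basis_freq i) (z - t)))) * fejer m (z - t).
      rewrite /G ReD [X in X + _]ReM [complex.Re (Complex _ _)]/= [complex.Im (Complex _ _)]/= [complex.Re (Complex _ _)]/= mul0r subr0 mulrDl; congr (_ + _).
      rewrite Re_sum -mulrA mulr_suml mulr_sumr; apply: eq_bigr => i _.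
      by rewrite ReM ReD ReN ReM /= !mul0r !subr0; ring.
    by rewrite ler_wpM2r ?fejer_ge0//; exact: HK.
  + rewrite /G cube_avgD; [|by apply: bucZ; exact: buc_fejer|exact: buc_sum].
    rewrite cube_avgZ ?cube_avg_fejer ?mulr1 ?ReD; last exact: buc_fejer.
    rewrite [complex.Re (Complex _ _)]/=.
    rewrite cube_avg_sum// Re_sum.
    have -> : e = e / 2 + e / 2 by lra.
    rewrite -[X in _ <= X + _]addr0 -addrA lerD//; first by lra.
    rewrite add0r; apply: le_trans Hm.
    have -> : K * d%:R * m.+1%:R^-1 = \sum_(i < d) K * m.+1%:R^-1.
      by rewrite sumr_const card_ord -mulr_natl; ring.
    apply: ler_sum => i _.
    rewrite cube_avgZ ?cube_avgB ?cube_avg_fejer //; [|exact: buc_fejer|by apply: bucB => //; exact: buc_fejer].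
    rewrite ReZ; apply: ler_wpM2l => //; rewrite ReD ReN [complex.Re 1]/=.
    by rewrite lerBlDr -lerBlDl; exact: cube_avg_fejer_basis.
Qed.

End avg.
End trigonometric_approximation.
(** * Square means and the Plancherel inequality *)

Section plancherel.
Context {R : realType} {d : nat}.
Local Notation V := 'rV[R]_d.
Local Notation C := (R[i]^o).
Implicit Types (f g h u : V -> C) (x y t z : V).

Section bessel.
Variables (r : R) (r0 : 0 < r).

Definition inner f g : C := cube_avg r (fun x => f x * conjc (g x)).

Let buc_inner f g : buc f -> buc g -> buc (fun x => f x * conjc (g x)).
Proof. by move=> bf bg; apply: bucM => //; exact: buc_conj. Qed.

Lemma innerBl f g h : buc f -> buc g -> buc h ->
  inner (fun x => f x - g x) h = inner f h - inner g h.
Proof.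
move=> bf bg bh; rewrite /inner -cube_avgB; [|exact: buc_inner|exact: buc_inner].
by apply: cube_avg_eq => x _; rewrite mulrBl.
Qed.

Lemma innerBr f g h : buc f -> buc g -> buc h ->
  inner h (fun x => f x - g x) = inner h f - inner h g.
Proof.
move=> bf bg bh; rewrite /inner -cube_avgB; [|exact: buc_inner|exact: buc_inner].
by apply: cube_avg_eq => x _; rewrite conjcB mulrBr.
Qed.

Lemma inner_suml (Y : seq V) (b : V -> C) h : buc h ->
  inner (fun x => \sum_(y <- Y) b y * chi y x) h = \sum_(y <- Y) b y * inner (chi y) h.
Proof.
move=> bh; rewrite /inner.
transitivity (cube_avg r (fun x => \sum_(y <- Y) b y * (chi y x * conjc (h x)))).
  by apply: cube_avg_eq => x _; rewrite mulr_suml; apply: eq_bigr => y _; rewrite mulrA.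
have bc y : buc (fun x => chi y x * conjc (h x)) by apply: buc_inner => //; exact: buc_chi.
rewrite cube_avg_sum; last by move=> y; exact: bucZ.
by apply: eq_bigr => y _; rewrite cube_avgZ.
Qed.

Lemma inner_sumr (Y : seq V) (b : V -> C) h : buc h ->
  inner h (fun x => \sum_(y <- Y) b y * chi y x) = \sum_(y <- Y) conjc (b y) * inner h (chi y).
Proof.
move=> bh; rewrite /inner.
transitivity (cube_avg r (fun x => \sum_(y <- Y) conjc (b y) * (h x * conjc (chi y x)))).
  apply: cube_avg_eq => x _; rewrite conjc_sum mulr_sumr; apply: eq_bigr => y _.
  by rewrite conjcM2 mulrCA.
have bc y : buc (fun x => h x * conjc (chi y x)) by apply: buc_inner => //; exact: buc_chi.
rewrite cube_avg_sum; last by move=> y; exact: bucZ.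
by apply: eq_bigr => y _; rewrite cube_avgZ.
Qed.

Lemma conj_cube_avg f : buc f -> conjc (cube_avg r f) = cube_avg r (fun x => conjc (f x)).
Proof.
move=> bf; rewrite /cube_avg conjcM2 [conjc (Complex _ 0)]/= oppr0; congr (_ * _).
rewrite !integral_onE /=; congr Complex; first by apply: rint_eq => x _; rewrite ReJ.
rewrite -mulN1r -rintZ; [|exact: borel_cube|exact: vol_cube_fin|exact: buc_Im].
by apply: rint_eq => x _; rewrite ImJ mulN1r.
Qed.

Lemma conj_inner f g : buc f -> buc g -> conjc (inner f g) = inner g f.
Proof.
move=> bf bg; rewrite conj_cube_avg; last exact: buc_inner.
by apply: cube_avg_eq => x _; rewrite conjcM2 conjcK2 mulrC.
Qed.

Lemma inner_chi y y' : dual_lattice r y -> dual_lattice r y' ->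
  inner (chi y) (chi y') = (y == y')%:R.
Proof.
move=> ly ly'; transitivity (cube_avg r (chi (y - y'))).
  by apply: cube_avg_eq => x _; rewrite chiBl.
rewrite (cube_avg_chi r0); first by rewrite subr_eq0; case: eqP.
exact: dual_latticeB.
Qed.

(** Expanding the square. With the Fourier coefficients of f for b this is Bessel's
    inequality; with the coefficients of a uniform approximation it is the
    converse inequality. *)
Lemma inner_dist f (Y : seq V) (b : V -> C) : buc f -> uniq Y ->
  (forall y, y \in Y -> dual_lattice r y) ->
  let T := fun x => f x - \sum_(y <- Y) b y * chi y x in
  complex.Re (inner T T) = complex.Re (inner f f) - \sum_(y <- Y) normc (inner f (chi y)) ^+ 2
    + \sum_(y <- Y) normc (inner f (chi y) - b y) ^+ 2.
Proof.
move=> bf uY lY T; have bP : buc (fun x => \sum_(y <- Y) b y * chi y x).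
  by apply: buc_sum => y; apply: bucZ; exact: buc_chi.
rewrite innerBl ?innerBr//; last exact: bucB.
have -> : inner (fun x => \sum_(y <- Y) b y * chi y x) (fun x => \sum_(y <- Y) b y * chi y x) =
   \sum_(y <- Y) conjc (b y) * b y.
  rewrite inner_sumr//; apply: eq_big_seq => y yY; congr (_ * _).
  rewrite inner_suml; last exact: buc_chi.
  rewrite (bigD1_seq y)//= big_seq_cond big1 ?addr0.
    by rewrite inner_chi ?eqxx ?mulr1//; exact: lY.
  move=> z /andP[zY zy]; rewrite inner_chi; [|exact: lY|exact: lY].
  by rewrite (negbTE zy) mulr0.
rewrite inner_suml// inner_sumr//.
have -> : \sum_(y <- Y) b y * inner (chi y) f = \sum_(y <- Y) b y * conjc (inner f (chi y)).
  by apply: eq_bigr => y _; rewrite conj_inner//; exact: buc_chi.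
rewrite !(ReD, ReN, Re_sum).
have -> : \sum_(y <- Y) normc (inner f (chi y) - b y) ^+ 2 =
    \sum_(y <- Y) normc (inner f (chi y)) ^+ 2 - \sum_(y <- Y) complex.Re (conjc (b y) * inner f (chi y))
    - \sum_(y <- Y) complex.Re (b y * conjc (inner f (chi y)))
    + \sum_(y <- Y) complex.Re (conjc (b y) * b y).
  rewrite -!sumrB -big_split; apply: eq_bigr => y _.
  move: (inner f (chi y)) => c /=.
  by rewrite !sqr_normc !(ReM, ReJ, ImJ, ReD, ImD, ReN, ImN); ring.
ring.
Qed.

Lemma Re_inner_ge0 f : 0 <= complex.Re (inner f f).
Proof.
rewrite /inner /cube_avg ReZ; apply: mulr_ge0.
  by rewrite invr_ge0 exprn_ge0// mulr_ge0// ltW.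
by rewrite Re_integral_on; apply: rint_ge0 => x _; rewrite mulcJ sqr_ge0.
Qed.

Lemma bessel f (Y : seq V) : buc f -> uniq Y -> (forall y, y \in Y -> dual_lattice r y) ->
  \sum_(y <- Y) normc (inner f (chi y)) ^+ 2 <= complex.Re (inner f f).
Proof.
move=> bf uY lY; have := inner_dist (fun y => inner f (chi y)) bf uY lY; cbv zeta.
rewrite [X in _ = _ + X]big1; last by move=> y _; rewrite subrr normc0 expr0n.
have := Re_inner_ge0 (fun x => f x - \sum_(y <- Y) inner f (chi y) * chi y x).
by move=> + E; rewrite E addr0 subr_ge0.
Qed.

(** Completeness of the characters of the torus, from their uniform density. *)
Lemma parseval_approx (rho e : R) f : ucont f -> vanish rho f -> 0 <= rho -> rho < r -> 0 < e ->
  exists Y : seq V, [/\ uniq Y, forall y, y \in Y -> dual_lattice r y &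
    complex.Re (inner f f) <= \sum_(y <- Y) normc (inner f (chi y)) ^+ 2 + e].
Proof.
move=> uf fv rho0 rhor e0.
have cf : Cc f by apply/CcP; split=> //; exists rho.
have [B B0 fB] := Cc_bound cf.
pose a := Num.min 1 e; have a0 : 0 < a by rewrite lt_min ltr01.
have [s [ls _ Hs]] := fejer_approx r0 uf fv rho0 rhor a0 fB.
pose Y := undup [seq p.2 | p <- s].
pose b y : C := \sum_(p <- s | p.2 == y) p.1.
have lY y : y \in Y -> dual_lattice r y.
  by rewrite mem_undup => /mapP[p ps ->]; exact: ls.
have TE x : trig_poly s x = \sum_(y <- Y) b y * chi y x.
  rewrite /trig_poly.
  transitivity (\sum_(p <- s) \sum_(y <- Y) (if p.2 == y then p.1 * chi y x else 0)).
    apply: eq_big_seq => p ps.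
    have pY : p.2 \in Y by rewrite mem_undup; exact: map_f.
    rewrite (bigD1_seq p.2) ?undup_uniq//= eqxx big1 ?addr0// => y.
    by rewrite eq_sym => /negbTE ->.
  rewrite exchange_big /=; apply: eq_bigr => y _.
  by rewrite /b mulr_suml -big_mkcond.
have bf := Cc_buc cf.
exists Y; split=> //; first exact: undup_uniq.
have := inner_dist b bf (undup_uniq _) lY; set T := fun x => _; move=> E.
have bT : buc T by apply: bucB => //; apply: buc_sum => y; apply: bucZ; exact: buc_chi.
have S0 : 0 <= \sum_(y <- Y) normc (inner f (chi y) - b y) ^+ 2.
  by apply: sumr_ge0 => y _; exact: sqr_ge0.
suff : complex.Re (inner T T) <= e by rewrite E; rewrite -/Y; lra.
apply: le_trans (ler_norm _) _; apply: le_trans (Re_le_normc _) _.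
have bC := @buc_cst R d (Complex (a ^+ 2) 0).
have bTT : buc (fun x => T x * conjc (T x)) by exact: buc_inner.
apply: le_trans (normc_cube_avg r0 bTT bC _) _.
  move=> x xr; rewrite mulcJ normc_real ger0_norm ?sqr_ge0// [complex.Re _]/= ler_pXn2r ?nnegrE ?normc_ge0 ?(ltW a0)//.
  by rewrite /T -TE; exact: Hs.
rewrite (cube_avg_cst r0) [complex.Re _]/=; apply: (@le_trans _ _ a); last by rewrite ge_min lexx orbT.
by rewrite expr2 ger_pMr// ge_min lexx.
Qed.

End bessel.

Definition msq f : R := complex.Re (integral_Rd (fun x => f x * conjc (f x))).

Lemma msq_inner r f : 0 < r -> vanish r f ->
  complex.Re (inner r f f) = ((2 * r) ^+ d)^-1 * msq f.
Proof.
move=> r0 fr; rewrite /inner /cube_avg ReZ /msq (@integral_Rd_cube _ _ r)//.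
by move=> x /fr ->; rewrite mul0r.
Qed.

Lemma inner_chi_fcheck r f y : 0 < r -> vanish r f ->
  inner r f (chi y) = Complex ((2 * r) ^+ d)^-1 0 * fcheck f (- y).
Proof.
move=> r0 fr; rewrite /inner /cube_avg /fcheck (@integral_Rd_cube _ _ r); last first.
  by move=> x /fr ->; rewrite mul0r.
by congr (_ * _); apply: integral_on_eq => x _; rewrite chiNl.
Qed.

(** The part of Plancherel's theorem that is used. On a torus so large that the
    convolution does not wrap around, the transforms are sampled at the
    frequencies of the torus, where the inequality holds term by term. *)
Lemma msq_convolution (S : R) u f : Cc u -> Cc f -> 0 <= S ->
  (forall y, normc (fcheck u y) ^+ 2 <= S) ->
  msq (convolution u f) <= S * msq f.
Proof.
move=> cu cf S0 uS.
have [uu [a a0 ua]] := (CcP u).1 cu; have [uf [b b0 fb]] := (CcP f).1 cf.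
have cuf := Cc_conv cu cf; have vuf := vanish_conv ua fb.
pose r := a + b + 1; have r0 : 0 < r by rewrite /r; lra.
have fr : vanish r f by apply: vanish_le fb; rewrite /r; lra.
have ufr : vanish r (convolution u f) by apply: vanish_le vuf; rewrite /r; lra.
have D0 : 0 < (2 * r) ^+ d by rewrite exprn_gt0// mulr_gt0.
suff : complex.Re (inner r (convolution u f) (convolution u f)) <= S * complex.Re (inner r f f).
  by rewrite !msq_inner// mulrCA ler_pM2l// invr_gt0.
apply/ler_addgt0Pr => e e0.
have ab0 : 0 <= a + b by exact: addr_ge0.
have abr : a + b < r by rewrite /r; lra.
have [Y [uY lY HY]] := parseval_approx r0 ((CcP _).1 cuf).1 vuf ab0 abr e0.
apply: le_trans HY _; rewrite lerD2r.
apply: le_trans (ler_wpM2l S0 (bessel r0 (Cc_buc cf) uY lY)).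
rewrite mulr_sumr; apply: ler_sum => y _.
rewrite !inner_chi_fcheck// fcheck_conv// mulrCA.
move: (_ * fcheck f _) => w; rewrite normcM2 exprMn.
by apply: ler_wpM2r; [exact: sqr_ge0|exact: uS].
Qed.

End plancherel.
(** * Almost periodic functions *)

Section almost_periodic.
Context {R : realType} {d : nat}.
Local Notation V := 'rV[R]_d.
Local Notation C := (R[i]^o).
Implicit Types (f g h k : V -> C) (x y t z : V).

Lemma compact_finite_cover (X : topologicalType) (I : eqType) (A : set X) (U : I -> set X) :
  compact A -> (forall p, A p -> exists i, nbhs p (U i)) ->
  exists s : seq I, forall p, A p -> exists2 i, i \in s & U i p.
Proof.
move=> /compact_near_coveringP cA AU.
pose F : set_system (seq I) := filter_from setT (fun s0 : seq I => [set s : seq I | {subset s0 <= s}]).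
have FF : Filter F.
  apply: filter_from_filter; first by exists [::].
  move=> s1 s2 _ _; exists (s1 ++ s2) => // s /= H; split=> t ts; apply: H; rewrite mem_cat ts ?orbT//.
have := cA (seq I) F (fun s p => exists2 i, i \in s & U i p) FF.
case.
- move=> x /AU[t Ut]; exists (U t, [set s : seq I | {subset [:: t] <= s}]).
    by split => //=; exists [:: t].
  by move=> [x' s] /= [Ux' ts]; exists t => //; apply: ts; rewrite inE.
- move=> s0 _ H; exists s0; exact: H.
Qed.

(** Total boundedness of the set of translates, as a finite classification of
    the translations; in this form it passes to sums and products at once. *)
Definition tb_translates h := forall e : R, 0 < e ->
  exists (T : finType) (c : V -> T), forall s t, c s = c t ->
    forall x, normc (h (x - s) - h (x - t)) <= e.

Definition ap h := buc h /\ tb_translates h.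

Lemma nbhs_uniform (k : {uniform V -> C}) (e : R) : 0 < e ->
  nbhs k [set k' : {uniform V -> C} | forall x, normc (k x - k' x) < e].
Proof.
move=> e0; have eC : 0 < (Complex e 0 : R[i]) by rewrite ltcE /= eqxx.
apply/uniform_nbhs; exists [set xy | ball xy.1 (Complex e 0) xy.2]; split.
  exact: (entourage_ball _ (PosNum eC)).
move=> k' /= Hk x; have := Hk x I; rewrite -ball_normE /=.
by rewrite -[ `|_|]/(Complex (normc (k x - k' x)) 0) ltcE /= => /andP[_].
Qed.

Lemma tb_of_cover h (s : seq V) (e : R) :
  (forall t, exists2 t', t' \in s & forall x, normc (h (x - t') - h (x - t)) <= e / 2) ->
  exists (T : finType) (c : V -> T), forall s t, c s = c t ->
    forall x, normc (h (x - s) - h (x - t)) <= e.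
Proof.
move=> H.
have /choice[c Hc] : forall t, exists i : 'I_(size s).+1,
    forall x, normc (h (x - nth 0 s i) - h (x - t)) <= e / 2.
  move=> t; have [t' ts Ht'] := H t; exists (inord (index t' s)) => x.
  rewrite inordK; first by rewrite nth_index.
  by rewrite ltnS index_size.
exists 'I_(size s).+1, c => u t E x; apply: le_trans (normc_tri (h (x - nth 0 s (c u))) _ _) _.
have H1 := Hc u x; have H2 := Hc t x; rewrite -E in H2; rewrite normcBC in H1; lra.
Qed.

Lemma strongly_ap_fun_ap h : strongly_ap_fun h -> ap h.
Proof.
move=> [[[M hM] uh] ch]; split; first split.
- by exists M.
- move=> e e0.
  have eC : 0 < (Complex e 0 : R[i]) by rewrite ltcE /= eqxx.
  have := uh _ (entourage_ball _ (PosNum eC)).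
  rewrite /= -entourage_from_ballE => -[a /= a0 Ha]; exists a => // x y xy.
  have := Ha (x, y); rewrite /= -ball_normE /= => /(_ xy).
  rewrite -ball_normE /= -[ `|_|]/(Complex (normc (h x - h y)) 0) ltcE /= => /andP[_].
  exact: ltW.
- move=> e e0; have e40 : 0 < e / 4 by rewrite divr_gt0.
  pose U t : set {uniform V -> C} := [set k | forall x, normc (h (x - t) - k x) < e / 2].
  have [|s Hs] := @compact_finite_cover _ V _ U ch.
    move=> k kc; have [_ [[t _ <-] Ht]] := kc _ (nbhs_uniform k e40).
    exists t; apply: filterS (nbhs_uniform k e40) => k' Hk' x.
    apply: le_lt_trans (normc_tri (k x) _ _) _; have := Hk' x; have := Ht x.
    rewrite normcBC; lra.
  apply: (@tb_of_cover _ s) => t.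
  have [|t' ts Ut'] := Hs (fun x => h (x - t)); first by apply: subset_closure; exists t.
  by exists t' => // x; apply: ltW; exact: Ut'.
Qed.

Lemma apD f g : ap f -> ap g -> ap (fun x => f x + g x).
Proof.
move=> [bf tf] [bg tg]; split; first exact: bucD.
move=> e e0; have e20 : 0 < e / 2 by rewrite divr_gt0.
have [T [a Ha]] := tf _ e20; have [S [b Hb]] := tg _ e20.
exists (T * S)%type, (fun t => (a t, b t)) => s t [E1 E2] x.
rewrite opprD addrACA; apply: le_trans (normcD _ _) _.
have := Ha _ _ E1 x; have := Hb _ _ E2 x; lra.
Qed.

Lemma apM f g : ap f -> ap g -> ap (fun x => f x * g x).
Proof.
move=> [bf tf] [bg tg]; split; first exact: bucM.
have [M M0 fM] := bddW bf.1; have [N N0 gN] := bddW bg.1.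
move=> e e0.
have eN0 : 0 < e / (2 * N) by rewrite divr_gt0// mulr_gt0.
have eM0 : 0 < e / (2 * M) by rewrite divr_gt0// mulr_gt0.
have [T [a Ha]] := tf _ eN0; have [S [b Hb]] := tg _ eM0.
exists (T * S)%type, (fun t => (a t, b t)) => s t [E1 E2] x.
have -> : f (x - s) * g (x - s) - f (x - t) * g (x - t) =
  (f (x - s) - f (x - t)) * g (x - s) + f (x - t) * (g (x - s) - g (x - t)) by ring.
apply: le_trans (normcD _ _) _; rewrite !normcM2.
have H1 : normc (f (x - s) - f (x - t)) * normc (g (x - s)) <= e / (2 * N) * N.
  by apply: ler_pM; rewrite ?normc_ge0//; exact: Ha.
have H2 : normc (f (x - t)) * normc (g (x - s) - g (x - t)) <= M * (e / (2 * M)).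
  by apply: ler_pM; rewrite ?normc_ge0//; exact: Hb.
apply: le_trans (lerD H1 H2) _.
have -> : e / (2 * N) * N = e / 2 by field; rewrite gt_eqF.
have -> : M * (e / (2 * M)) = e / 2 by field; rewrite gt_eqF.
lra.
Qed.

Lemma ap_cst (c : C) : ap (fun=> c).
Proof.
split; first exact: buc_cst.
by move=> e e0; exists unit, (fun=> tt) => s t _ x; rewrite subrr normc0 ltW.
Qed.

Lemma apZ (c : C) f : ap f -> ap (fun x => c * f x).
Proof. by move=> af; apply: apM => //; exact: ap_cst. Qed.


Lemma bounded_classification (phi : V -> R) (e : R) : (forall t, `|phi t| <= 1) -> 0 < e ->
  exists (T : finType) (c : V -> T), forall s t, c s = c t -> `|phi s - phi t| <= e.
Proof.
move=> Hphi e0; pose n := Num.truncn (2 / e).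
pose c t : 'I_n.+1 := inord (Num.truncn ((phi t + 1) / e)).
exists 'I_n.+1, c => s t.
have b u : 0 <= (phi u + 1) / e.
  by have := Hphi u; rewrite ler_norml => /andP[H _]; rewrite divr_ge0 ?(ltW e0)//; lra.
have cE u : c u = Num.truncn ((phi u + 1) / e) :> nat.
  rewrite inordK// ltnS; apply: le_truncn; rewrite ler_pM2r ?invr_gt0//.
  by have := Hphi u; rewrite ler_norml => /andP[_ H]; lra.
move=> /(congr1 val); rewrite /= !cE => E.
have /andP[s1 s2] := truncn_itv (b s); have /andP[t1 t2] := truncn_itv (b t).
rewrite -E -natr1 in t1 t2; rewrite -natr1 in s2.
have K : `|(phi s + 1) / e - (phi t + 1) / e| <= 1 by rewrite ler_norml; apply/andP; split; lra.
have -> : phi s - phi t = ((phi s + 1) / e - (phi t + 1) / e) * e by field; rewrite gt_eqF.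
by rewrite normrM (gtr0_norm e0) ger_pMl.
Qed.

Lemma ap_chi y : ap (chi y).
Proof.
split; first exact: buc_chi.
move=> e e0; have e20 : 0 < e / 2 by rewrite divr_gt0.
have [T [a Ha]] := bounded_classification (phi := fun t => complex.Re (chi y t))
  (fun t => le_trans (Re_le_normc _) (eq_ind_r (fun r => r <= 1) (lexx 1) (normc_chi y t))) e20.
have [S [b Hb]] := bounded_classification (phi := fun t => complex.Im (chi y t))
  (fun t => le_trans (Im_le_normc _) (eq_ind_r (fun r => r <= 1) (lexx 1) (normc_chi y t))) e20.
exists (T * S)%type, (fun t => (a t, b t)) => s t [E1 E2] x.
rewrite !chiB -mulrBr normcM2 normc_chi mul1r -conjcB normcJ.
apply: le_trans (normc_le_sum _) _; rewrite ReD ReN ImD ImN.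
have := Ha _ _ E1; have := Hb _ _ E2; lra.
Qed.

Lemma apN f : ap f -> ap (fun x => - f x).
Proof. by move=> /(apZ (- 1)); under eq_fun do rewrite mulN1r. Qed.

Lemma apB f g : ap f -> ap g -> ap (fun x => f x - g x).
Proof. by move=> af ag; apply: apD => //; exact: apN. Qed.

Lemma ap_sum I (s : seq I) (F : I -> V -> C) : (forall i, ap (F i)) ->
  ap (fun x => \sum_(i <- s) F i x).
Proof.
move=> aF; elim: s => [|i s IH].
  by under eq_fun do rewrite big_nil; exact: ap_cst.
by under eq_fun do rewrite big_cons; exact: apD.
Qed.

Lemma ap_uniform_limit f : (forall e : R, 0 < e ->
  exists2 g, ap g & forall x, normc (f x - g x) <= e) -> ap f.
Proof.
move=> H; split; first split.
- have [g [[[M gM] _] _] Hg] := H 1 ltr01; exists (M + 1) => x.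
  by apply: le_trans (normc_dist _ (g x)) _; exact: lerD.
- move=> e e0; have e30 : 0 < e / 3 by rewrite divr_gt0.
  have [g [[_ ug] _] Hg] := H _ e30; have [a a0 Ha] := ug _ e30; exists a => // x y xy.
  apply: le_trans (normc_tri (g x) _ _) _.
  have K := Hg y; rewrite normcBC in K.
  have := normc_tri (g y) (g x) (f y); have := Ha _ _ xy; have := Hg x; lra.
- move=> e e0; have e30 : 0 < e / 3 by rewrite divr_gt0.
  have [g [_ tg] Hg] := H _ e30; have [T [c Hc]] := tg _ e30; exists T, c => s t E x.
  apply: le_trans (normc_tri (g (x - s)) _ _) _.
  have K := Hg (x - t); rewrite normcBC in K.
  have := normc_tri (g (x - t)) (g (x - s)) (f (x - t)); have := Hc _ _ E x.
  have := Hg (x - s); lra.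
Qed.

(** * Means *)

Definition avg (s : seq V) h x : C :=
  Complex (size s)%:R^-1 0 * \sum_(t <- s) h (x - t).

Lemma avg_eq s f g : f =1 g -> avg s f =1 avg s g.
Proof. by move=> fg x; congr (_ * _); apply: eq_bigr => t _. Qed.

Lemma avgD s f g x : avg s (fun x => f x + g x) x = avg s f x + avg s g x.
Proof. by rewrite /avg big_split mulrDr. Qed.

Lemma avgZ s c f x : avg s (fun x => c * f x) x = c * avg s f x.
Proof. by rewrite /avg -mulr_sumr mulrCA. Qed.

Lemma avgB s f g x : avg s (fun x => f x - g x) x = avg s f x - avg s g x.
Proof. by rewrite /avg sumrB mulrBr. Qed.

Lemma avg_cst s (c : C) x : s != [::] -> avg s (fun=> c) x = c.
Proof.
move=> s0; have n0 : (size s)%:R != 0 :> R by rewrite pnatr_eq0 size_eq0.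
rewrite /avg big_const_seq count_predT iter_addr_0.
have -> : c *+ size s = Complex (size s)%:R 0 * c :> R[i].
  by rewrite -[Complex _ 0]/((_)%:C%C) rmorph_nat mulr_natl.
by case: c => a b; simpc; rewrite !mulrA mulVf// !mul1r.
Qed.

Lemma avg_le s f (B : R) x : s != [::] -> (forall t, t \in s -> normc (f (x - t)) <= B) ->
  normc (avg s f x) <= B.
Proof.
move=> s0 fB; have n0 : 0 < (size s)%:R :> R by rewrite ltr0n lt0n size_eq0.
rewrite /avg normcM2 normc_real ger0_norm ?invr_ge0 ?ler0n// ler_pdivrMl//.
apply: le_trans (normc_sum _ _ _) _.
have -> : (size s)%:R * B = \sum_(t <- s) B by rewrite big_const_seq count_predT iter_addr_0 mulr_natl.
by rewrite big_seq [leRHS]big_seq; apply: ler_sum.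
Qed.

Definition sums (s s' : seq V) := [seq a + b | a <- s, b <- s'].

Lemma sums_neq0 s s' : s != [::] -> s' != [::] -> sums s s' != [::].
Proof. by rewrite -!size_eq0 size_allpairs muln_eq0 negb_or => -> ->. Qed.

Lemma avg_sums s s' h x : avg (sums s s') h x = avg s (avg s' h) x.
Proof.
rewrite /avg size_allpairs natrM -mulr_sumr mulrA invfM.
rewrite -[Complex (size s)%:R^-1 0 * _]/(_) (_ : Complex _ 0 * Complex _ 0 = Complex ((size s)%:R^-1 * (size s')%:R^-1) 0); last by simpc.
congr (_ * _); rewrite big_allpairs_dep; apply: eq_bigr => a _.
by apply: eq_bigr => b _; rewrite opprD addrA.
Qed.

Lemma avg_sumsC s s' h x : avg s (avg s' h) x = avg s' (avg s h) x.
Proof.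
rewrite /avg -!mulr_sumr mulrCA; congr (_ * (_ * _)); rewrite exchange_big.
by apply: eq_bigr => a _; apply: eq_bigr => b _; rewrite addrAC.
Qed.

(** One averaging step over representatives of the classes of translations
    shrinks the diameter of the range by a fixed factor: for any two points, one
    pair of terms of the two averages nearly agrees. *)
Lemma avg_diameter (e : R) (T : finType) (c : V -> T) (r : T -> V) k (D : R) :
  0 < e -> (forall t, c (r (c t)) = c t) ->
  (forall s t, c s = c t -> forall x, normc (k (x - s) - k (x - t)) <= e) ->
  (forall x y, normc (k x - k y) <= D) ->
  forall x y, normc (avg [seq r v | v <- enum T] k x - avg [seq r v | v <- enum T] k y)
    <= D - (#|T|%:R)^-1 * (D - e).
Proof.
move=> e0 rc kc kD x y.
have n0 : 0 < (#|T|%:R : R) by rewrite ltr0n; apply/card_gt0P; exists (c 0).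
rewrite /avg size_map -cardE -mulrBr normcM2 normc_real ger0_norm ?invr_ge0 ?ler0n//.
have E z : \sum_(t <- [seq r v | v <- enum T]) k (z - t) = \sum_v k (z - r v).
  by rewrite big_map big_enum.
rewrite !E.
(* The transposition tau pairs the two terms that nearly agree; D bounds the
   differences of all other pairs. *)
pose v0 := c 0; pose w0 := c (r v0 + (y - x)); pose tau := tperm v0 w0.
rewrite [X in _ - X](reindex_inj (@perm_inj _ tau)) -sumrB /=.
rewrite ler_pdivrMl//.
apply: le_trans (normc_sum _ _ _) _.
have -> : #|T|%:R * (D - #|T|%:R^-1 * (D - e)) = e + (#|T|%:R - 1) * D by field; rewrite gt_eqF.
rewrite (bigD1 v0)//=; apply: lerD.
  rewrite tpermL normcBC; have := kc (r w0) (r v0 + (y - x)) (rc _) y.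
  have -> // : y - (r v0 + (y - x)) = x - r v0 by rewrite opprD opprB addrCA [y + _]addrC subrK addrC.
rewrite (_ : (#|T|%:R - 1) * D = \sum_(v | v != v0) D); first exact: ler_sum.
have K : \sum_(v : T) D = #|T|%:R * D by rewrite sumr_const mulr_natl.
by rewrite mulrBl mul1r -K; rewrite (bigD1 v0)//= addrAC subrr add0r.
Qed.

Lemma avg_classes (T : finType) (c : V -> T) h (e : R) s : s != [::] ->
  (forall s t, c s = c t -> forall x, normc (h (x - s) - h (x - t)) <= e) ->
  forall t t', c t = c t' -> forall x, normc (avg s h (x - t) - avg s h (x - t')) <= e.
Proof.
move=> s0 hc t t' E x; rewrite /avg -mulrBr -sumrB.
have -> : \sum_(i <- s) (h (x - t - i) - h (x - t' - i)) =
    \sum_(i <- s) (h (x - i - t) - h (x - i - t')).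
  by apply: eq_bigr => i _; rewrite [x - t - i]addrAC [x - t' - i]addrAC.
by apply: (@avg_le s (fun z => h (z - t) - h (z - t')) e x s0) => u _; exact: hc.
Qed.

Lemma class_representatives (T : finType) (c : V -> T) :
  exists r : T -> V, forall t, c (r (c t)) = c t.
Proof.
exists (fun v => xget 0 [set t | c t = v]) => t.
exact: (@xgetPex _ 0 [set u | c u = c t] (ex_intro _ t erefl)).
Qed.

Lemma geometric_small (q D e : R) : 0 <= q -> q < 1 -> 0 < e -> exists j : nat, q ^+ j * D <= e.
Proof.
move=> q0 q1 e0; have De : 0 < e / (`|D| + 1) by rewrite divr_gt0// ltr_wpDl.
have /cvgrPdist_lt/(_ _ De)[j _ Hj] : q ^+ n @[n --> \oo] --> (0 : R).
  by apply: cvg_expr; rewrite ger0_norm.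
exists j; have := Hj j (leqnn j); rewrite /= sub0r normrN normrX (ger0_norm q0) => H.
apply: le_trans (ler_norm _) _; rewrite normrM normrX (ger0_norm q0).
apply: (@le_trans _ _ (q ^+ j * (`|D| + 1))); first by rewrite ler_wpM2l ?exprn_ge0// lerDl.
by rewrite -ler_pdivlMr ?ltW// ltr_wpDl.
Qed.

(** By [avg_classes], averaging preserves the classification of the translations;
    so the step of [avg_diameter] can be iterated with the same representatives. *)
Lemma ap_avg_diameter h (e : R) : ap h -> 0 < e ->
  exists2 s, s != [::] & forall x y, normc (avg s h x - avg s h y) <= e.
Proof.
move=> [[[M hM] _] th] e0; have e20 : 0 < e / 2 by rewrite divr_gt0.
have [T [c Hc]] := th _ e20; have [r Hr] := class_representatives c.
pose S := [seq r v | v <- enum T].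
have T0 : (0 < #|T|)%N by apply/card_gt0P; exists (c 0).
have S0 : S != [::] by rewrite -size_eq0 size_map -cardE -lt0n.
pose q : R := 1 - #|T|%:R^-1.
have n1 : (1 : R) <= #|T|%:R by rewrite ler1n.
have q0 : 0 <= q by rewrite /q subr_ge0 invf_le1// (lt_le_trans ltr01).
have q1 : q < 1 by rewrite /q gtrBl invr_gt0 (lt_le_trans ltr01).
have step j : exists2 s, s != [::] & forall x y, normc (avg s h x - avg s h y) <= e / 2 + q ^+ j * (2 * M).
  elim: j => [|j [s s0 Hs]].
    exists [:: 0] => // x y; rewrite expr0 mul1r.
    have E z : avg [:: 0] h z = h z.
      by rewrite /avg big_seq1 subr0 invr1 -[Complex 1 0]/(1 : C) mul1r.
    by rewrite !E; apply: le_trans (normcB _ _) _; have := hM x; have := hM y; lra.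
  exists (sums S s); first exact: sums_neq0.
  move=> x y; rewrite !avg_sums.
  apply: le_trans (avg_diameter e20 Hr (avg_classes s0 Hc) Hs x y) _.
  rewrite exprS; rewrite le_eqVlt; apply/orP; left; apply/eqP.
  by rewrite /q; ring.
have [j Hj] := geometric_small (2 * M) q0 q1 e20.
have [s s0 Hs] := step j; exists s => // x y; apply: le_trans (Hs x y) _; lra.
Qed.

(** Means as uniform limits of averages over finite lists of translations. Such
    averages commute with each other, which makes existence, uniqueness and
    linearity elementary; [amean_has_mean] relates them to Folner sequences. *)
Definition amean h (m : C) := forall e : R, 0 < e ->
  exists2 s, s != [::] & forall x, normc (avg s h x - m) <= e.

(** Completeness in a form that needs no sequences: the bounds e i play the role
    of the Cauchy condition. *)
Lemma compatible_limit (I : Type) (i0 : I) (m : I -> C) (e : I -> R) :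
  (forall i j, normc (m i - m j) <= e i + e j) -> exists z : C, forall i, normc (z - m i) <= 2 * e i.
Proof.
move=> H.
have real_case (a : I -> R) : (forall i j, `|a i - a j| <= e i + e j) -> exists z : R, forall i, `|z - a i| <= e i.
  move=> Ha; pose S := range (fun i => a i - e i).
  have ub j : ubound S (a j + e j).
    by move=> _ [i _ <-]; have := Ha i j; rewrite ler_norml => /andP[_ ?]; lra.
  have hs : has_sup S by split; [exists (a i0 - e i0), i0|exists (a i0 + e i0); exact: ub].
  exists (sup S) => i.
  have H1 : sup S <= a i + e i by apply: ge_sup => //; case: hs.
  have H2 : a i - e i <= sup S by apply: sup_upper_bound => //; exists i.
  by rewrite ler_norml; apply/andP; split; lra.
have [x Hx] : exists z : R, forall i, `|z - complex.Re (m i)| <= e i.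
  apply: real_case => i j; apply: le_trans (H i j); rewrite -ReN -ReD; exact: Re_le_normc.
have [y Hy] : exists z : R, forall i, `|z - complex.Im (m i)| <= e i.
  apply: real_case => i j; apply: le_trans (H i j); rewrite -ImN -ImD; exact: Im_le_normc.
exists (Complex x y) => i; apply: le_trans (normc_le_sum _) _.
by rewrite ReD ReN ImD ImN /=; have := Hx i; have := Hy i; lra.
Qed.

(** Two averages of small diameter are compared through the average over all sums
    of their translations. *)
Lemma amean_exists h : ap h -> exists m, amean h m.
Proof.
move=> ah.
have /choice[s Hs] : forall n : nat, exists s : seq V, s != [::] /\
    forall x y, normc (avg s h x - avg s h y) <= n.+1%:R^-1.
  by move=> n; have [|s s0 Hs] := ap_avg_diameter (e := n.+1%:R^-1) ah; [rewrite invr_gt0|exists s].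
have [|m Hm] := compatible_limit 0%N (m := fun n => avg (s n) h 0) (e := fun n => n.+1%:R^-1).
  move=> i j; have [si0 Hi] := Hs i; have [sj0 Hj] := Hs j.
  apply: le_trans (normc_tri (avg (s i) (avg (s j) h) 0) _ _) _; apply: lerD.
    rewrite avg_sumsC -[avg (s i) h 0 in leLHS](@avg_cst (s j) _ 0)// -avgB.
    by apply: avg_le => // t _; exact: Hi.
  rewrite -[avg (s j) h 0 in leLHS](@avg_cst (s i) _ 0)// -avgB.
  by apply: avg_le => // t _; exact: Hj.
exists m => e e0; have e30 : 0 < e / 3 by rewrite divr_gt0.
have := ltr_add_invr (y := 0) e30; case=> n; rewrite add0r => Hn.
have [s0 Hn'] := Hs n; exists (s n) => // x.
apply: le_trans (normc_tri (avg (s n) h 0) _ _) _.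
have := Hm n; have := Hn' x 0; rewrite (normcBC m).
move: Hn; move: (n.+1%:R^-1) => u; lra.
Qed.

Lemma amean_unique h m m' : amean h m -> amean h m' -> m = m'.
Proof.
move=> H H'; apply/subr0_eq/normc_le0/ler_addgt0Pl => e e0; rewrite addr0.
have e20 : 0 < e / 2 by rewrite divr_gt0.
have [s s0 Hs] := H _ e20; have [s' s'0 Hs'] := H' _ e20.
apply: le_trans (normc_tri (avg s (avg s' h) 0) _ _) _.
have H1 : normc (avg s (avg s' h) 0 - m') <= e / 2.
  rewrite -[m' in leLHS](@avg_cst s _ 0)// -avgB; apply: avg_le => // t _; exact: Hs'.
have H2 : normc (avg s' (avg s h) 0 - m) <= e / 2.
  rewrite -[m in leLHS](@avg_cst s' _ 0)// -avgB; apply: avg_le => // t _; exact: Hs.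
rewrite avg_sumsC in H1; rewrite avg_sumsC normcBC; lra.
Qed.

Lemma ameanD f g m m' : amean f m -> amean g m' -> amean (fun x => f x + g x) (m + m').
Proof.
move=> Hf Hg e e0; have e20 : 0 < e / 2 by rewrite divr_gt0.
have [s s0 Hs] := Hf _ e20; have [s' s'0 Hs'] := Hg _ e20.
exists (sums s s'); first exact: sums_neq0.
move=> x; rewrite avgD opprD addrACA; apply: le_trans (normcD _ _) _.
have H1 : normc (avg (sums s s') f x - m) <= e / 2.
  rewrite avg_sums avg_sumsC -[m in leLHS](@avg_cst s' _ x)// -avgB.
  by apply: avg_le => // t _; exact: Hs.
have H2 : normc (avg (sums s s') g x - m') <= e / 2.
  rewrite avg_sums -[m' in leLHS](@avg_cst s _ x)// -avgB.
  by apply: avg_le => // t _; exact: Hs'.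
lra.
Qed.

Lemma ameanZ c f m : amean f m -> amean (fun x => c * f x) (c * m).
Proof.
move=> Hf e e0; have c0 : 0 < normc c + 1 by rewrite ltr_wpDl// normc_ge0.
have [s s0 Hs] := Hf _ (divr_gt0 e0 c0); exists s => // x.
rewrite avgZ -mulrBr normcM2.
apply: (@le_trans _ _ ((normc c + 1) * (e / (normc c + 1)))).
  by apply: ler_pM; rewrite ?normc_ge0// lerDl.
by rewrite mulrC divfK// gt_eqF.
Qed.

Lemma amean_ext f g m : f =1 g -> amean f m -> amean g m.
Proof. by move=> /funext ->. Qed.

Lemma amean_cst c : amean (fun=> c) c.
Proof. by move=> e e0; exists [:: 0] => // x; rewrite avg_cst// subrr normc0 ltW. Qed.

Lemma ameanB f g m m' : amean f m -> amean g m' -> amean (fun x => f x - g x) (m - m').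
Proof.
move=> Hf Hg; rewrite -mulN1r; apply: (@amean_ext (fun x => f x + (-1) * g x)).
  by move=> x; rewrite mulN1r.
by apply: ameanD => //; exact: ameanZ.
Qed.

Lemma amean_sum I (s : seq I) (F : I -> V -> C) (m : I -> C) : (forall i, amean (F i) (m i)) ->
  amean (fun x => \sum_(i <- s) F i x) (\sum_(i <- s) m i).
Proof.
move=> aF; elim: s => [|i s IH].
  rewrite big_nil; apply: (@amean_ext (fun=> 0)); first by move=> x; rewrite big_nil.
  exact: amean_cst.
rewrite big_cons; apply: (@amean_ext (fun x => F i x + \sum_(j <- s) F j x)).
  by move=> x; rewrite big_cons.
exact: ameanD.
Qed.

Lemma amean_translate h m t : amean h m -> amean (fun x => h (x - t)) m.
Proof.
move=> H e e0; have [s s0 Hs] := H _ e0; exists s => // x.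
have -> : avg s (fun z => h (z - t)) x = avg s h (x - t).
  by rewrite /avg; congr (_ * _); apply: eq_bigr => u _; rewrite addrAC.
exact: Hs.
Qed.

Lemma amean_limit f m : (forall e : R, 0 < e -> exists g m', [/\ amean g m',
   normc (m - m') <= e & forall x, normc (f x - g x) <= e]) -> amean f m.
Proof.
move=> H e e0; have e30 : 0 < e / 3 by rewrite divr_gt0.
have [g [m' [Hg mm fg]]] := H _ e30; have [s s0 Hs] := Hg _ e30; exists s => // x.
apply: le_trans (normc_tri (avg s g x) _ _) _.
have H1 : normc (avg s f x - avg s g x) <= e / 3.
  by rewrite -avgB; apply: avg_le => // t _; exact: fg.
have := normc_tri m' (avg s g x) m; have := Hs x; rewrite (normcBC m') ; lra.
Qed.

(** The translation by half a period of a character is short for large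
    frequencies. *)
Lemma chi_minus1 y : y != 0 -> exists2 t, chi y t = -1 & `|t| <= (2 * `|y|)^-1.
Proof.
move=> y0; have [i yi] : exists i, `|y| = `|y ord0 i|.
  have [[j i] /= E] := mx_norm_neq0 (x := y) ltac:(by apply: contra y0 => /eqP/mx_norm_eq0 ->).
  by exists i; rewrite [LHS]E (ord1 j).
have yi0 : y ord0 i != 0.
  by apply: contra y0 => /eqP E; rewrite -normr_eq0 yi E normr0.
pose t : V := \row_j (if j == i then (2 * y ord0 i)^-1 else 0).
exists t; last first.
  apply/rV_norm_le; first by rewrite invr_ge0 mulr_ge0.
  move=> j; rewrite mxE; case: eqP => _; last by rewrite normr0 invr_ge0 mulr_ge0.
  by rewrite normfV normrM yi ger0_norm.
have -> : chi y t = Complex (cos pi) (sin pi).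
  rewrite /chi /dotp (bigD1 i)//= big1 ?addr0; last by move=> j ji; rewrite mxE (negbTE ji) mul0r.
  rewrite mxE eqxx; congr Complex; congr (_ _); field; exact: yi0.
by rewrite cospi sinpi; apply/eqP; rewrite eq_complex /= oppr0 !eqxx.
Qed.

Lemma amean_chi y : amean (chi y) (y == 0)%:R.
Proof.
case: eqVneq => [->|y0].
  by apply: (@amean_ext (fun=> 1)); [move=> x; rewrite chiC chi0|exact: amean_cst].
have [t Ht _] := chi_minus1 y0; move=> e e0; exists [:: 0; t] => // x.
rewrite /avg !big_cons big_nil addr0 !chiB chi0 Ht.
have -> : chi y x * conjc 1 + chi y x * conjc (-1) = 0 :> R[i].
  by rewrite conjcN2 mulrN subrr.
by rewrite mulr0 subr0 normc0 ltW.
Qed.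

End almost_periodic.
Section means.
Context {R : realType} {d : nat}.
Local Notation V := 'rV[R]_d.
Local Notation C := (R[i]^o).
Implicit Types (f g h k : V -> C) (x y t z : V) (A B : set V).

Lemma vol_le A B : borel A -> borel B -> A `<=` B -> (vol A <= vol B)%E.
Proof.
move=> mA mB AB; apply: le_measure; rewrite ?inE //.
by move=> u; exact: AB.
Qed.

Lemma vol_finite A : borel A -> compact (closure A) -> (vol A < +oo)%E.
Proof.
move=> mA cA; have [r Ar] : exists r : R, A `<=` cube r.
  have [M [_ HM]] := compact_bounded cA; exists (M + 1) => x Ax.
  by apply: (HM (M + 1)); [rewrite ltrDl|exact: subset_closure].
apply: le_lt_trans (vol_le mA (borel_cube r) Ar) (vol_cube_fin r).
Qed.

Lemma vol_diff_finite A B : borel A -> borel B -> (vol A < +oo)%E -> (vol (A `\` B) < +oo)%E.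
Proof.
move=> mA mB; apply: le_lt_trans; apply: vol_le => //.
exact: borelD.
Qed.

Lemma vol_fineK A : (vol A < +oo)%E -> vol A = (fine (vol A))%:E.
Proof. by move=> vA; rewrite fineK// ge0_fin_numE// measure_ge0. Qed.

Lemma borel_symdiff A B : borel A -> borel B -> borel (A `+` B).
Proof. by move=> mA mB; apply: measurableU; exact: borelD. Qed.

Lemma vol_symdiff A B : borel A -> borel B -> (vol A < +oo)%E -> (vol B < +oo)%E ->
  fine (vol (A `+` B)) = fine (vol (A `\` B)) + fine (vol (B `\` A)).
Proof.
move=> mA mB vA vB; rewrite -fineD.
- congr fine; apply: measureU.
  + exact: borelD.
  + exact: borelD.
  + by rewrite -subset0 => u [[/= _ H] [/H]].
- by rewrite ge0_fin_numE ?measure_ge0//; exact: vol_diff_finite.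
- by rewrite ge0_fin_numE ?measure_ge0//; exact: vol_diff_finite.
Qed.

Lemma translated_set t A : [set (t + a : V) | a in A] = [set y | A (y - t)].
Proof.
apply/seteqP; split=> y /=; first by move=> [a Aa <-]; rewrite addrC addKr.
by move=> H; exists (y - t) => //; rewrite addrC subrK.
Qed.

Lemma integral_on_shift A h t (M : R) : borel A -> (vol A < +oo)%E -> buc h ->
  (forall x, normc (h x) <= M) ->
  normc (integral_on A (fun x => h (x + t)) - integral_on A h) <=
  M * fine (vol (A `+` [set t + a | a in A])).
Proof.
move=> mA vA bh hM; rewrite translated_set.
set B := [set y | A (y - t)].
have [mB vBE] := vol_translate (- t) mA; rewrite -/B in mB vBE.
have vB : (vol B < +oo)%E by rewrite vBE.
have -> : integral_on A (fun x => h (x + t)) = integral_on B h.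
  rewrite -(integral_on_translate t mB vB bh); congr (integral_on _ _).
  by apply/funext => x; rewrite /B /= addrK.
rewrite (integral_on_split mA mB vA bh) (integral_on_split mB mA vB bh) setIC.
have -> : forall a b c : C, a + b - (a + c) = b - c by move=> a b c; ring.
apply: le_trans (normcB _ _) _; rewrite vol_symdiff// [leRHS]mulrDr [leRHS]addrC; apply: lerD.
  apply: normc_integral_on => //; first exact: borelD.
  exact: vol_diff_finite.
apply: normc_integral_on => //; first exact: borelD.
exact: vol_diff_finite.
Qed.

Lemma near_all (I : eqType) (s : seq I) (P : I -> nat -> Prop) :
  (forall i, \forall n \near \oo, P i n) -> \forall n \near \oo, forall i, i \in s -> P i n.
Proof.
move=> HP; elim: s => [|a s IH]; first by near=> n.
near=> n => i; rewrite inE => /orP[/eqP ->|].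
  by near: n; exact: HP.
by move: i; near: n.
Unshelve. all: by end_near.
Qed.

(** Averaging over a finite list of translations changes the average over a
    large member of a Folner sequence by little; so a constant approximated by
    finite averages is the mean along every Folner sequence. *)
Lemma amean_has_mean h (m : C) : buc h -> amean h m -> has_mean h m.
Proof.
move=> bh Hm A_ [HA vA0 fol]; apply/cvg_normcP => e e0.
have e30 : 0 < e / 3 by rewrite divr_gt0.
have [s s0 Hs] := Hm _ e30.
have [M M0 hM] := bddW bh.1.
have vA n : (vol (A_ n) < +oo)%E by apply: vol_finite; [exact: (HA n).1|exact: (HA n).2].
have pA n : 0 < fine (vol (A_ n)) by rewrite -lte_fin -(vol_fineK (vA n)).
have ev : \forall n \near \oo, forall t, t \in s ->
    fine (vol (A_ n `+` [set (- t + a : V) | a in A_ n])) / fine (vol (A_ n)) < e / 3 / M.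
  apply: near_all => t; have eM : 0 < e / 3 / M by rewrite divr_gt0.
  have /cvgrPdist_lt/(_ _ eM) := fol (- t); apply: filterS => n.
  by rewrite sub0r normrN => /ltr_normlW.
near=> n; set v := fine (vol (A_ n)).
pose I g : C := Complex v^-1 0 * integral_on (A_ n) g.
have mA := (HA n).1.
have Iavg g : buc g -> I (avg s g) = avg s (fun u => I (fun x => g (x + u))) 0.
  move=> bg; rewrite /I /avg integral_onZ//; last by apply: buc_sum => t; exact: buc_translate.
  rewrite mulrCA integral_on_sum//; last by move=> t; exact: buc_translate.
  congr (_ * _); rewrite mulr_sumr; apply: eq_bigr => t _; congr (_ * _).
  by apply: integral_on_eq => x _; rewrite sub0r.
have bavg : buc (avg s h) by apply: bucZ; apply: buc_sum => t; exact: buc_translate.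
have IB g : (forall x, normc (g x) <= e / 3) -> buc g -> normc (I g) <= e / 3.
  move=> gB bg; rewrite /I normcM2 normc_real ger0_norm ?invr_ge0 ?(ltW (pA n))//.
  rewrite ler_pdivrMl ?pA// mulrC; apply: normc_integral_on => //.
have Im : I (fun=> m) = m.
  rewrite /I integral_on_cst// -/v; case: (m) => a b; simpc.
  by rewrite ![v^-1 * _]mulrC !mulfK ?gt_eqF ?pA.
have H1 : normc (I (avg s h) - m) <= e / 3.
  rewrite -{1}Im /I -mulrBr -integral_onB//; last exact: buc_cst.
  by apply: (IB (fun x => avg s h x - m)) => //; apply: bucB => //; exact: buc_cst.
have H2 : normc (I h - I (avg s h)) <= e / 3.
  rewrite Iavg// normcBC -[I h in leLHS](@avg_cst _ _ s _ 0)// -avgB.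
  apply: avg_le => // t ts; rewrite sub0r /I -mulrBr normcM2 normc_real ger0_norm ?invr_ge0 ?(ltW (pA n))//.
  rewrite ler_pdivrMl ?pA//; apply: le_trans (integral_on_shift (- t) mA (vA n) bh hM) _.
  have : fine (vol (A_ n `+` [set (- t + a : V) | a in A_ n])) / v < e / 3 / M.
    by rewrite /v; move: t ts; near: n.
  rewrite ltr_pdivrMr ?pA// => H.
  have -> : v * (e / 3) = M * (e / 3 / M * v) by field; rewrite gt_eqF.
  by rewrite ler_wpM2l ?(ltW M0)// (ltW H).
rewrite -/(I h); apply: le_lt_trans (normc_tri (I (avg s h)) _ _) _; lra.
Unshelve. all: by end_near.
Qed.

Lemma vol_cube_shift (r : R) x : `|x| <= r ->
  fine (vol (cube r `+` [set x + a | a in cube r])) <= (2 * (r + `|x|)) ^+ d - (2 * (r - `|x|)) ^+ d.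
Proof.
move=> xr; have r0 : 0 <= r := le_trans (normr_ge0 _) xr.
have s0 : 0 <= r + `|x| by rewrite addr_ge0.
have d0 : 0 <= r - `|x| by rewrite subr_ge0.
rewrite translated_set.
have mB : borel [set y | cube r (y - x)] := (vol_translate (- x) (borel_cube r)).1.
have sub : cube r `+` [set y | cube r (y - x)] `<=` cube (r + `|x|) `\` cube (r - `|x|).
  rewrite /cube => y /= [[H1 H2]|[H1 H2]]; split.
  - by apply: le_trans H1 _; rewrite lerDl.
  - by move=> /= H; apply: H2; apply: le_trans (ler_normB _ _) _; rewrite -lerBrDr.
  - by rewrite /= -[y](subrK x); apply: le_trans (ler_normD _ _) _; rewrite lerD2r.
  - by move=> /= H; apply: H2; apply: le_trans H _; rewrite gerBl.
rewrite -lee_fin -vol_fineK; last first.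
  apply: le_lt_trans (vol_cube_fin (r + `|x|)); apply: vol_le; [|exact: borel_cube|].
    by apply: borel_symdiff => //; exact: borel_cube.
  by move=> y /sub [].
apply: le_trans (vol_le _ _ sub) _; first by apply: borel_symdiff => //; exact: borel_cube.
  by apply: borelD; exact: borel_cube.
rewrite EFinB -vol_cube// -[X in (_ - X)%E]vol_cube//.
have E : row_of_tuple @^-1` (cube (r + `|x|) `\` cube (r - `|x|)) =
  (@row_of_tuple R d @^-1` cube (r + `|x|)) `\` (@row_of_tuple R d @^-1` cube (r - `|x|)) by [].
rewrite /vol E measureD.
- rewrite setIidr// => u /=; rewrite /cube /= => H; apply: le_trans H _.
  by rewrite lerD2l; apply: le_trans (_ : 0 <= _); rewrite ?oppr_le0.
- exact: borel_cube.
- exact: borel_cube.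
- exact: vol_cube_fin.
Qed.

Lemma cubes_folner : folner (fun n => cube n.+1%:R : set V).
Proof.
have c0 n : (0 : R) < n.+1%:R by rewrite ltr0n.
split.
- move=> n; split; first exact: borel_cube.
  rewrite -(iffLR (closure_id _)); first exact: compact_ball.
  exact: compact_closed (@compact_ball R d _).
- by move=> n; rewrite vol_cube ?(ltW (c0 n))// lte_fin exprn_gt0// mulr_gt0.
move=> x; pose u n : R := `|x| / n.+1%:R.
have u0 : u @ \oo --> (0 : R).
  by rewrite -[X in _ --> X](mulr0 `|x|); apply: cvgM; [exact: cvg_cst|exact: cvg_harmonic].
have E0 : (fun n => (1 + u n) ^+ d - (1 - u n) ^+ d) @ \oo --> (0 : R).
  rewrite -[X in _ --> X](subrr ((1 : R) ^+ d)).
  have E1 : (fun n => 1 + u n) @ \oo --> (1 : R).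
    by rewrite -[X in _ --> X](addr0 (1 : R)); apply: cvgD => //; exact: cvg_cst.
  have E2 : (fun n => 1 - u n) @ \oo --> (1 : R).
    by rewrite -[X in _ --> X](subr0 (1 : R)); apply: cvgB => //; exact: cvg_cst.
  exact: cvgB (cvg_comp _ _ E1 (@exprn_continuous _ d 1)) (cvg_comp _ _ E2 (@exprn_continuous _ d 1)).
have [N _ HN] : \forall n \near \oo, `|x| <= (n.+1%:R : R).
  exists (Num.bound `|x|) => // n /= Hn; apply: le_trans (ltW (archi_boundP (normr_ge0 x))) _.
  by rewrite ler_nat; exact: leq_trans Hn (leqnSn _).
apply: (squeeze_cvgr _ (cvg_cst 0) E0); exists N => // n /= /HN xn.
rewrite divr_ge0 ?fine_ge0 ?measure_ge0//= ler_pdivrMr; last first.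
  by rewrite vol_cube ?(ltW (c0 n))//= exprn_gt0// mulr_gt0.
apply: le_trans (vol_cube_shift xn) _.
rewrite vol_cube ?(ltW (c0 n))//= mulrBl -!exprMn_comm; try exact: mulrC.
rewrite /u le_eqVlt; apply/orP; left; apply/eqP.
by congr (_ ^+ _ - _ ^+ _); field; rewrite gt_eqF.
Qed.

(** There is a Folner sequence, namely that of the cubes, so that [has_mean]
    determines the mean. *)
Lemma mean_amean h m : buc h -> amean h m -> mean h = m.
Proof.
move=> bh Hm; have Hh := amean_has_mean bh Hm.
have := @xgetPex _ (0 : C) [set m' | has_mean h m'] (ex_intro _ m Hh).
rewrite -/(mean h) /= => H; apply: (cvg_unique _ (H _ cubes_folner) (Hh _ cubes_folner)).
exact: norm_hausdorff.
Qed.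

(** * Cut-off functions *)

Definition clip (a : R) : R := Num.max 0 (Num.min 1 a).

Lemma clip_ge0 a : 0 <= clip a. Proof. by rewrite /clip le_max lexx. Qed.
Lemma clip_le1 a : clip a <= 1. Proof. by rewrite /clip ge_max ler01 ge_min lexx. Qed.

Lemma clip_lipschitz (a b : R) : `|clip a - clip b| <= `|a - b|.
Proof.
wlog ab : a b / a <= b.
  by move=> W; have [/W//|/ltW/W] := leP a b; rewrite distrC [ `|b - a|]distrC.
rewrite [ `|a - b|]distrC [leLHS]distrC [leRHS]ger0_norm ?subr_ge0// ler_norml.
rewrite /clip; case: (leP 1 a) => a1; case: (leP 1 b) => b1; rewrite ?(max_r ler01).
- by apply/andP; split; lra.
- by apply/andP; split; lra.
- by case: (leP 0 a) => a0; apply/andP; split; lra.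
by case: (leP 0 a) => a0; case: (leP 0 b) => b0; apply/andP; split; lra.
Qed.

Lemma max0_lipschitz (a b : R) : `|Num.max 0 a - Num.max 0 b| <= `|a - b|.
Proof.
have := normr_ge0 (a - b); rewrite !ler_norml; have := ler_norm (a - b); have := ler_norm (- (a - b)).
rewrite normrN; case: (leP 0 a) => ?; case: (leP 0 b) => ? *; apply/andP; split; lra.
Qed.

Definition bump (L : R) x : C := Complex (clip (L + 1 - `|x|)) 0.

Lemma bump_in L x : `|x| <= L -> bump L x = 1.
Proof.
move=> xL; rewrite /bump /clip (min_idPl _); last by lra.
by rewrite (max_idPr _) ?ler01.
Qed.

Lemma vanish_bump L : vanish (L + 1) (bump L).
Proof.
move=> x xL; rewrite /bump /clip (min_idPr _); last by lra.
by rewrite (max_idPl _)//; lra.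
Qed.

Lemma normc_bump L x : normc (bump L x) = complex.Re (bump L x).
Proof. by rewrite normc_real ger0_norm// clip_ge0. Qed.

Lemma bump_le1 L x : normc (bump L x) <= 1.
Proof. by rewrite normc_bump clip_le1. Qed.

Lemma bump_lipschitz L x y : normc (bump L x - bump L y) <= `|x - y|.
Proof.
rewrite /bump -[X in normc X]/(Complex (clip (L + 1 - `|x|) - clip (L + 1 - `|y|)) (0 - 0)) subrr normc_real.
apply: le_trans (clip_lipschitz _ _) _; rewrite opprD opprK addrACA subrr add0r addrC distrC.
rewrite distrC; have A := ler_normD (x - y) y; have B := ler_normD (y - x) x.
rewrite !subrK [ `|y - x|]distrC in A B.
by rewrite ler_norml; apply/andP; split; lra.
Qed.

Lemma Cc_bump L : 0 <= L -> Cc (bump L).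
Proof.
move=> L0; apply/CcP; split; last by exists (L + 1); [lra|exact: vanish_bump].
by move=> e e0; exists e => // x y xy; apply: le_trans (bump_lipschitz _ _ _) (ltW xy).
Qed.

Lemma nint_bump_ge L : 0 <= L -> (2 * L) ^+ d <= nint (bump L).
Proof.
move=> L0; rewrite (nintE (@vanish_bump L)).
have bb : bcont (fun x => normc (bump L x)).
  have -> : (fun x => normc (bump L x)) = (fun x => complex.Re (bump L x)).
    by apply/funext => x; rewrite normc_bump.
  by apply: buc_Re; apply: Cc_buc; exact: Cc_bump.
rewrite (rint_split (borel_cube _) (borel_cube L) (vol_cube_fin _) bb).
apply: ler_wpDr; first by apply: rint_ge0 => x _; exact: normc_ge0.
rewrite (_ : _ `&` _ = cube L); last first.
  by apply/seteqP; split => x /=; [case|rewrite /cube /= => H; split=> //; apply: le_trans H _; rewrite lerDl].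
rewrite (rint_eq (g := fun=> 1)); last by move=> x H; rewrite bump_in// normc1.
by rewrite (rint_cst (borel_cube _)) mul1r ?vol_cube.
Qed.

Lemma nint_bump_le L : 0 <= L -> nint (bump L) <= (2 * (L + 1)) ^+ d.
Proof.
move=> L0; have L1 : 0 <= L + 1 by lra.
rewrite (nintE (@vanish_bump L)).
have bb : bcont (fun x => normc (bump L x)).
  have -> : (fun x => normc (bump L x)) = (fun x => complex.Re (bump L x)).
    by apply/funext => x; rewrite normc_bump.
  by apply: buc_Re; apply: Cc_buc; exact: Cc_bump.
apply: le_trans (_ : rint (cube (L + 1) : set V) (fun=> 1 : R) <= _); last first.
  by rewrite (rint_cst (borel_cube _)) mul1r (vol_cube L1).
apply: rint_le => //; [exact: borel_cube|exact: vol_cube_fin| |by move=> x _; exact: bump_le1].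
exact: (buc_Re (buc_cst (1 : C))).
Qed.

Lemma integral_bump L : integral_Rd (bump L) = Complex (nint (bump L)) 0.
Proof.
rewrite /nint [LHS]integral_onE; rewrite [X in Complex X _](_ : _ = complex.Re (integral_Rd (fun x => Complex (normc (bump L x)) 0))).
  by congr Complex; rewrite (@rint_supp _ _ set0) ?rint_eq0.
rewrite /integral_Rd Re_integral_on; apply: rint_eq => x _.
by rewrite normc_bump.
Qed.

Lemma unit_mass : exists2 g : V -> C, Cc g & integral_Rd g = 1.
Proof.
have b0 : 0 < nint (bump 1).
  by apply: lt_le_trans (nint_bump_ge ler01); rewrite exprn_gt0// mulr1.
exists (fun x => Complex (nint (bump 1))^-1 0 * bump 1 x); first exact: CcZ (Cc_bump ler01).
rewrite integral_RdZ ?integral_bump; last exact: Cc_bump ler01.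
by simpc; rewrite mulVf// gt_eqF.
Qed.

(** The mean of f * k is the integral of f times the mean of k, because the
    convolution is a uniform limit of combinations of translates of k whose
    coefficients add up to the integral. *)
Lemma amean_conv f k m : Cc f -> buc k -> amean k m ->
  amean (fun x => integral_Rd (fun y => f y * k (x - y))) (integral_Rd f * m).
Proof.
move=> cf bk km; apply: amean_limit => e e0.
have n1 : 0 < nint f + 1 by rewrite ltr_wpDl// nint_ge0.
have e'0 : 0 < e / (nint f + 1) by rewrite divr_gt0.
have [del del0 Hdel] := bk.2 _ e'0.
have [uf [r r0 vf]] := iffLR (CcP f) cf.
have [s [_ _ Hs]] := riemann_sum uf vf del0.
have Es : integral_Rd f = \sum_(p <- s) p.1.
  apply/subr0_eq/normc_le0.
  have := Hs (fun=> 1) 0 (lexx 0); rewrite mul0r.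
  under [X in integral_Rd X]eq_fun do rewrite mulr1.
  under eq_bigr do rewrite mulr1; apply=> //.
    by under eq_fun do rewrite mulr1.
  by move=> x y _ _ _; rewrite subrr normc0.
exists (fun x => \sum_(p <- s) p.1 * k (x - p.2)), (integral_Rd f * m); split.
- rewrite Es mulr_suml; apply: amean_sum => p; apply: ameanZ; exact: amean_translate.
- by rewrite subrr normc0 ltW.
move=> x; apply: le_trans (Hs (fun y => k (x - y)) (e / (nint f + 1)) (ltW e'0) _ _) _.
- by apply: CcM => //; exact: buc_reflect.
- by move=> y y' _ _ yy; apply: Hdel; rewrite opprB addrC addrA subrK distrC.
by rewrite mulrAC ler_pdivrMr// ler_pM2l// lerDl.
Qed.

End means.
(** * Absolutely summable families *)

Section summable.
Context {R : realType} {I : eqType}.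
Local Notation C := (R[i]^o).
Implicit Types (a : I -> C) (F : I -> C) (Y s : seq I).

Definition abs_summable a := exists S : R, forall s, uniq s -> \sum_(y <- s) normc (a y) <= S.

(** Finite approximations of an absolutely convergent sum are described by the size
    of what they leave out, so that all sums can be kept finite. *)
Definition tail_le a Y (e : R) := uniq Y /\
  forall s, uniq s -> (forall y, y \in s -> y \notin Y) -> \sum_(y <- s) normc (a y) <= e.

Lemma summable_tail a (e : R) : abs_summable a -> 0 < e -> exists Y, tail_le a Y e.
Proof.
move=> [S HS] e0; pose A := [set r : R | exists2 s, uniq s & r = \sum_(y <- s) normc (a y)].
have hA : has_sup A.
  by split; [exists 0, [::]; rewrite ?big_nil|exists S => _ [s us ->]; exact: HS].
have [_ [Y uY ->] HY] := sup_adherent e0 hA; exists Y; split=> // s us sY.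
have : \sum_(y <- Y ++ s) normc (a y) <= sup A.
  apply: sup_upper_bound => //; exists (Y ++ s) => //.
  rewrite cat_uniq uY us /= andbT; apply/hasPn => y /sY; by [].
rewrite big_cat /=; lra.
Qed.

Lemma tail_le_tail a Y e y : tail_le a Y e -> y \notin Y -> normc (a y) <= e.
Proof.
move=> [_ H] yY; have := H [:: y] isT; rewrite big_seq1; apply.
by move=> y'; rewrite inE => /eqP ->.
Qed.

Lemma tail_le_mul a F Y e : tail_le a Y e -> (forall y, normc (F y) <= normc (a y)) -> tail_le F Y e.
Proof.
move=> [uY H] Fa; split=> // s us sY; apply: le_trans (H s us sY); exact: ler_sum.
Qed.

Lemma tail_compare a Y Y' e e' : tail_le a Y e -> tail_le a Y' e' ->
  normc (\sum_(y <- Y) a y - \sum_(y <- Y') a y) <= e + e'.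
Proof.
move=> [uY HY] [uY' HY']; rewrite (bigID (mem Y')) [X in _ - X](bigID (mem Y)) /=.
have -> : \sum_(y <- Y | y \in Y') a y = \sum_(y <- Y' | y \in Y) a y.
  rewrite -big_filter -[RHS]big_filter; apply: perm_big; apply: uniq_perm; rewrite ?filter_uniq//.
  by move=> y; rewrite !mem_filter andbC.
have -> : forall p q r : C, p + q - (p + r) = q - r by move=> p q r; ring.
have H s s' r : uniq s -> (forall t, uniq t -> (forall y, y \in t -> y \notin s') -> \sum_(y <- t) normc (a y) <= r) ->
    normc (\sum_(y <- s | y \notin s') a y) <= r.
  move=> us K; apply: le_trans (normc_sum _ _ _) _; rewrite -big_filter.
  by apply: K; [exact: filter_uniq|move=> y; rewrite mem_filter => /andP[]].
apply: le_trans (normcB _ _) _; rewrite addrC; apply: lerD; exact: H.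
Qed.

Lemma summable_limit a : abs_summable a ->
  exists z : C, forall Y e, tail_le a Y e -> normc (z - \sum_(y <- Y) a y) <= 2 * e.
Proof.
move=> sa; pose J := {p : seq I * R | tail_le a p.1 p.2}.
have [Y0 HY0] := summable_tail sa ltr01.
have [|z Hz] := compatible_limit (exist _ (Y0, 1) HY0 : J)
   (m := fun j => \sum_(y <- (sval j).1) a y) (e := fun j => (sval j).2).
  by move=> [p hp] [p' hp']; exact: tail_compare.
by exists z => Y e H; exact: (Hz (exist _ (Y, e) H)).
Qed.

End summable.

Section uniqueness.
Context {R : realType} {d : nat}.
Local Notation V := 'rV[R]_d.
Local Notation C := (R[i]^o).
Implicit Types (f g h k w : V -> C) (x y t z : V).

(** * Vanishing of almost periodic functions without Fourier coefficients *)

Lemma ap_lipschitz (phi : C -> C) h : (forall a b, normc (phi a - phi b) <= normc (a - b)) ->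
  ap h -> ap (fun x => phi (h x)).
Proof.
move=> Lphi [[[M hM] uh] th]; split; first split.
- exists (M + normc (phi 0)) => x; apply: le_trans (normc_dist _ (phi 0)) _; rewrite addrC lerD2r.
  by apply: le_trans (Lphi _ _) _; rewrite subr0.
- by move=> e e0; have [del del0 H] := uh _ e0; exists del => // x y /H; exact: le_trans.
- move=> e e0; have [T [c Hc]] := th _ e0; exists T, c => s t E x.
  by apply: le_trans (Lphi _ _) _; exact: Hc.
Qed.

(** The uniform distance between h and its translate by t, a function whose small
    values mark the almost periods of h. *)
Definition deviation h t : C := Complex (sup_norm (fun z => h (z - t) - h z)) 0.

Lemma bdd_translateB h s t : bdd h -> bdd (fun z => h (z - s) - h (z - t)).
Proof.
move=> [M hM]; exists (M + M) => z; apply: le_trans (normcB _ _) _; exact: lerD.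
Qed.

Lemma deviation_ub h t z : bdd h -> normc (h (z - t) - h z) <= complex.Re (deviation h t).
Proof.
move=> bh; apply: (@le_sup_norm _ _ (fun z => h (z - t) - h z)).
by have [M hM] := bdd_translateB t 0 bh; exists M => u; have := hM u; rewrite subr0.
Qed.

Lemma deviation_lipschitz h s t (e : R) : bdd h ->
  (forall z, normc (h (z - s) - h (z - t)) <= e) ->
  normc (deviation h s - deviation h t) <= e.
Proof.
move=> bh H.
have le a b : (forall z, normc (h (z - a) - h (z - b)) <= e) ->
    complex.Re (deviation h a) <= complex.Re (deviation h b) + e.
  move=> K; apply: sup_norm_le => z; apply: le_trans (normc_tri (h (z - b)) _ _) _.
  by rewrite addrC; apply: lerD => //; exact: deviation_ub.
have l1 := le _ _ H; have l2 := le t s (fun z => eq_ind _ (fun r => r <= e) (H z) _ (normcBC _ _)).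
rewrite -[X in normc X]/(Complex (complex.Re (deviation h s) - complex.Re (deviation h t)) (0 - 0)) subrr normc_real.
by rewrite ler_norml; apply/andP; split; lra.
Qed.

Lemma ap_deviation h : ap h -> ap (deviation h).
Proof.
move=> [[bh uh] th]; split; first split.
- have [M hM] := bh; exists (M + M) => t; rewrite normc_real.
  have H : sup_norm (fun z => h (z - t) - h z) <= M + M.
    by apply: sup_norm_le => z; apply: le_trans (normcB _ _) _; exact: lerD.
  rewrite ger0_norm//; apply: le_trans (deviation_ub t 0 bh); exact: normc_ge0.
- move=> e e0; have [del del0 H] := uh _ e0; exists del => // s t st.
  apply: deviation_lipschitz => // z; apply: H.
  by rewrite opprB addrC addrA subrK distrC.
- move=> e e0; have [T [c Hc]] := th _ e0; exists T, c => s t E x.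
  apply: deviation_lipschitz => // z; have := Hc s t E (z - x + s + t); rewrite addrK normcBC.
  rewrite (_ : z - x + s + t - s = z - (x - t)); last by rewrite opprB addrAC addrK addrA addrAC.
  by rewrite (_ : z - (x - s) = z - x + s) // opprB addrA addrAC.
Qed.

(** A nonnegative almost periodic function that is not zero somewhere stays
    away from zero on a relatively dense set, and thus has positive mean. *)
Lemma ap_positive_mean g m z : ap g -> (forall x, g x = Complex (complex.Re (g x)) 0) ->
  (forall x, 0 <= complex.Re (g x)) -> 0 < complex.Re (g z) -> amean g m -> 0 < complex.Re m.
Proof.
move=> [bg tg] gR g0 gz gm; set a := complex.Re (g z) in gz.
have a20 : 0 < a / 2 by rewrite divr_gt0.
have [T [c Hc]] := tg _ a20; have [r Hr] := class_representatives c.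
pose S := [seq r v | v <- enum T].
have T0 : (0 < #|T|)%N by apply/card_gt0P; exists (c 0).
have S0 : S != [::] by rewrite -size_eq0 size_map -cardE -lt0n.
have n0 : 0 < #|T|%:R :> R by rewrite ltr0n.
pose del := (#|T|%:R)^-1 * (a / 2); have del0 : 0 < del by rewrite mulr_gt0// invr_gt0.
have ReA s x : complex.Re (avg s g x) = (size s)%:R^-1 * \sum_(t <- s) complex.Re (g (x - t)).
  by rewrite /avg ReZ Re_sum.
have H1 x : del <= complex.Re (avg S g x).
  rewrite ReA size_map -cardE ler_pM2l ?invr_gt0// big_map big_enum /= (bigD1 (c (x - z)))//=.
  apply: ler_wpDr; first by apply: sumr_ge0 => v _; exact: g0.
  have := Hc _ _ (Hr (x - z)) x; rewrite subKr => K.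
  have := le_trans (Re_le_normc _) K; rewrite ReD ReN -/a ler_norml => /andP[L _]; lra.
have H2 s : s != [::] -> del <= complex.Re (avg s (avg S g) 0).
  move=> s0; have p0 : 0 < (size s)%:R :> R by rewrite ltr0n lt0n size_eq0.
  rewrite /avg ReZ Re_sum ler_pdivlMl//.
  have -> : (size s)%:R * del = \sum_(t <- s) del by rewrite big_const_seq count_predT iter_addr_0 mulr_natl.
  apply: ler_sum => t _; exact: H1.
have [|s s0 Hs] := gm (del / 2); first by rewrite divr_gt0.
have H3 : normc (avg S (avg s g) 0 - m) <= del / 2.
  rewrite -[m in leLHS](@avg_cst _ _ S _ 0)// -avgB; apply: avg_le => // t _; exact: Hs.
have := H2 s s0; rewrite avg_sumsC => H4.
have := le_trans (Re_le_normc _) H3; rewrite ReD ReN ler_norml => /andP[L1 L2]; lra.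
Qed.

Lemma seq_bound (I : eqType) (s : seq I) (F : I -> R) : exists2 M, 0 <= M & forall i, i \in s -> F i <= M.
Proof.
elim: s => [|a s [M M0 HM]]; first by exists 0.
exists (Num.max M (F a)); first by rewrite le_max M0.
by move=> i; rewrite inE => /orP[/eqP ->|/HM H]; rewrite le_max ?lexx ?orbT// H.
Qed.

(** Averages of h against all characters are small over translations of a
    common size: for bounded frequencies by compactness, for large ones because
    h is nearly invariant under the short shift by half a period. *)
Lemma uniform_small_averages h (eta : R) : ap h -> 0 < eta ->
  (forall y, amean (fun x => h x * conjc (chi y x)) 0) ->
  exists2 rho : R, 0 <= rho & forall y, exists s, [/\ s != [::],
    forall t, t \in s -> `|t| <= rho & forall x, normc (avg s (fun x => h x * conjc (chi y x)) x) <= eta].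
Proof.
move=> [[bh uh] th] eta0 H0.
have [M M0 hM] := bddW bh.
have e20 : 0 < eta / 2 by rewrite divr_gt0.
have [del del0 Hdel] := uh _ eta0.
have eM : 0 < eta / 2 / M by rewrite divr_gt0.
have [del' del'0 Hdel'] := @chi_near1 R d _ eM.
pose Y := del^-1; have Y0 : 0 < Y by rewrite invr_gt0.
have /choice[s Hs] : forall y, exists s : seq V, s != [::] /\
    forall x, normc (avg s (fun x => h x * conjc (chi y x)) x) <= eta / 2.
  by move=> y; have [s s0 Hs] := H0 y _ e20; exists s; split=> // x; have := Hs x; rewrite subr0.
have /choice[rho Hrho] : forall y, exists rho : R, 0 <= rho /\ forall t, t \in s y -> `|t| <= rho.
  by move=> y; have [r r0 Hr] := seq_bound (s y) (fun t => `|t|); exists r.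
pose U c := [set y : V | `|y - c| < del' / (rho c + 1)].
have [|l [_ Hl]] := @compact_net R d _ U (@compact_ball R d Y).
  move=> c _; split; first exact: open_ball_norm.
  by rewrite /U /= subrr normr0 divr_gt0// ltr_wpDl//; exact: (Hrho c).1.
have [r r0 Hr] := seq_bound l rho.
exists (Num.max r del); first by rewrite le_max r0.
move=> y; have [yY|yY] := leP `|y| Y.
  have [c cl Uc] := Hl _ yY; exists (s c); have [sc0 Hc] := Hs c; split=> //.
    move=> t ts; rewrite le_max; apply/orP; left.
    by apply: le_trans (Hr _ cl); exact: (Hrho c).2.
  move=> x; pose q := y - c.
  have E : avg (s c) (fun x => h x * conjc (chi y x)) x = conjc (chi q x) *
      (avg (s c) (fun x => h x * conjc (chi c x)) x +
       avg (s c) (fun u => h u * conjc (chi c u) * (chi q (x - u) - 1)) x).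
    rewrite -avgD /avg mulrCA; congr (_ * _); rewrite mulr_sumr; apply: eq_bigr => t _.
    rewrite subKr -{1}[y](subrK c) -/q chiDl conjcM2 [chi q (x - t)]chiB conjcM2 conjcK2.
    ring.
  rewrite E normcM2 normcJ normc_chi mul1r; apply: le_trans (normcD _ _) _.
  have H1 : normc (avg (s c) (fun u => h u * conjc (chi c u) * (chi q (x - u) - 1)) x) <= eta / 2.
    apply: avg_le => // t ts; rewrite subKr !normcM2 normcJ normc_chi mulr1.
    have -> : eta / 2 = M * (eta / 2 / M) by field; rewrite gt_eqF.
    apply: ler_pM; rewrite ?normc_ge0//; apply: Hdel'.
    have rc0 : 0 < rho c + 1 by rewrite ltr_wpDl//; exact: (Hrho c).1.
    apply: (@le_lt_trans _ _ ((rho c + 1) * `|q|)).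
      by rewrite ler_wpM2r//; have := (Hrho c).2 _ ts; lra.
    by rewrite mulrC -ltr_pdivlMr.
  have := Hc x; lra.
have y0 : y != 0 by apply: contraTneq yY => ->; rewrite normr0 -leNgt ltW.
have [t Ht tn] := chi_minus1 y0.
have td : `|t| < del.
  have yp : 0 < `|y| := lt_trans Y0 yY.
  apply: le_lt_trans tn _; rewrite -[del]invrK ltf_pV2 ?posrE ?invr_gt0 ?mulr_gt0//.
  by rewrite -/Y; apply: lt_trans yY _; lra.
exists [:: 0; t]; split=> //.
  move=> u; rewrite !inE => /orP[/eqP ->|/eqP ->]; rewrite le_max.
    by rewrite normr0 (ltW del0) orbT.
  by rewrite (ltW td) orbT.
move=> x; rewrite /avg !big_cons big_nil addr0 subr0 [chi y (x - t)]chiB Ht.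
have -> : h x * conjc (chi y x) + h (x - t) * conjc (chi y x * conjc (-1)) =
    (h x - h (x - t)) * conjc (chi y x) :> R[i].
  by rewrite conjcM2 conjcK2; ring.
rewrite !normcM2 normcJ normc_chi mulr1 normc_real ger0_norm ?invr_ge0//= ler_pdivrMl//.
have : normc (h x - h (x - t)) <= eta by apply: Hdel; rewrite subKr.
by have := normc_ge0 (h x - h (x - t)); lra.
Qed.

(** An average of translates of g may be introduced under the integral, at the
    cost of the distances between w and its translates. *)
Lemma integral_weighted_average w g s (eta M D : R) : Cc w -> buc g -> s != [::] ->
  (forall x, normc (g x) <= M) -> 0 <= eta -> (forall x, normc (avg s g x) <= eta) ->
  (forall t, t \in s -> nint (fun x => w x - w (x + t)) <= D) ->
  normc (integral_Rd (fun x => w x * g x)) <= eta * nint w + M * D.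
Proof.
move=> cw bg s0 gM eta0 sg wD.
have M0 : 0 <= M := le_trans (normc_ge0 _) (gM 0).
have ctr t : Cc (fun x => w x * g (x + t)).
  by apply: CcM => //; have := buc_translate (- t) bg; under eq_fun do rewrite opprK.
have bavg : buc (avg s g) by apply: bucZ; apply: buc_sum => t; exact: buc_translate.
have E : integral_Rd (fun x => w x * avg s g x) =
    avg s (fun u => integral_Rd (fun x => w x * g (x + u))) 0.
  rewrite /avg; under [X in integral_Rd X]eq_fun do rewrite mulrCA mulr_sumr.
  rewrite integral_RdZ; last by apply: Cc_sum => t; exact: ctr.
  rewrite integral_Rd_sum; last by move=> t; exact: ctr.
  by congr (_ * _); apply: eq_bigr => t _; rewrite sub0r.
apply: le_trans (normc_dist _ (integral_Rd (fun x => w x * avg s g x))) _; apply: lerD.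
  apply: normc_integral_mul => //; exact: CcM.
rewrite E -[integral_Rd (fun x => w x * g x) in leLHS](@avg_cst _ _ s _ 0)// -avgB.
apply: avg_le => // t ts; rewrite sub0r.
have cg : Cc (fun x => w x * g x) by apply: CcM.
have cwt : Cc (fun x => w (x + t)).
  by have := Cc_translate (- t) cw; under eq_fun do rewrite opprK.
have -> : integral_Rd (fun x => w x * g (x - t)) = integral_Rd (fun x => w (x + t) * g x).
  rewrite -(integral_Rd_translate t (ctr (- t))); apply: integral_Rd_ext => x.
  by rewrite addrK.
rewrite -integral_RdB//; last exact: CcM.
rewrite (integral_Rd_ext (g := fun x => (w x - w (x + t)) * g x)); last by move=> x; rewrite mulrBl.
apply: le_trans (_ : M * nint (fun x => w x - w (x + t)) <= _); last by rewrite ler_wpM2l// wD.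
by apply: normc_integral_mul => //; [exact: CcB|apply: CcM => //; exact: CcB].
Qed.

(** The difference vanishes on the smaller and outside of the larger of two
    cubes. *)
Lemma nint_bump_shift (L rho : R) t : 0 <= rho -> rho <= L -> `|t| <= rho ->
  nint (fun x => bump L x - bump L (x + t)) <= (2 * (L + 1 + rho)) ^+ d - (2 * (L - rho)) ^+ d.
Proof.
move=> rho0 rL tr; have L0 : 0 <= L by lra.
pose a := L + 1 + rho; pose b := L - rho.
have a0 : 0 <= a by rewrite /a; lra. have b0 : 0 <= b by rewrite /b; lra.
have cb := Cc_bump (d := d) L0.
have cD : Cc (fun x => bump L x - bump L (x + t)).
  by apply: CcB => //; have := Cc_translate (- t) cb; under eq_fun do rewrite opprK.
have vD : vanish a (fun x => bump L x - bump L (x + t)).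
  move=> x xa; rewrite (@vanish_bump R d L x); last by rewrite /a in xa; lra.
  rewrite (@vanish_bump R d L (x + t)) ?subrr//.
  by have := ler_normB (x + t) t; rewrite addrK /a in xa *; lra.
rewrite (nintE vD).
have bn : bcont (fun x => normc (bump L x - bump L (x + t))).
  exact: (buc_Re (buc_normc (Cc_buc cD))).
rewrite (rint_split (borel_cube a) (borel_cube b) (vol_cube_fin a) bn).
have ba : b <= a by rewrite /a /b; lra.
have E : @cube R d a `&` cube b = cube b.
  by apply/seteqP; split => x /=; [case|rewrite /cube /= => H; split=> //; apply: le_trans H ba].
have r1 (A : set V) : borel A -> (vol A < +oo)%E -> rint A (fun=> 1 : R) = fine (vol A).
  by move=> mA vA; rewrite rint_cst// mul1r.
have split1 := rint_split (@borel_cube R d a) (borel_cube b) (vol_cube_fin a) (buc_Re (buc_cst (1 : C))).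
rewrite E !r1 ?vol_cube// in split1; try exact: borel_cube; try exact: vol_cube_fin.
all: try by apply: borelD; exact: borel_cube.
all: try by apply: vol_diff_finite; [exact: borel_cube|exact: borel_cube|exact: vol_cube_fin].
all: try exact: ltry.
rewrite E (@rint_eq _ _ (cube b) _ (fun=> 0 * 1)); last first.
  move=> x; rewrite /cube /= /b => xb; rewrite !bump_in ?subrr ?normc0 ?mul0r//; last by lra.
  by have := ler_normD x t; lra.
rewrite rint_cst ?mul0r ?add0r; last exact: borel_cube.
have -> : (2 * a) ^+ d - (2 * b) ^+ d = fine (vol (cube a `\` cube b : set V)).
  by apply/eqP; rewrite subr_eq addrC; apply/eqP; exact: split1.
rewrite -r1; last 2 first.
- by apply: borelD; exact: borel_cube.
- by apply: vol_diff_finite; [exact: borel_cube|exact: borel_cube|exact: vol_cube_fin].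
apply: rint_le => //.
- by apply: borelD; exact: borel_cube.
- by apply: vol_diff_finite; [exact: borel_cube|exact: borel_cube|exact: vol_cube_fin].
- exact: (buc_Re (buc_cst (1 : C))).
move=> x _; rewrite /bump -[X in normc X]/(Complex (clip (L + 1 - `|x|) - clip (L + 1 - `|x + t|)) (0 - 0)) subrr normc_real.
have := clip_ge0 (L + 1 - `|x|); have := clip_le1 (L + 1 - `|x|).
have := clip_ge0 (L + 1 - `|x + t|); have := clip_le1 (L + 1 - `|x + t|).
by move=> *; rewrite ler_norml; apply/andP; split; lra.
Qed.

Lemma nint_ge_cube f r : Cc f -> rint (cube r) (fun x => normc (f x)) <= nint f.
Proof.
move=> cf; have [_ [s s0 vf]] := iffLR (CcP f) cf.
have vm : vanish (Num.max r s) f by apply: vanish_le vf; rewrite le_max lexx orbT.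
rewrite (nintE vm) [leRHS](rint_split (borel_cube _) (borel_cube r) (vol_cube_fin _) (buc_Re (buc_normc (Cc_buc cf)))).
rewrite (_ : _ `&` _ = cube r); last first.
  apply/seteqP; split => x /=; [by case|rewrite /cube /= => H; split=> //].
  by rewrite le_max H.
by rewrite lerDl; apply: rint_ge0 => x _; exact: normc_ge0.
Qed.

Lemma msq_nint f : msq f = nint (fun x => f x * conjc (f x)).
Proof.
rewrite /msq /nint; congr complex.Re; apply: integral_Rd_ext => x.
by rewrite mulcJ normc_real ger0_norm// exprn_ge0// normc_ge0.
Qed.

Lemma mean_lower_bound g m : ap g -> amean g m -> 0 < complex.Re m ->
  \forall n \near \oo, complex.Re m / 2 * (2 * n.+1%:R) ^+ d <= rint (cube n.+1%:R) (fun x => complex.Re (g x)).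
Proof.
move=> [bg tg] gm m0; have m20 : 0 < complex.Re m / 2 by rewrite divr_gt0.
have /cvg_normcP/(_ _ m20) := amean_has_mean bg gm cubes_folner.
apply: filterS => n; have n0 : (0 : R) <= n.+1%:R by [].
have p0 : 0 < (2 * n.+1%:R : R) ^+ d by rewrite exprn_gt0// mulr_gt0// ltr0n.
rewrite vol_cube//= => H; have := le_lt_trans (Re_le_normc _) H.
rewrite ReD ReN ReZ Re_integral_on ltr_norml => /andP[K _].
by rewrite mulrC -ler_pdivlMl//; lra.
Qed.

Lemma thin_shell (a b e : R) : 0 < e ->
  \forall n \near \oo, (2 * (2 * n.+1%:R + a)) ^+ d - (2 * (2 * n.+1%:R + b)) ^+ d <= e * (2 * n.+1%:R) ^+ d.
Proof.
move=> e0; have E1 (c : R) : (fun n => 2 + c / n.+1%:R) @ \oo --> (2 : R).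
  rewrite -[X in _ --> X](addr0 (2 : R)); apply: cvgD; first exact: cvg_cst.
  by rewrite -[X in _ --> X](mulr0 c); apply: cvgM; [exact: cvg_cst|exact: cvg_harmonic].
have E0 : (fun n => (2 + a / n.+1%:R) ^+ d - (2 + b / n.+1%:R) ^+ d) @ \oo --> (0 : R).
  rewrite -[X in _ --> X](subrr ((2 : R) ^+ d)).
  exact: cvgB (cvg_comp _ _ (E1 a) (@exprn_continuous _ d 2)) (cvg_comp _ _ (E1 b) (@exprn_continuous _ d 2)).
have /cvgrPdist_lt/(_ _ e0) := E0; apply: filterS => n /=.
have n0 : 0 < (n.+1%:R : R) by rewrite ltr0n.
have p0 : 0 < (2 * n.+1%:R : R) ^+ d by rewrite exprn_gt0// mulr_gt0.
rewrite sub0r normrN => /ltr_normlW H.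
have E (c : R) : (2 * (2 * n.+1%:R + c)) ^+ d = (2 + c / n.+1%:R) ^+ d * (2 * n.+1%:R) ^+ d.
  by rewrite -exprMn; congr (_ ^+ _); field; rewrite gt_eqF.
by rewrite !E -mulrBl ler_wpM2r ?(ltW p0)// (ltW H).
Qed.

(** Suppose h z != 0 and compare, over a large cube of side P^(1/d), two
    estimates of the square mean of u * f, where u is h cut off at a larger cube
    and f is the cut-off of k = (e - p)_+, with p(t) the uniform distance between
    h and its translate by t. Since k only sees translations that move h by at
    most e, u * f is close to h times the integral of f, which is of order P; so
    the square mean has order P^2 * P. On the other hand the Fourier transform
    of u is o(P), and the square mean of f is of order P. *)
Lemma ap_uniqueness h z : ap h -> (forall y, amean (fun x => h x * conjc (chi y x)) 0) -> h z = 0.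
Proof.
move=> ah H0; apply/normc_le0; rewrite leNgt; apply/negP => hz.
have [bh th] := ah; have [M M0 hM] := bddW bh.1.
pose e := normc (h z) / 4; have e0 : 0 < e by rewrite divr_gt0.
pose g x : C := Complex (Num.max 0 (normc (h x) - e)) 0.
pose k t : C := Complex (Num.max 0 (e - complex.Re (deviation h t))) 0.
have lip_of (q : C -> R) : (forall a b, `|q a - q b| <= normc (a - b)) -> forall a b : C,
    normc (Complex (Num.max 0 (q a)) 0 - Complex (Num.max 0 (q b)) 0 : C) <= normc (a - b).
  move=> Hq a b; rewrite -[X in normc X]/(Complex (Num.max 0 (q a) - Num.max 0 (q b)) (0 - 0)) subrr normc_real.
  exact: le_trans (max0_lipschitz _ _) (Hq a b).
have ag : ap g.
  apply: (@ap_lipschitz (fun a => Complex (Num.max 0 (normc a - e)) 0)) => //.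
  apply: lip_of => a b; rewrite opprB addrA subrK.
  have A := normc_dist a b; have B := normc_dist b a; rewrite normcBC in B.
  by rewrite ler_norml; apply/andP; split; lra.
have ak : ap k.
  apply: (@ap_lipschitz (fun a => Complex (Num.max 0 (e - complex.Re a)) 0)); last exact: ap_deviation.
  apply: lip_of => a b; rewrite opprB addrC addrA subrK distrC -ReN -ReD; exact: Re_le_normc.
pose g2 x : C := g x * g x; have ag2 : ap g2 := apM ag ag.
have g2E x : g2 x = Complex (Num.max 0 (normc (h x) - e) ^+ 2) 0 by rewrite /g2 /g expr2; simpc.
have [mk Hk] := amean_exists ak; have [mg Hg] := amean_exists ag2.
have k0 t : 0 <= complex.Re (k t) by rewrite /= le_max lexx.
have ke t : complex.Re (k t) <= e.
  have := le_trans (normc_ge0 _) (deviation_ub t 0 bh.1).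
  by rewrite /= ge_max (ltW e0) /= => ?; lra.
have mk0 : 0 < complex.Re mk.
  apply: (@ap_positive_mean k mk 0) => //; rewrite /= lt_max; apply/orP; right.
  rewrite subr_gt0; apply: le_lt_trans e0; apply: sup_norm_le => x.
  by rewrite subr0 subrr normc0.
have mg0 : 0 < complex.Re mg.
  apply: (@ap_positive_mean g2 mg z) => //.
  - by move=> x; rewrite g2E.
  - by move=> x; rewrite g2E /= sqr_ge0.
  by rewrite g2E /= exprn_gt0// lt_max; apply/orP; right; rewrite /e; lra.
pose c := complex.Re mk / 2; pose c' := complex.Re mg / 2.
have c0 : 0 < c by rewrite divr_gt0. have c'0 : 0 < c' by rewrite divr_gt0.
(* The square mean will be at least c * c' * P^2 * nint f, and at most
   q^2 * e * P^2 * nint f. *)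
pose q := Num.min 1 (c * c' / (2 * e)).
have q0 : 0 < q by rewrite lt_min ltr01 /= divr_gt0// mulr_gt0.
have qe : q ^+ 2 * e < c * c'.
  have q1 : q <= 1 by rewrite ge_min lexx.
  have q2 : q <= c * c' / (2 * e) by rewrite ge_min lexx orbT.
  apply: (@le_lt_trans _ _ (c * c' / (2 * e) * e)).
    rewrite ler_wpM2r ?(ltW e0)//; apply: le_trans q2; rewrite expr2 ger_pMl//.
  have -> : c * c' / (2 * e) * e = c * c' / 2 by field; rewrite gt_eqF.
  by rewrite ltr_pdivrMr// ltr_pMr ?mulr_gt0//; lra.
pose eta := q / (4 ^+ d + 1); have p4 : 0 < (4 ^+ d + 1 : R) by rewrite ltr_wpDl// exprn_ge0.
have eta0 : 0 < eta by rewrite divr_gt0.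
have [rho rho0 Hrho] := uniform_small_averages ah eta0 H0.
have etaM : 0 < eta / M by rewrite divr_gt0.
have ev1 := mean_lower_bound ak Hk mk0; have ev2 := mean_lower_bound ag2 Hg mg0.
have ev3 := thin_shell (2 + rho) (1 - rho) etaM.
have ev4 : \forall n \near \oo, rho <= n.+1%:R.
  exists (Num.bound rho) => // n /= Hn; apply: le_trans (ltW (archi_boundP rho0)) _.
  by rewrite ler_nat; exact: leq_trans Hn (leqnSn _).
have [n [[B1 B2] [B3 B4]]] : exists n : nat, (c * (2 * n.+1%:R) ^+ d <= rint (cube n.+1%:R) (fun x => complex.Re (k x)) /\
    c' * (2 * n.+1%:R) ^+ d <= rint (cube n.+1%:R) (fun x => complex.Re (g2 x))) /\
    ((2 * (2 * n.+1%:R + (2 + rho))) ^+ d - (2 * (2 * n.+1%:R + (1 - rho))) ^+ d <= eta / M * (2 * n.+1%:R) ^+ d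
     /\ rho <= n.+1%:R).
  have := filterI (filterI ev1 ev2) (filterI ev3 ev4).
  by move=> [m _ Hm]; exists m; have := Hm m (leqnn m).
set N : R := n.+1%:R in B1 B2 B3 B4; have N1 : 1 <= N by rewrite ler1n.
set P := (2 * N) ^+ d in B1 B2 B3; have P0 : 0 < P by rewrite exprn_gt0//; lra.
pose L := 2 * N + 1; have L0 : 0 <= L by rewrite /L; lra. have N0 : 0 <= N by lra.
pose f x := k x * bump N x; pose u x := bump L x * h x.
have cf : Cc f by apply: CcMl => //; [exact: ak.1|exact: Cc_bump].
have cu : Cc u by apply: CcM => //; exact: Cc_bump.
pose kap := nint f.
have fR x : f x = Complex (normc (f x)) 0.
  rewrite /f normcM2 (normc_bump N) normc_real ger0_norm; last exact: k0.
  by rewrite /k /bump; simpc.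
have fe x : normc (f x) <= e.
  rewrite normcM2 normc_real ger0_norm; last exact: k0.
  apply: le_trans (ke x); rewrite -[leRHS]mulr1; apply: ler_wpM2l; [exact: k0|exact: bump_le1].
have kapE : kap <= normc (integral_Rd f).
  rewrite /kap /nint (integral_Rd_ext (g := f)); last by move=> x; rewrite -fR.
  exact: le_trans (ler_norm _) (Re_le_normc _).
have kapc : c * P <= kap.
  apply: le_trans B1 _; apply: le_trans (nint_ge_cube N cf).
  apply: rint_le; [exact: borel_cube|exact: vol_cube_fin|exact: buc_Re ak.1| |].
    exact: buc_Re (buc_normc (Cc_buc cf)).
  by move=> x xN; rewrite /f bump_in// mulr1; exact: le_trans (ler_norm _) (Re_le_normc _).
have kap0 : 0 < kap by apply: lt_le_trans kapc; rewrite mulr_gt0.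
have nw : nint (@bump R d L) <= 4 ^+ d * P.
  apply: le_trans (nint_bump_le L0) _; rewrite /P -exprMn lerXn2r ?nnegrE//.
  - by rewrite /L; lra.
  - by lra.
  - by rewrite /L; lra.
have fu y : normc (fcheck u y) <= q * P.
  have [s [s0 sr Hs]] := Hrho (- y).
  have -> : fcheck u y = integral_Rd (fun x => bump L x * (h x * conjc (chi (- y) x))).
    by apply: integral_Rd_ext => x; rewrite /u chiNl conjcK2 mulrA.
  have bg : buc (fun x => h x * conjc (chi (- y) x)).
    by apply: bucM; [exact: bh|apply: buc_conj; exact: buc_chi].
  have gM x : normc (h x * conjc (chi (- y) x)) <= M by rewrite normcM2 normcJ normc_chi mulr1.
  have K := integral_weighted_average (Cc_bump L0) bg s0 gM (ltW eta0) Hs.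
  apply: le_trans (K (eta / M * P) _) _ => [t ts|].
    apply: le_trans (nint_bump_shift rho0 _ (sr _ ts)) _; first by rewrite /L; lra.
    apply: le_trans B3; rewrite le_eqVlt; apply/orP; left; apply/eqP.
    by congr (_ ^+ _ - _ ^+ _); rewrite /L; ring.
  apply: le_trans (_ : eta * (4 ^+ d * P) + M * (eta / M * P) <= _).
    by rewrite lerD2r ler_wpM2l// ltW.
  rewrite le_eqVlt; apply/orP; left; apply/eqP; rewrite /eta; field.
  by rewrite !gt_eqF.
have conv_lower x : `|x| <= N -> kap * Num.max 0 (normc (h x) - e) <= normc (convolution u f x).
  move=> xN; rewrite convC//.
  have H : normc (h x * integral_Rd f - convolution f u x) <= e * kap.
    rewrite -integral_RdZ// -integral_RdB; last 2 first.
    - exact: CcZ.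
    - exact: Cc_conv_integrand.
    rewrite (integral_Rd_ext (g := fun t => f t * (h x - u (x - t)))); last by move=> t; ring.
    apply: normc_integral_mul => //.
      by apply: CcM => //; apply: bucB; [exact: buc_cst|exact: buc_reflect (Cc_buc cu)].
    move=> t ft; have tN : `|t| <= N + 1.
      by rewrite leNgt; apply: contra ft => /vanish_bump; rewrite /f => ->; rewrite mulr0.
    have xtL : `|x - t| <= L by rewrite /L; have := ler_normB x t; lra.
    rewrite /u bump_in// mul1r normcBC.
    have dt : complex.Re (deviation h t) <= e.
      rewrite leNgt; apply: contra ft => dt; rewrite /f /k (max_idPl _); last by lra.
      by rewrite mul0r.
    exact: le_trans (deviation_ub t x bh.1) dt.
  have K := normc_dist (h x * integral_Rd f) (convolution f u x); rewrite normcM2 in K.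
  have K2 : normc (h x) * kap <= normc (h x) * normc (integral_Rd f).
    by rewrite ler_wpM2l// normc_ge0.
  have := normc_ge0 (convolution f u x).
  case: (leP 0 (normc (h x) - e)) => ?; last by rewrite mulr0.
  by rewrite mulrBr; lra.
have cF : Cc (convolution u f) by apply: Cc_conv.
have low : kap ^+ 2 * (c' * P) <= msq (convolution u f).
  rewrite msq_nint; apply: le_trans (nint_ge_cube N (CcM cF (buc_conj (Cc_buc cF)))).
  apply: le_trans (ler_wpM2l (exprn_ge0 2 (ltW kap0)) B2) _.
  rewrite -(rintZ (borel_cube N) (vol_cube_fin N)); last exact: buc_Re ag2.1.
  apply: rint_le; [exact: borel_cube|exact: vol_cube_fin| | |].
  - apply: bcontZ; exact: buc_Re ag2.1.
  - exact: buc_Re (buc_normc (Cc_buc (CcM cF (buc_conj (Cc_buc cF))))).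
  move=> x xN; rewrite g2E mulcJ normc_real ger0_norm ?exprn_ge0 ?normc_ge0//.
  rewrite -[complex.Re _]/(Num.max 0 (normc (h x) - e) ^+ 2) -exprMn lerXn2r ?nnegrE ?normc_ge0//.
    by rewrite mulr_ge0 ?(ltW kap0)// le_max lexx.
  exact: conv_lower.
have up : msq (convolution u f) <= (q * P) ^+ 2 * (e * kap).
  have qP0 : 0 <= q * P by rewrite mulr_ge0 ?(ltW q0) ?(ltW P0).
  apply: le_trans (msq_convolution cu cf (exprn_ge0 2 qP0) _) _.
    by move=> y; rewrite lerXn2r ?nnegrE ?normc_ge0.
  apply: ler_wpM2l; first exact: exprn_ge0.
  apply: le_trans (le_trans (ler_norm _) (Re_le_normc _)) _.
  apply: (@normc_integral_mul R d f (fun x => conjc (f x)) e cf).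
    exact: CcM cf (buc_conj (Cc_buc cf)).
  by move=> x _; rewrite normcJ.
have K1 := le_trans low up.
have K2 : kap * (c' * P) <= (q * P) ^+ 2 * e.
  rewrite -(ler_pM2l kap0); apply: le_trans _ (le_trans K1 _).
    by rewrite le_eqVlt; apply/orP; left; apply/eqP; ring.
  by rewrite le_eqVlt; apply/orP; left; apply/eqP; ring.
have K3 : c * P * (c' * P) <= (q * P) ^+ 2 * e.
  by apply: le_trans K2; rewrite ler_pM2r// mulr_gt0.
suff : c * c' <= q ^+ 2 * e by rewrite leNgt qe.
rewrite -(ler_pM2l (exprn_gt0 2 P0)).
by apply: le_trans (le_trans _ K3) _; rewrite le_eqVlt; apply/orP; left; apply/eqP; ring.
Qed.


(** The sum of the Fourier series is almost periodic as a uniform limit of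
    trigonometric polynomials, and it has the same coefficients as h; so it is h,
    by [ap_uniqueness]. *)
Lemma ap_fourier_series h (a : V -> C) : ap h -> abs_summable a ->
  (forall y, amean (fun x => h x * conjc (chi y x)) (a y)) ->
  forall Y e x, tail_le a Y e -> normc (h x - \sum_(y <- Y) a y * chi y x) <= 2 * e.
Proof.
move=> ah sa Ha.
have dom x y : normc (a y * chi y x) <= normc (a y) by rewrite normcM2 normc_chi mulr1.
have sx x : abs_summable (fun y => a y * chi y x).
  by have [S HS] := sa; exists S => s /HS; apply: le_trans; exact: ler_sum.
have /choice[G HG] := fun x => summable_limit (sx x).
have GE Y e x : tail_le a Y e -> normc (G x - \sum_(y <- Y) a y * chi y x) <= 2 * e.
  by move=> tY; apply: HG; apply: tail_le_mul tY _.
suff hG x : h x = G x by move=> Y e x tY; rewrite hG; exact: GE.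
have aY Y : ap (fun x => \sum_(y <- Y) a y * chi y x).
  by apply: ap_sum => y; apply: apZ; exact: ap_chi.
have aG : ap G.
  apply: ap_uniform_limit => e e0; have e20 : 0 < e / 2 by rewrite divr_gt0.
  have [Y tY] := summable_tail sa e20; exists (fun x => \sum_(y <- Y) a y * chi y x) => //.
  by move=> z; apply: le_trans (GE Y _ z tY) _; lra.
apply/subr0_eq; apply: (@ap_uniqueness (fun x => h x - G x)); first exact: apB.
move=> y; rewrite -(subrr (a y)).
apply: (@amean_ext _ _ (fun x => h x * conjc (chi y x) - G x * conjc (chi y x))).
  by move=> z; rewrite mulrBl.
apply: ameanB => //; apply: amean_limit => e e0; have e20 : 0 < e / 2 by rewrite divr_gt0.
have [Y tY] := summable_tail sa e20.
exists (fun x => \sum_(y' <- Y) a y' * chi (y' - y) x), (\sum_(y' <- Y) a y' * (y' - y == 0)%:R); split.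
- by apply: amean_sum => y'; apply: ameanZ; exact: amean_chi.
- have [yY|yY] := boolP (y \in Y).
    rewrite (bigD1_seq y)//=; last exact: tY.1.
    rewrite subrr eqxx mulr1 big1 ?addr0 ?subrr ?normc0 ?ltW//.
    by move=> y' yy'; rewrite subr_eq0 (negbTE yy') mulr0.
  rewrite big_seq big1 ?subr0; first by have := tail_le_tail tY yY; lra.
  move=> y' y'Y; rewrite subr_eq0; case: eqP => [E|_]; last by rewrite mulr0.
  by rewrite -E y'Y in yY.
- move=> z; have -> : \sum_(y' <- Y) a y' * chi (y' - y) z = (\sum_(y' <- Y) a y' * chi y' z) * conjc (chi y z).
    by rewrite mulr_suml; apply: eq_bigr => y' _; rewrite chiBl mulrA.
  rewrite -mulrBl normcM2 normcJ normc_chi mulr1; apply: le_trans (GE Y _ z tY) _; lra.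
Qed.

End uniqueness.
Section fourier_bohr_coefficients.
Context {R : realType} {d : nat}.
Local Notation V := 'rV[R]_d.
Local Notation C := (R[i]^o).
Implicit Types (f g h : V -> C) (x y t z : V).
Variables (mu : (V -> C) -> C) (hmu : strongly_ap mu).

(** * Fourier-Bohr coefficients *)

Let mmu : is_measure mu. Proof. by case: hmu. Qed.

Lemma ap_conv_measure f : Cc f -> ap (conv_measure f mu).
Proof. by move=> cf; apply: strongly_ap_fun_ap; case: hmu => _ _; apply. Qed.

Let twist y : (V -> C) -> C := fun f => mu (fun x => conjc (chi y x) * f x).

Lemma measure_twist y : is_measure (twist y).
Proof. by apply: is_measure_mul => //; apply: buc_conj; exact: buc_chi. Qed.

Lemma conv_measure_twist y g x : Cc g ->
  conv_measure g (twist y) x = conjc (chi y x) * conv_measure (fun z => chi y z * g z) mu x.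
Proof.
move=> cg; rewrite /conv_measure -measZ//; last first.
  by apply: (@Cc_reflect _ _ x (fun z => chi y z * g z)); apply: CcMl => //; exact: buc_chi.
congr mu; apply/funext => z; rewrite chiB !mulrA; congr (_ * _).
by rewrite [conjc (chi y x) * _]mulrC chi_conj mul1r.
Qed.

Lemma ap_conv_twist y g : Cc g -> ap (conv_measure g (twist y)).
Proof.
move=> cg; rewrite (_ : conv_measure g (twist y) = fun x => conjc (chi y x) * conv_measure (fun z => chi y z * g z) mu x).
  apply: apM; last by apply: ap_conv_measure; apply: CcMl => //; exact: buc_chi.
  rewrite (_ : (fun x => conjc (chi y x)) = chi (- y)); first exact: ap_chi.
  by apply/funext => x; rewrite chiNl.
by apply/funext => x; exact: conv_measure_twist.
Qed.

(** With nu for the measure conjc (chi y) mu, the mean of g * nu is proportional to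
    the integral of g, since the mean of f * g * nu may be computed from that of
    g * nu or from that of f * nu. *)
Lemma fourier_bohr_twist y g : Cc g ->
  amean (conv_measure g (twist y)) (fourier_bohr mu y * integral_Rd g).
Proof.
have [g0 cg0 ig0] := @unit_mass R d.
have [c Hc] := amean_exists (ap_conv_twist y cg0).
have P f : Cc f -> amean (conv_measure f (twist y)) (c * integral_Rd f).
  move=> cf; have [m Hm] := amean_exists (ap_conv_twist y cf).
  suff <- : m = c * integral_Rd f by [].
  have E (p q : V -> C) n : Cc p -> Cc q -> amean (conv_measure q (twist y)) n ->
      amean (conv_measure (convolution p q) (twist y)) (integral_Rd p * n).
    move=> cp cq Hn; have := amean_conv cp (ap_conv_twist y cq).1 Hn.
    by apply: amean_ext => x; rewrite -(conv_measure_conv _ (measure_twist y)).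
  have E1 := E _ _ _ cg0 cf Hm; have E2 := E _ _ _ cf cg0 Hc.
  rewrite (_ : convolution f g0 = convolution g0 f) in E2; last by apply/funext => x; exact: convC.
  by have := amean_unique E1 E2; rewrite ig0 mul1r mulrC.
have Pm f : Cc f -> mean (conv_measure f (twist y)) = c * integral_Rd f.
  by move=> cf; apply: mean_amean (P _ cf); exact: (ap_conv_twist y cf).1.
have -> : fourier_bohr mu y = c; last exact: P.
have := @xgetPex _ (0 : C) [set m : C | forall f, Cc f -> mean (conv_measure f (twist y)) = m * integral_Rd f] (ex_intro _ c Pm).
move=> /= /(_ _ cg0); rewrite ig0 mulr1 -[xget _ _]/(fourier_bohr mu y) => <-.
by rewrite Pm// ig0 mulr1.
Qed.

Lemma fourier_bohr_conv y g : Cc g ->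
  amean (fun x => conv_measure g mu x * conjc (chi y x)) (fourier_bohr mu y * fcheck g (- y)).
Proof.
move=> cg; have cg' : Cc (fun x => g x * conjc (chi y x)).
  by apply: CcM => //; apply: buc_conj; exact: buc_chi.
have := fourier_bohr_twist y cg'.
rewrite (_ : integral_Rd _ = fcheck g (- y)); last by apply: integral_Rd_ext => x; rewrite chiNl.
apply: amean_ext => x; rewrite conv_measure_twist// mulrC.
suff -> : (fun z => chi y z * (g z * conjc (chi y z))) = g by [].
by apply/funext => z; rewrite mulrCA chi_conj mulr1.
Qed.

Definition reflect f z := f (- z).

Lemma Cc_reflect0 f : Cc f -> Cc (reflect f).
Proof. by move=> /(Cc_reflect 0); rewrite /reflect; under eq_fun do rewrite sub0r. Qed.

Lemma fcheck_reflect f y : Cc f -> fcheck (reflect f) (- y) = fcheck f y.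
Proof.
move=> cf; rewrite /fcheck -integral_Rd_oppose; last first.
  by apply: CcM; [exact: Cc_reflect0|exact: buc_chi].
by apply: integral_Rd_ext => x; rewrite /reflect opprK chiN chiNl conjcK2.
Qed.

Lemma autocorrelation_reflect f z : Cc f ->
  convolution (reflect f) (ftilde (reflect f)) (- z) = convolution f (ftilde f) z.
Proof.
move=> cf; rewrite /convolution -integral_Rd_oppose; last first.
  apply: Cc_conv_integrand; first exact: Cc_reflect0.
  by apply: Cc_ftilde; exact: Cc_reflect0.
apply: integral_Rd_ext => x; rewrite /reflect /ftilde opprK; congr (_ * conjc (f _)).
by rewrite opprK opprB addrC.
Qed.

(** The reflections compensate for the sign of the variable in [conv_measure], so
    that the value at the origin is the pairing of mu with the autocorrelation
    of f. *)
Definition autocorrelation f := conv_measure (convolution (reflect f) (ftilde (reflect f))) mu.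

Lemma ap_autocorrelation f : Cc f -> ap (autocorrelation f).
Proof.
move=> /Cc_reflect0 cf; apply: ap_conv_measure; apply: Cc_conv => //; exact: Cc_ftilde.
Qed.

Lemma autocorrelation0 f : Cc f -> autocorrelation f 0 = mu (convolution f (ftilde f)).
Proof.
move=> cf; rewrite /autocorrelation /conv_measure; congr mu; apply/funext => z.
by rewrite sub0r autocorrelation_reflect.
Qed.

Lemma amean_autocorrelation f y : Cc f -> amean (fun x => autocorrelation f x * conjc (chi y x))
  (fourier_bohr mu y * Complex (normc (fcheck f y) ^+ 2) 0).
Proof.
move=> cf; have cr := Cc_reflect0 cf.
rewrite -(fcheck_reflect y cf) -fcheck_autocorrelation//.
by apply: fourier_bohr_conv; apply: Cc_conv => //; exact: Cc_ftilde.
Qed.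

End fourier_bohr_coefficients.
Section formal_sums.
Context {R : realType} {d : nat}.
Local Notation V := 'rV[R]_d.
Local Notation C := (R[i]^o).
Implicit Types (f g h : V -> C) (x y t z : V) (w a : V -> C).

(** * Formal sums *)

Lemma tail_le_subset a Y Y' (e : R) : tail_le a Y e -> uniq Y' -> {subset Y <= Y'} -> tail_le a Y' e.
Proof.
by move=> [uY H] uY' YY'; split=> // s us sY'; apply: H => // y /sY'; apply: contra; exact: YY'.
Qed.

Lemma tail_le_union a b Y Y' (e e' : R) : tail_le a Y e -> tail_le b Y' e' ->
  tail_le a (undup (Y ++ Y')) e /\ tail_le b (undup (Y ++ Y')) e'.
Proof.
move=> ta tb; split; [apply: tail_le_subset ta _ _|apply: tail_le_subset tb _ _]; rewrite ?undup_uniq//.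
  by move=> y yY; rewrite mem_undup mem_cat yY.
by move=> y yY; rewrite mem_undup mem_cat yY orbT.
Qed.

Lemma sum_tail a Y (e : R) : abs_summable a -> tail_le a Y e ->
  normc (summability.sum a - \sum_(y <- Y) a y) <= 2 * e.
Proof.
move=> sa tY; have [z Hz] := summable_limit sa.
suff -> : summability.sum a = z by exact: Hz.
have PF := @summability.totally_filter V; apply: cvg_lim; first exact: norm_hausdorff.
apply/(@cvg_normcP _ _ _ (@filter_filter _ _ (summability.totally_filter))) => r r0; have r30 : 0 < r / 3 by rewrite divr_gt0.
have [Y0 tY0] := summable_tail sa r30.
exists [fset y | y in Y0]%fset => // B /= HB.
rewrite /summability.partial_sum -(big_seq_fsetE _ B xpredT a) normcBC.
apply: le_lt_trans (Hz B (r / 3) _) _; last by lra.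
apply: tail_le_subset tY0 _ _; first exact: fset_uniq.
by move=> y yY; apply: (fsubsetP HB); rewrite inE.
Qed.

Lemma abs_summable_esum a : abs_summable a <-> (\esum_(y in [set: V]) (normc (a y))%:E < +oo)%E.
Proof.
split=> [[S HS]|H].
  apply: (@le_lt_trans _ _ S%:E); last exact: ltry.
  apply: ge_ereal_sup => _ [A [fA _] <-]; rewrite fsbig_finite//= sumEFin lee_fin.
  by apply: HS; exact: fset_uniq.
pose E := (\esum_(y in [set: V]) (normc (a y))%:E)%E.
have E0 : (0 <= E)%E by apply: esum_ge0 => y _; rewrite lee_fin normc_ge0.
exists (fine E) => s us; rewrite -lee_fin fineK; last by rewrite ge0_fin_numE.
rewrite -sumEFin; apply: ereal_sup_ubound; exists [set` s]; first by split=> //; exact: finite_seq.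
by rewrite -fsbig_seq.
Qed.

Definition loc_summable w := forall r : R, exists S : R, forall s, uniq s ->
  (forall y, y \in s -> `|y| <= r) -> \sum_(y <- s) normc (w y) <= S.

Lemma loc_summable_sum_le w f r (S B : R) : 0 <= B ->
  (forall s, uniq s -> (forall y, y \in s -> `|y| <= r) -> \sum_(y <- s) normc (w y) <= S) ->
  vanish r f -> (forall x, normc (f x) <= B) ->
  forall s, uniq s -> \sum_(y <- s) normc (f y * w y) <= B * S.
Proof.
move=> B0 HS vf fB s us; rewrite (bigID (fun y => `|y| <= r))/= [X in _ + X]big1 ?addr0; last first.
  by move=> y; rewrite -ltNge => /vf ->; rewrite mul0r normc0.
apply: (@le_trans _ _ (\sum_(y <- s | `|y| <= r) B * normc (w y))).
  by apply: ler_sum => y _; rewrite normcM2 ler_wpM2r// normc_ge0.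
rewrite -mulr_sumr ler_wpM2l// -big_filter; apply: HS; first exact: filter_uniq.
by move=> y; rewrite mem_filter => /andP[].
Qed.

Lemma loc_summable_mul w f : loc_summable w -> Cc f -> abs_summable (fun y => f y * w y).
Proof.
move=> lw cf; have [M M0 fM] := Cc_bound cf; have [_ [r r0 vf]] := iffLR (CcP f) cf.
by have [S HS] := lw r; exists (M * S); exact: loc_summable_sum_le HS vf fM.
Qed.

Lemma formal_sum_tail w f Y (e : R) : loc_summable w -> Cc f ->
  tail_le (fun y => f y * w y) Y e ->
  normc (formal_sum w f - \sum_(y <- Y) f y * w y) <= 2 * e.
Proof. by move=> lw cf tY; apply: sum_tail => //; exact: loc_summable_mul. Qed.

Lemma formal_sum_bound w f (E : R) : loc_summable w -> Cc f ->
  (forall s, uniq s -> \sum_(y <- s) normc (f y * w y) <= E) -> normc (formal_sum w f) <= E.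
Proof.
move=> lw cf H; apply/ler_addgt0Pr => e e0; have e20 : 0 < e / 2 by rewrite divr_gt0.
have [Y tY] := summable_tail (loc_summable_mul lw cf) e20.
apply: le_trans (normc_dist _ (\sum_(y <- Y) f y * w y)) _; apply: lerD.
  by apply: le_trans (normc_sum _ _ _) (H _ tY.1).
by apply: le_trans (formal_sum_tail lw cf tY) _; lra.
Qed.

Lemma is_measure_formal_sum w : loc_summable w -> is_measure (formal_sum w).
Proof.
move=> lw; apply: is_measureI => [b f g cf cg|r].
  have ch : Cc (fun x => b * f x + g x) by apply: CcD => //; exact: CcZ.
  apply/subr0_eq/normc_le0/ler_addgt0Pl => e e0; rewrite addr0.
  pose K := 4 + 2 * normc b; have K0 : 0 < K by rewrite /K; have := normc_ge0 b; lra.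
  have eK : 0 < e / K by rewrite divr_gt0.
  have [Y1 t1] := summable_tail (loc_summable_mul lw cf) eK.
  have [Y2 t2] := summable_tail (loc_summable_mul lw cg) eK.
  have [Y3 t3] := summable_tail (loc_summable_mul lw ch) eK.
  have [{t2} t2 {t3} t3] := tail_le_union t2 t3.
  have [{t1} t1 {t2} t2'] := tail_le_union t1 t2.
  have t3' := tail_le_subset t3 t2'.1 _.
  have {t3'} t3 := t3' ltac:(by move=> y yY; rewrite mem_undup mem_cat yY orbT).
  move: (undup (Y1 ++ _)) t1 t2' t3 => Y t1 t2 t3.
  have H1 := formal_sum_tail lw cf t1; have H2 := formal_sum_tail lw cg t2; have H3 := formal_sum_tail lw ch t3.
  set F := formal_sum w f in H1 *; set G := formal_sum w g in H2 *; set H := formal_sum w _ in H3 *.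
  set sf := \sum_(y <- Y) f y * w y in H1; set sg := \sum_(y <- Y) g y * w y in H2.
  have E : \sum_(y <- Y) (b * f y + g y) * w y = b * sf + sg.
    by rewrite /sf /sg mulr_sumr -big_split /=; apply: eq_bigr => y _; rewrite mulrDl mulrA.
  rewrite E in H3.
  have -> : H - (b * F + G) = (H - (b * sf + sg)) - (b * (F - sf) + (G - sg)) by ring.
  apply: le_trans (normcB _ _) _.
  have := normcD (b * (F - sf)) (G - sg); rewrite normcM2.
  have H4 : normc b * normc (F - sf) <= normc b * (2 * (e / K)) by rewrite ler_wpM2l// normc_ge0.
  have -> : e = K * (e / K) by field; rewrite gt_eqF.
  rewrite {1}/K mulrDl; lra.
have [S HS] := lw r; exists S => h B ch vh hB.
have B0 : 0 <= B := le_trans (normc_ge0 _) (hB 0).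
rewrite mulrC; apply: formal_sum_bound => //; exact: loc_summable_sum_le HS vh hB.
Qed.

Lemma formal_sum_is_measureP w : formal_sum_is_measure w <-> loc_summable w.
Proof.
split=> [[H _] r|lw]; last first.
  split; last exact: is_measure_formal_sum.
  by move=> f cf; apply/abs_summable_esum; exact: loc_summable_mul.
have /abs_summable_esum[S HS] := H _ (@Cc_bump R d `|r| (normr_ge0 r)).
exists S => s us sr; apply: le_trans (HS s us).
rewrite big_seq [leRHS]big_seq; apply: ler_sum => y /sr yr.
by rewrite bump_in ?mul1r//; exact: le_trans yr (ler_norm r).
Qed.

End formal_sums.
Section upper_integrals.
Context {R : realType} {d : nat}.
Local Notation V := 'rV[R]_d.
Local Notation C := (R[i]^o).
Implicit Types (f g h k u : V -> C) (x y t : V) (F : V -> R) (nu : (V -> C) -> C).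

(** * Upper integrals and integrable functions *)

(** For continuous F >= 0 this says that the upper integral of F is at most E;
    only continuous functions are ever integrated here, so that this form is
    used throughout. *)
Definition upper_le nu F (E : R) := forall h, Cc h -> (forall x, normc (h x) <= F x) -> normc (nu h) <= E.

Lemma normc_le_upper_integral nu h (G : V -> \bar R) : Cc h ->
  (forall x, ((normc (h x))%:E <= G x)%E) -> ((normc (nu h))%:E <= upper_integral nu G)%E.
Proof.
move=> ch hG; apply: le_ereal_inf_tmp => _ [G' [_ GG'] <-].
apply: (@le_trans _ _ (abs_measure nu (fun x => normc (h x)))).
  by apply: ereal_sup_ubound; exists h.
apply: ereal_sup_ubound; exists (fun x => normc (h x)) => //; split; last first.
  by move=> x; split; [exact: normc_ge0|exact: le_trans (hG x) (GG' x)].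
have [_ [r r0 vh]] := iffLR (CcP h) ch; split.
  exact: (buc_Re (buc_normc (Cc_buc ch))).1.
by apply: (vanish_compact (r := r) _).1 => x /vh ->; exact: normc0.
Qed.

Lemma upper_integral_le nu F (E : R) : continuous F -> (forall x, 0 <= F x) -> upper_le nu F E ->
  (upper_integral nu (fun x => (F x)%:E) <= E%:E)%E.
Proof.
move=> cF F0 FE; apply: (@le_trans _ _ (upper_integral_lsc nu (fun x => (F x)%:E))).
  apply: ereal_inf_lbound; exists (fun x => (F x)%:E) => //; split=> //.
  move=> x a; rewrite lte_fin => aF.
  exists (F @^-1` [set r | a < r]); last by move=> y /=; rewrite lte_fin.
  by apply: cF; apply: open_nbhs_nbhs; split=> //; exact: open_gt.
apply: ge_ereal_sup => _ [g [cg gF] <-]; apply: ge_ereal_sup => _ [h [ch hg] <-].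
rewrite lee_fin; apply: FE => // x; apply: le_trans (hg x) _.
by have [_] := gF x; rewrite lee_fin.
Qed.

Lemma upper_integral_leP nu F (E : R) : continuous F -> (forall x, 0 <= F x) ->
  (upper_integral nu (fun x => (F x)%:E) <= E%:E)%E <-> upper_le nu F E.
Proof.
move=> cF F0; split; last exact: upper_integral_le.
move=> H h ch hF; rewrite -lee_fin; apply: le_trans H; exact: normc_le_upper_integral.
Qed.

Section measure.
Variables (nu : (V -> C) -> C) (mnu : is_measure nu).
Local Notation upper := (upper_le nu).

Lemma upper_mono F F' E : (forall x, F x <= F' x) -> upper F' E -> upper F E.
Proof. by move=> FF H h ch hF; apply: H => // x; exact: le_trans (hF x) (FF x). Qed.

Lemma upper_weaken F E E' : E <= E' -> upper F E -> upper F E'.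
Proof. by move=> EE H h ch hF; exact: le_trans (H h ch hF) EE. Qed.

Lemma upper_scale F E (c : R) : 0 <= c -> 0 <= E -> upper F E -> upper (fun x => c * F x) (c * E).
Proof.
rewrite le_eqVlt => /orP[/eqP <-|c0] E0 H h ch hF.
  rewrite (_ : h = fun=> 0); first by rewrite meas0// normc0 mul0r.
  by apply/funext => x; apply: normc_le0; have := hF x; rewrite mul0r.
have -> : h = fun x => Complex c 0 * (Complex c^-1 0 * h x).
  apply/funext => x; rewrite mulrA; have -> : Complex c 0 * Complex c^-1 0 = 1 :> R[i].
    by simpc; rewrite mulfV// gt_eqF.
  by rewrite mul1r.
have ch' : Cc (fun x => Complex c^-1 0 * h x : C) by exact: CcZ.
rewrite measZ// normcM2 normc_real gtr0_norm// ler_pM2l//; apply: H => // x.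
by rewrite normcM2 normc_real gtr0_norm ?invr_gt0// ler_pdivrMl.
Qed.

Lemma buc_inv_shift k (e : R) : 0 < e -> buc k -> (forall x, 0 <= complex.Re (k x)) ->
  buc (fun x => Complex (complex.Re (k x) + e)^-1 0).
Proof.
move=> e0 bk k0; pose phi (a : R) := e ^+ 2 / (Num.max 0 a + e).
have p (a : R) : 0 < Num.max 0 a + e by rewrite ltr_wpDl// le_max lexx.
have L (a b : R) : `|phi a - phi b| <= `|a - b|.
  have H := max0_lipschitz a b.
  have -> : phi a - phi b = (Num.max 0 b - Num.max 0 a) * (e / (Num.max 0 a + e) * (e / (Num.max 0 b + e))).
    by rewrite /phi; field; rewrite !gt_eqF.
  rewrite normrM distrC [X in _ * X]ger0_norm; last by rewrite mulr_ge0// divr_ge0 ?(ltW e0) ?(ltW (p _)).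
  apply: le_trans H; rewrite -[leRHS]mulr1; apply: ler_wpM2l => //.
  have q c : e / (Num.max 0 c + e) <= 1 by rewrite ler_pdivrMr// mul1r lerDr le_max lexx.
  by rewrite -[leRHS]mulr1 ler_pM ?divr_ge0 ?(ltW e0) ?(ltW (p _)).
have := bucZ (Complex (e ^+ 2)^-1 0) (buc_lipschitz L bk).
rewrite (_ : (fun x => _) = fun x => Complex (complex.Re (k x) + e)^-1 0)//.
apply/funext => x; rewrite /phi (max_idPr (k0 x)); simpc; congr Complex.
by rewrite mulrA mulVf ?mul1r// expf_neq0// gt_eqF.
Qed.

(** A function dominated by a sum of two positive functions is a sum of two
    functions dominated by one of them each, up to a uniformly small function
    with the same support. *)
Lemma upper_add k F E E' : buc k -> (forall x, 0 <= F x) ->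
  upper (fun x => normc (k x)) E -> upper F E' -> upper (fun x => normc (k x) + F x) (E + E').
Proof.
move=> bk F0 HE HE' h ch hF; apply/ler_addgt0Pr => e e0.
have [_ [r r0 vh]] := iffLR (CcP h) ch; have [M M0 HM] := meas_bound mnu r.
pose del := e / (M + 1); have M1 : 0 < M + 1 by lra.
have del0 : 0 < del by rewrite divr_gt0.
pose g x : C := Complex (normc (h x)) 0; pose kk x : C := Complex (normc (k x)) 0.
pose g2 x : C := Complex (Num.max 0 (complex.Re (g x - kk x))) 0.
pose q x : C := Complex (complex.Re (g x) + del)^-1 0.
have bg : buc g := buc_normc (Cc_buc ch).
have bq : buc q by apply: buc_inv_shift => // x; exact: normc_ge0.
have bg2 : buc g2.
  apply: (@buc_lipschitz _ _ (Num.max 0)); first exact: max0_lipschitz.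
  by apply: bucB => //; exact: buc_normc.
pose h1 x := h x * ((g x - g2 x) * q x); pose h2 x := h x * (g2 x * q x).
have ch1 : Cc h1 by apply: CcM => //; apply: bucM => //; exact: bucB.
have ch2 : Cc h2 by apply: CcM => //; exact: bucM.
have gd x : 0 < normc (h x) + del by rewrite ltr_wpDl// normc_ge0.
have dom (a b : R) : 0 <= a -> 0 <= b -> a * (b * (a + del)^-1) <= b.
  move=> a0 b0; rewrite mulrCA -[leRHS]mulr1 ler_wpM2l// ler_pdivrMr ?ltr_wpDl//; lra.
have g2b x : [/\ 0 <= normc (h x) - complex.Re (g2 x), normc (h x) - complex.Re (g2 x) <= normc (k x),
    0 <= complex.Re (g2 x) & complex.Re (g2 x) <= F x].
  rewrite /= ; have := hF x; have := F0 x; have := normc_ge0 (h x); have := normc_ge0 (k x).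
  by case: (leP 0 (normc (h x) - normc (k x))) => *; split; lra.
have H1 x : normc (h1 x) <= normc (k x).
  have [a b c c'] := g2b x; apply: le_trans b; rewrite !normcM2 normc_real ger0_norm; last by rewrite invr_ge0 (ltW (gd x)).
  have -> : g x - g2 x = Complex (normc (h x) - complex.Re (g2 x)) 0 :> R[i] by rewrite /g /g2; simpc.
  by rewrite normc_real (ger0_norm a); apply: dom => //; exact: normc_ge0.
have H2 x : normc (h2 x) <= F x.
  have [a b c c'] := g2b x; apply: le_trans c'; rewrite !normcM2 normc_real ger0_norm// normc_real ger0_norm; last by rewrite invr_ge0 (ltW (gd x)).
  by apply: dom => //; exact: normc_ge0.
pose h3 x := h x - (h1 x + h2 x).
have ch3 : Cc h3 by apply: CcB => //; exact: CcD.
have H3 x : normc (h3 x) <= del.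
  have -> : h3 x = h x * Complex (del / (normc (h x) + del)) 0.
    have -> : Complex (del / (normc (h x) + del)) 0 = 1 - g x * q x :> R[i].
      rewrite -[q x]/(Complex (normc (h x) + del)^-1 0) /g; have := gd x; move: (normc (h x)) => b b0.
      rewrite -[1 : R[i]]/(Complex 1 0); simpc; congr Complex; field; exact: lt0r_neq0.
    by rewrite /h3 /h1 /h2; ring.
  rewrite normcM2 normc_real ger0_norm; last by rewrite divr_ge0 ?(ltW del0) ?(ltW (gd x)).
  by apply: dom; [exact: normc_ge0|exact: ltW].
have v3 : vanish r h3 by move=> x /vh hx; rewrite /h3 /h1 /h2 hx !mul0r addr0 subrr.
have -> : h = fun x => (h1 x + h2 x) + h3 x by apply/funext => x; rewrite /h3 addrC subrK.
rewrite measD//; last exact: CcD.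
apply: le_trans (normcD _ _) _; apply: lerD.
  rewrite measD//; apply: le_trans (normcD _ _) _; apply: lerD; [exact: HE|exact: HE'].
apply: le_trans (HM _ _ ch3 v3 H3) _; rewrite /del mulrA ler_pdivrMr// mulrC ler_wpM2l ?(ltW e0)//; lra.
Qed.

Lemma upper_add2 k k' E E' : buc k ->
  upper (fun x => normc (k x)) E -> upper (fun x => normc (k' x)) E' ->
  upper (fun x => normc (k x) + normc (k' x)) (E + E').
Proof. by move=> bk; apply: upper_add => // x; exact: normc_ge0. Qed.

(** Bourbaki integrability and the value of the integral; see pairingP for the
    relation with pairing. *)
Definition integrable f := forall e : R, 0 < e ->
  exists2 h, Cc h & upper (fun x => normc (f x - h x)) e.

Definition integral_is f (z : C) := forall e : R, 0 < e ->
  exists2 h, Cc h & upper (fun x => normc (f x - h x)) e /\ normc (nu h - z) <= e.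

Lemma integral_is_Cc h : Cc h -> integral_is h (nu h).
Proof.
move=> ch e e0; exists h => //; split; last by rewrite subrr normc0 ltW.
move=> g cg gh; rewrite (_ : g = fun=> 0); first by rewrite meas0// normc0 ltW.
by apply/funext => x; apply: normc_le0; have := gh x; rewrite subrr normc0.
Qed.

Lemma upper_close f h h' (e e' : R) : buc f -> Cc h -> Cc h' ->
  upper (fun x => normc (f x - h x)) e -> upper (fun x => normc (f x - h' x)) e' ->
  normc (nu h - nu h') <= e + e'.
Proof.
move=> bf ch ch' H H'; rewrite -measB//.
apply: (upper_add2 (bucB bf (Cc_buc ch)) H H') => [|x]; first exact: CcB.
by apply: le_trans (normc_tri (f x) _ _) _; rewrite (normcBC (h x)).
Qed.

Lemma integral_is_unique f z z' : buc f -> integral_is f z -> integral_is f z' -> z = z'.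
Proof.
move=> bf H H'; apply/subr0_eq/normc_le0/ler_addgt0Pl => e e0; rewrite addr0.
have e40 : 0 < e / 4 by rewrite divr_gt0.
have [h ch [Hh hz]] := H _ e40; have [h' ch' [Hh' hz']] := H' _ e40.
have K := upper_close bf ch ch' Hh Hh'.
have := normc_tri (nu h) z z'; have := normc_tri (nu h') (nu h) z'.
rewrite (normcBC z (nu h)); lra.
Qed.

Lemma integral_is_exists f : buc f -> integrable f -> exists z, integral_is f z.
Proof.
move=> bf H; pose J := {p : (V -> C) * R | [/\ Cc p.1, 0 < p.2 & upper (fun x => normc (f x - p.1 x)) p.2]}.
have [h0 ch0 Hh0] := H 1 ltr01.
have [|z Hz] := compatible_limit (exist _ (h0, 1) (And3 ch0 ltr01 Hh0) : J)
   (m := fun j => nu (sval j).1) (e := fun j => (sval j).2).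
  by move=> [p [p1 p2 p3]] [p' [p1' p2' p3']]; exact: (upper_close bf p1 p1' p3 p3').
exists z => e e0; have e20 : 0 < e / 2 by rewrite divr_gt0.
have [h ch Hh] := H _ e20; exists h => //; split; first by apply: upper_weaken Hh; lra.
rewrite normcBC; apply: le_trans (Hz (exist _ (h, e / 2) (And3 ch e20 Hh))) _ => /=; lra.
Qed.

Lemma integral_is_integrable f z : integral_is f z -> integrable f.
Proof. by move=> H e e0; have [h ch []] := H e e0; exists h. Qed.

Lemma integral_is_ext f g z : f =1 g -> integral_is f z -> integral_is g z.
Proof. by move=> /funext ->. Qed.

Lemma integral_isD f g z z' : buc f -> integral_is f z -> integral_is g z' ->
  integral_is (fun x => f x + g x) (z + z').
Proof.
move=> bf H H' e e0; have e20 : 0 < e / 2 by rewrite divr_gt0.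
have [h ch [Hh hz]] := H _ e20; have [h' ch' [Hh' hz']] := H' _ e20.
exists (fun x => h x + h' x); first exact: CcD.
split; last by rewrite measD// opprD addrACA; apply: le_trans (normcD _ _) _; lra.
have -> : e = e / 2 + e / 2 by field.
apply: upper_mono (upper_add2 (bucB bf (Cc_buc ch)) Hh Hh') => x.
by rewrite opprD addrACA; exact: normcD.
Qed.

Lemma integral_isZ (c : C) f z : integral_is f z -> integral_is (fun x => c * f x) (c * z).
Proof.
move=> H e e0; pose K := normc c + 1; have K0 : 0 < K by rewrite /K ltr_wpDl// normc_ge0.
have eK0 : 0 < e / K by rewrite divr_gt0.
have [h ch [Hh hz]] := H _ eK0; exists (fun x => c * h x); first exact: CcZ.
have E : K * (e / K) = e by field; rewrite gt_eqF.
split.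
  rewrite -E; apply: upper_mono (upper_scale (ltW K0) (ltW eK0) Hh) => x.
  by rewrite -mulrBr normcM2 ler_wpM2r ?normc_ge0// lerDl.
rewrite measZ// -mulrBr normcM2 -E; apply: ler_pM; rewrite ?normc_ge0//.
by rewrite lerDl.
Qed.

Lemma integral_is_sum I (s : seq I) (f : I -> V -> C) (z : I -> C) : (forall i, buc (f i)) ->
  (forall i, integral_is (f i) (z i)) -> integral_is (fun x => \sum_(i <- s) f i x) (\sum_(i <- s) z i).
Proof.
move=> bf H; elim: s => [|i s IH].
  rewrite big_nil; apply: (@integral_is_ext (fun=> 0)); first by move=> x; rewrite big_nil.
  by have := integral_is_Cc Cc0; rewrite meas0.
rewrite big_cons; apply: (@integral_is_ext (fun x => f i x + \sum_(j <- s) f j x)).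
  by move=> x; rewrite big_cons.
exact: integral_isD.
Qed.

Lemma integral_is_bound f z E : buc f -> upper (fun x => normc (f x)) E -> integral_is f z -> normc z <= E.
Proof.
move=> bf HE H; apply/ler_addgt0Pr => e e0; have e20 : 0 < e / 2 by rewrite divr_gt0.
have [h ch [Hh hz]] := H _ e20.
have K : normc (nu h) <= E + e / 2.
  apply: (upper_add2 bf HE Hh) => // x.
  by have := normc_dist (h x) (f x); rewrite (normcBC (h x)).
have := normc_dist z (nu h); rewrite (normcBC z); lra.
Qed.

Lemma upper_Cc h : Cc h -> exists2 E, 0 <= E & upper (fun x => normc (h x)) E.
Proof.
move=> ch; have [B B0 hB] := Cc_bound ch; have [_ [r r0 vh]] := iffLR (CcP h) ch.
have [M M0 HM] := meas_bound mnu r; exists (M * B); first exact: mulr_ge0.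
move=> g cg gh; apply: HM => // x; last exact: le_trans (gh x) (hB x).
by move=> /vh hx; apply: normc_le0; have := gh x; rewrite hx normc0.
Qed.

Lemma upper_integrable f : buc f -> integrable f -> exists2 E, 0 <= E & upper (fun x => normc (f x)) E.
Proof.
move=> bf H; have [h ch Hh] := H 1 ltr01; have [E E0 HE] := upper_Cc ch.
exists (E + 1); first lra.
apply: upper_mono (upper_add2 (Cc_buc ch) HE Hh) => x; exact: normc_dist.
Qed.

Lemma continuous_normcB f h : buc f -> Cc h -> continuous (fun x => normc (f x - h x)).
Proof. by move=> bf ch; have [] := buc_Re (buc_normc (bucB bf (Cc_buc ch))). Qed.

Lemma L1_dist_le f h (e : R) : buc f -> Cc h ->
  (L1_dist nu f h <= e%:E)%E <-> upper (fun x => normc (f x - h x)) e.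
Proof.
move=> bf ch; apply: upper_integral_leP; first exact: continuous_normcB.
by move=> x; exact: normc_ge0.
Qed.

Lemma in_L1P f : buc f -> in_L1 nu f <-> integrable f.
Proof.
move=> bf; split=> H e e0.
  by have [h ch Hh] := H e e0; exists h => //; apply/L1_dist_le => //; exact: ltW.
have e20 : 0 < e / 2 by rewrite divr_gt0.
have [h ch Hh] := H _ e20; exists h => //.
apply: (@le_lt_trans _ _ (e / 2)%:E); first exact/L1_dist_le.
by rewrite lte_fin; lra.
Qed.

Lemma pairingP f z : buc f -> integral_is f z -> pairing nu f = z.
Proof.
move=> bf H.
pose P := [set z' : C | exists h_ : nat -> V -> C, [/\ forall n, Cc (h_ n),
  (fun n => L1_dist nu f (h_ n)) @ \oo --> 0%E & (fun n => nu (h_ n)) @ \oo --> z']].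
have uniq_z z' : P z' -> z' = z.
  move=> [h_ [ch Hd Hz]]; apply: (integral_is_unique bf _ H) => e e0.
  have ev1 : \forall n \near \oo, (L1_dist nu f (h_ n) < e%:E)%E.
    apply: (Hd [set y | (y < e%:E)%E]); apply: open_nbhs_nbhs.
    by split; [exact: open_ereal_lt_ereal|rewrite /= lte_fin].
  have ev2 : \forall n \near \oo, normc (nu (h_ n) - z') < e by move/cvg_normcP: Hz; apply.
  have [n _ Hn] := filterI ev1 ev2; have [H1 H2] := Hn n (leqnn n).
  by exists (h_ n) => //; split; [exact: (iffLR (L1_dist_le e bf (ch n)) (ltW H1))|exact: ltW].
apply: uniq_z; apply: (@xgetPex _ 0 P); exists z.
have /choice[h_ Hh] : forall n : nat, exists h, Cc h /\
    (upper (fun x => normc (f x - h x)) n.+1%:R^-1 /\ normc (nu h - z) <= n.+1%:R^-1).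
  by move=> n; have [|h ch Hh] := H n.+1%:R^-1; [rewrite invr_gt0|exists h].
exists h_; split; first by move=> n; have [] := Hh n.
- have L0 n : (0 <= L1_dist nu f (h_ n))%E.
    apply: le_trans (normc_le_upper_integral nu Cc0 _) => [|x]; first by rewrite lee_fin normc_ge0.
    by rewrite normc0 lee_fin normc_ge0.
  apply: (@squeeze_cvge _ _ _ _ (fun=> 0%E) _ (fun n => (n.+1%:R^-1 : R)%:E)).
  + apply: nearW => n; rewrite L0 /=; have [ch [K _]] := Hh n; exact/L1_dist_le.
  + exact: cvg_cst.
  + apply/fine_cvgP; split; first exact: nearW.
    exact: cvg_harmonic.
- apply/cvg_normcP => e e0; have := ltr_add_invr (y := 0) e0; case=> m; rewrite add0r => Hm.
  exists m => // n /= mn; have [_ [_ K]] := Hh n.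
  apply: le_lt_trans K (le_lt_trans _ Hm).
  by rewrite lef_pV2 ?posrE ?ltr0n// ler_nat ltnS.
Qed.

End measure.

Lemma upper_integral_eq_on_Cc nu nu' (G : V -> \bar R) : eq_on_Cc nu nu' ->
  upper_integral nu G = upper_integral nu' G.
Proof.
move=> E; have EA (g : V -> R) : abs_measure nu g = abs_measure nu' g.
  congr ereal_sup; apply/seteqP; split => _ [h [ch hg] <-]; exists h; rewrite //= E//.
have EL G' : upper_integral_lsc nu G' = upper_integral_lsc nu' G'.
  by congr ereal_sup; apply/seteqP; split => _ [g Hg <-]; exists g; rewrite // EA.
by congr ereal_inf; apply/seteqP; split => _ [G' HG <-]; exists G'; rewrite // EL.
Qed.

Lemma is_fourier_transform_eq_on_Cc mu nu nu' : eq_on_Cc nu nu' -> is_measure nu' ->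
  is_fourier_transform mu nu -> is_fourier_transform mu nu'.
Proof.
move=> E mnu' [mnu H]; split=> // f cf; have [H1 H2] := H f cf.
have EL g h : L1_dist nu g h = L1_dist nu' g h by exact: upper_integral_eq_on_Cc.
split; first by move=> e e0; have [h ch Hh] := H1 e e0; exists h; rewrite -?EL.
rewrite H2 /pairing; congr (xget _ _); apply/seteqP; split => z [h_ [ch Hd Hz]]; exists h_; split=> //.
- by under eq_fun do rewrite -EL.
- by under eq_fun do rewrite -E//.
- by under eq_fun do rewrite EL.
- by under eq_fun do rewrite E//.
Qed.

End upper_integrals.
Section spikes.
Context {R : realType} {d : nat}.
Local Notation V := 'rV[R]_d.
Local Notation C := (R[i]^o).
Implicit Types (f g h k u : V -> C) (x y t : V) (w : V -> C).

(** * Uniformly locally summable families *)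

Definition spike (del : R) x : C := Complex (clip (1 - `|x| / del)) 0.

Lemma spike0 del : spike del 0 = 1.
Proof. by rewrite /spike normr0 mul0r subr0 /clip minxx (max_idPr _) ?ler01. Qed.

Lemma spike_out del x : 0 < del -> del <= `|x| -> spike del x = 0.
Proof.
move=> d0 dx; rewrite /spike /clip (min_idPr _); last by rewrite gerBl divr_ge0// ltW.
by rewrite (max_idPl _)// subr_le0 ler_pdivlMr// mul1r.
Qed.

Lemma spike_le1 del x : normc (spike del x) <= 1.
Proof. by rewrite normc_real ger0_norm ?clip_ge0 ?clip_le1. Qed.

Lemma Cc_spike del y : 0 < del -> Cc (fun x => spike del (x - y)).
Proof.
move=> d0; apply: Cc_translate; apply/CcP; split; last first.
  by exists del; [exact: ltW|move=> x dx; apply: spike_out => //; exact: ltW].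
move=> e e0; exists (e * del) => [|x x' xx]; first exact: mulr_gt0.
rewrite /spike -[X in normc X]/(Complex (clip (1 - `|x| / del) - clip (1 - `|x'| / del)) (0 - 0)) subrr normc_real.
apply: le_trans (clip_lipschitz _ _) _.
have -> : 1 - `|x| / del - (1 - `|x'| / del) = (`|x'| - `|x|) / del by field; rewrite gt_eqF.
rewrite normrM [X in _ * X]ger0_norm ?invr_ge0 ?(ltW d0)// ler_pdivrMr//.
have A := ler_normD (x - x') x'; have B := ler_normD (x' - x) x.
rewrite !subrK (distrC x' x) in A B.
by rewrite ler_norml; apply/andP; split; lra.
Qed.

Lemma separation (Y : seq V) : exists del : R, [/\ 0 < del, del <= 1 &
  forall y y', y \in Y -> y' \in Y -> y != y' -> del <= `|y - y'|].
Proof.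
have [M M0 HM] := seq_bound (allpairs pair Y Y) (fun p : V * V => `|p.1 - p.2|^-1).
have M1 : 0 < M + 1 by lra.
exists (M + 1)^-1; split; first by rewrite invr_gt0.
  by rewrite invf_le1//; lra.
move=> y y' yY yY' ne; have p0 : 0 < `|y - y'| by rewrite normr_gt0 subr_eq0.
rewrite -[leRHS]invrK lef_pV2 ?posrE ?invr_gt0//.
by apply: le_trans (HM (y, y') _) _; [exact: allpairs_f|lra].
Qed.

Definition unphase (z : C) : C := conjc z * Complex (normc z)^-1 0.

Lemma unphaseE z : unphase z * z = Complex (normc z) 0.
Proof.
rewrite /unphase mulrAC [conjc z * z]mulrC mulcJ; simpc; congr Complex.
have [->|z0] := eqVneq (normc z) 0; first by rewrite expr2 !mul0r.
by rewrite expr2 mulfK.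
Qed.

Lemma normc_unphase z : normc (unphase z) <= 1.
Proof.
rewrite normcM2 normcJ normc_real ger0_norm ?invr_ge0 ?normc_ge0//.
have [->|z0] := eqVneq (normc z) 0; first by rewrite mul0r ler01.
by rewrite mulfV.
Qed.

(** A combination of sharp bumps at the points of s, with phases opposite to
    those of w, is an admissible test function of modulus at most 1 and tests
    the absolute values of w on s. *)
Lemma translation_bounded_sums w : loc_summable w -> translation_bounded (formal_sum w) ->
  exists2 S : R, 0 <= S & forall x s, uniq s -> (forall y, y \in s -> `|y - x| <= 1) ->
    \sum_(y <- s) normc (w y) <= S.
Proof.
move=> lw /(_ _ (@compact_ball R d 2)); set T := ereal_sup _ => Too.
pose A x : set V := [set x + k | k in [set z : V | `|z| <= 2]].
have Tx x : (variation_set (formal_sum w) (A x) <= T)%E.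
  by apply: ereal_sup_ubound; exists x.
have T0 : (0 <= T)%E.
  apply: le_trans (Tx 0); apply: le_trans (normc_le_upper_integral _ Cc0 _) => [|x].
    by rewrite lee_fin normc_ge0.
  by rewrite normc0 lee_fin.
exists (fine T); first exact: fine_ge0.
move=> x s us sx; apply/ler_addgt0Pr => e e0; have e20 : 0 < e / 2 by rewrite divr_gt0.
pose r := `|x| + 2; have r0 : 0 <= r by rewrite addr_ge0.
have [Y tY] := summable_tail (loc_summable_mul lw (Cc_bump r0)) e20.
pose Z := undup (Y ++ s); have uZ : uniq Z := undup_uniq _.
have sZ y : y \in s -> y \in Z by move=> ys; rewrite mem_undup mem_cat ys orbT.
have [del [d0 d1 Hd]] := separation Z; pose q := del / 2; have q0 : 0 < q by rewrite divr_gt0.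
pose h z := \sum_(y <- s) unphase (w y) * spike q (z - y).
have ch : Cc h by apply: Cc_sum => y; apply: CcZ; exact: Cc_spike.
have hout z : 2 < `|z - x| -> h z = 0.
  move=> zx; rewrite /h big_seq big1// => y ys; rewrite spike_out ?mulr0//.
  have := sx y ys; have := ler_normD (z - y) (y - x); rewrite addrA subrK /q; lra.
have h1 z : normc (h z) <= 1.
  have [[y0 y0s zy]|no] := pselect (exists2 y0, y0 \in s & `|z - y0| < q).
    rewrite /h (bigD1_seq y0)//= big_seq_cond big1 ?addr0 => [|y /andP[ys yy0]].
      by rewrite normcM2 -[leRHS]mulr1 ler_pM ?normc_ge0 ?normc_unphase ?spike_le1.
    rewrite spike_out ?mulr0//; have := Hd y y0 (sZ _ ys) (sZ _ y0s) yy0.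
    by have := ler_normD (y - z) (z - y0); rewrite addrA subrK (distrC y z); move: zy; rewrite /q; lra.
  rewrite /h big_seq big1 ?normc0// => y ys; rewrite spike_out ?mulr0// leNgt.
  by apply/negP => K; apply: no; exists y.
have hw y : y \in Z -> h y = if y \in s then unphase (w y) else 0.
  move=> yZ; rewrite /h; case: ifPn => ys.
    rewrite (bigD1_seq y)//= big_seq_cond big1 ?addr0 => [|y' /andP[y's yy']].
      by rewrite subrr spike0 mulr1.
    by rewrite spike_out ?mulr0//; apply: le_trans (Hd _ _ yZ (sZ _ y's) _); rewrite 1?eq_sym// /q; lra.
  rewrite big_seq big1// => y' y's; rewrite spike_out ?mulr0//.
  apply: le_trans (Hd _ _ yZ (sZ _ y's) _); first by rewrite /q; lra.
  by apply: contraNneq ys => ->.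
have tZ : tail_le (fun y => h y * w y) Z (e / 2).
  apply: (@tail_le_mul _ _ (fun y => bump r y * w y)) => [|y].
    by apply: tail_le_subset tY uZ _ => y yY; rewrite mem_undup mem_cat yY.
  rewrite !normcM2 ler_wpM2r ?normc_ge0//.
  have [yr|yr] := leP `|y| r; first by rewrite bump_in// normc1.
  by rewrite hout ?normc0 ?normc_ge0//; have := ler_normB (y - x) (- x); rewrite opprK subrK normrN; move: yr; rewrite /r; lra.
have E : \sum_(y <- Z) h y * w y = Complex (\sum_(y <- s) normc (w y)) 0.
  rewrite (bigID (mem s))/= [X in _ + X]big_seq_cond [X in _ + X]big1 ?addr0; last first.
    by move=> y /andP[yZ ys]; rewrite hw// (negbTE ys) mul0r.
  rewrite big_seq_cond (eq_bigr (fun y => Complex (normc (w y)) 0)); last first.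
    by move=> y /andP[yZ ys]; rewrite hw// ys unphaseE.
  rewrite -big_seq_cond -big_filter (perm_big s)/=; last first.
    apply: uniq_perm; rewrite ?filter_uniq// => y; rewrite mem_filter.
    by case: (boolP (y \in s)) => //= /sZ.
  by elim: (s) => [|y l IH]; rewrite ?big_nil// !big_cons IH; simpc.
have K := formal_sum_tail lw ch tZ; rewrite E in K.
have hT : normc (formal_sum w h) <= fine T.
  rewrite -lee_fin fineK ?ge0_fin_numE//; apply: le_trans (Tx x).
  apply: normc_le_upper_integral => // z; rewrite lee_fin indicE.
  have [zx|zx] := leP `|z - x| 2; last by rewrite hout// normc0.
  by rewrite mem_set ?h1//=; exists (z - x) => //; rewrite addrC subrK.
have s0 : 0 <= \sum_(y <- s) normc (w y) by apply: sumr_ge0 => y _; exact: normc_ge0.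
have := normc_dist (Complex (\sum_(y <- s) normc (w y)) 0) (formal_sum w h).
rewrite normc_real (ger0_norm s0) (normcBC _ (formal_sum w h)); lra.
Qed.

End spikes.

Section sieve.
Context {R : realType} {d : nat}.
Local Notation V := 'rV[R]_d.
Local Notation C := (R[i]^o).
Implicit Types (f g h k u : V -> C) (x y t : V) (w : V -> C).

(** * The large sieve inequality *)

Lemma dirichlet_le (r a : R) : 0 <= r -> `|dirichlet r a| <= 2 * r.
Proof.
move=> r0; pose y : 'rV[R]_1 := const_mx (a / (2 * pi)).
have := @normc_integral_on R 1 (cube r) (borel_cube r) (vol_cube_fin r) (chi y) 1 (buc_chi y).
move=> /(_ (fun (x : 'rV[R]_1) _ => eq_ind_r (fun b => b <= 1) (lexx 1) (normc_chi y x))).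
rewrite integral_cube_chi// normc_real big_ord1 vol_cube//= expr1 mul1r mxE.
by rewrite mulrC divfK// mulf_neq0// gt_eqF// pi_gt0.
Qed.

(** A sequence of quadratic decay whose sum telescopes. *)
Definition decay (K : R) (m : nat) : R := K / (m.+1%:R * m.+2%:R).

Lemma sum_decay (K : R) n : 0 <= K -> \sum_(m < n) decay K m <= K.
Proof.
move=> K0; suff -> : \sum_(m < n) decay K m = K * (1 - n.+1%:R^-1).
  by rewrite -[leRHS]mulr1 ler_wpM2l// gerBl invr_ge0.
elim: n => [|n IH]; first by rewrite big_ord0 invr1 subrr mulr0.
rewrite big_ord_recr /= IH /decay.
have n1 : (n.+1%:R : R) != 0 by rewrite pnatr_eq0.
have n2 : (n.+2%:R : R) != 0 by rewrite pnatr_eq0.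
have E : (n.+2%:R : R) = n.+1%:R + 1 by rewrite -natr1.
rewrite E in n2 *; move: n1 n2; move: (n.+1%:R : R) => q q0 p0; field.
by rewrite q0 p0.
Qed.

Lemma dirichlet_decay (r eta : R) : 0 < r ->
  dirichlet r (2 * pi * eta) ^+ 2 <= decay (8 * r ^+ 2 + 6) (Num.truncn `|eta|).
Proof.
move=> r0; have /andP[m1 m2] := truncn_itv (normr_ge0 eta).
set m := Num.truncn `|eta| in m1 m2 *; rewrite /decay.
have p0 : 0 < (m.+1%:R * m.+2%:R : R) by rewrite mulr_gt0 ?ltr0n.
rewrite ler_pdivlMr//; case: (posnP m) => [->|m0].
  have H := dirichlet_le (2 * pi * eta) (ltW r0).
  have H2 : dirichlet r (2 * pi * eta) ^+ 2 <= (2 * r) ^+ 2.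
    by rewrite -[leLHS]real_normK ?num_real// lerXn2r ?nnegrE// mulr_ge0// ltW.
  rewrite mul1r; apply: le_trans (ler_wpM2r _ H2) _ => //.
  have := sqr_ge0 r; rewrite exprMn; lra.
have m1' : (1 : R) <= m%:R by rewrite ler1n.
have e0 : 0 < `|eta| by apply: lt_le_trans m1; lra.
have en : eta != 0 by rewrite -normr_gt0.
have pn : pi != 0 :> R by rewrite gt_eqF// pi_gt0.
have pi1 : (1 : R) <= pi by have := pi_ge2 R; lra.
rewrite dirichletE//; last by rewrite !mulf_neq0// gt_eqF// pi_gt0.
have H : (2 * sin (2 * pi * eta * r) / (2 * pi * eta)) ^+ 2 <= (m%:R ^+ 2)^-1.
  have -> : 2 * sin (2 * pi * eta * r) / (2 * pi * eta) = sin (2 * pi * eta * r) / (pi * eta).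
    by move: (sin _) => u; rewrite -(mulrA 2 pi eta) -mulf_div divff// mul1r.
  rewrite expr_div_n -[X in X / _]real_normK ?num_real// -[X in _ / X]real_normK ?num_real//.
  rewrite -[leRHS]mul1r; apply: ler_pM.
  - exact: sqr_ge0.
  - by rewrite invr_ge0 sqr_ge0.
  - by rewrite -[leRHS](expr1n _ 2) lerXn2r ?nnegrE// sin_max.
  rewrite lef_pV2 ?posrE ?exprn_gt0 ?normr_gt0 ?mulf_neq0 ?ltr0n//.
  rewrite lerXn2r ?nnegrE// normrM (gtr0_norm (pi_gt0 R)); apply: le_trans m1 _.
  by rewrite ler_peMl.
apply: le_trans (ler_wpM2r (ltW p0) H) _.
rewrite ler_pdivrMl ?exprn_gt0 ?ltr0n//.
apply: le_trans (_ : 6 * m%:R ^+ 2 <= _); last first.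
  rewrite mulrC ler_wpM2l ?sqr_ge0//; have := sqr_ge0 r; lra.
have -> : (m.+2%:R : R) = m%:R + 2 by rewrite -addn2 natrD.
rewrite -natr1; move: m1'; move: (m%:R : R) => q q1; nra.
Qed.

Definition kernel (K : R) y y' : R := \prod_(i < d) decay K (Num.truncn `|y ord0 i - y' ord0 i|).

Lemma decay_ge0 K m : 0 <= K -> 0 <= decay K m.
Proof. by move=> K0; rewrite divr_ge0// mulr_ge0. Qed.

Lemma kernelC K y y' : kernel K y y' = kernel K y' y.
Proof. by apply: eq_bigr => i _; rewrite distrC. Qed.

(** The kernel is summable over the cells on which the integer parts and the
    signs of all coordinates of y - x are constant, and each of the cells lies
    in a cube of side 1. *)
Lemma kernel_sum w (S K : R) x s : 0 <= K ->
  (forall z s, uniq s -> (forall y, y \in s -> `|y - z| <= 1) -> \sum_(y <- s) normc (w y) <= S) ->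
  uniq s -> \sum_(y <- s) normc (w y) * kernel K x y <= S * (2 * K) ^+ d.
Proof.
move=> K0 HS us.
have [B B0 HB] := seq_bound s (fun y => `|x - y|).
pose M := (Num.truncn B).+1.
pose cell y : {ffun 'I_d -> bool * 'I_M} :=
  [ffun i => (0 <= x ord0 i - y ord0 i, inord (Num.truncn `|x ord0 i - y ord0 i|))].
have cellE y i : y \in s -> ((cell y i).2 : nat) = Num.truncn `|x ord0 i - y ord0 i|.
  move=> ys; rewrite ffunE /= inordK// ltnS; apply: le_truncn.
  by apply: le_trans (HB _ ys); have := coord_le_norm (x - y) i; rewrite !mxE.
rewrite big_seq (@partition_big _ _ _ _ _ _ _ cell xpredT)//=.
apply: (@le_trans _ _ (\sum_(c : {ffun 'I_d -> bool * 'I_M}) S * \prod_(i < d) decay K (c i).2)).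
  apply: ler_sum => c _.
  rewrite (eq_bigr (fun y => normc (w y) * \prod_(i < d) decay K (c i).2)); last first.
    move=> y /andP[ys /eqP <-]; congr (_ * _); apply: eq_bigr => i _.
    by rewrite cellE.
  rewrite -mulr_suml; apply: ler_wpM2r; first by apply: prodr_ge0 => i _; exact: decay_ge0.
  pose z : V := x - \row_i (let p : R := (c i).2%:R + 2^-1 in if (c i).1 then p else - p).
  rewrite -big_filter; apply: (HS z); first exact: filter_uniq.
  move=> y; rewrite mem_filter => /andP[/andP[ys /eqP cy] _].
  apply/rV_norm_le => // i; rewrite /z !mxE; have := cellE y i ys; rewrite cy => Em.
  have := truncn_itv (normr_ge0 (x ord0 i - y ord0 i)); rewrite -Em -natr1.
  have : (c i).1 = (0 <= x ord0 i - y ord0 i) by rewrite -cy ffunE.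
  move: (((c i).2)%:R : R) => p -> /andP[] /=.
  case: (leP 0 (x ord0 i - y ord0 i)) => a0; rewrite ?(ger0_norm a0) ?(ltr0_norm a0) ler_norml => *;
    apply/andP; split; lra.
rewrite -mulr_sumr -(bigA_distr_bigA (fun (_ : 'I_d) (p : bool * 'I_M) => decay K p.2)).
have S0 : 0 <= S by have := HS 0 [::] isT; rewrite big_nil; apply.
apply: ler_wpM2l => //; rewrite prodr_const card_ord.
have -> : \sum_(p : bool * 'I_M) decay K p.2 = \sum_(b : bool) \sum_(m < M) decay K m.
  by rewrite pair_bigA.
rewrite big_bool /= -mulr2n -[X in X ^+ _ <= _]mulr_natl lerXn2r ?nnegrE//.
- by rewrite mulr_ge0// sumr_ge0// => m _; exact: decay_ge0.
- by rewrite mulr_ge0.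
by rewrite ler_pM2l// sum_decay.
Qed.

Definition cube_kernel (a : R) y : R := \prod_(i < d) dirichlet a (2 * pi * y ord0 i).

Lemma cube_kernel_le (a : R) y y' : 0 < a ->
  cube_kernel a (y - y') ^+ 2 <= kernel (8 * a ^+ 2 + 6) y y'.
Proof.
move=> a0; rewrite /cube_kernel /kernel -prodrXl; apply: ler_prod => i _.
by rewrite sqr_ge0 !mxE dirichlet_decay.
Qed.

(** Dual large sieve. Averaging the square of G over translations in a cube of
    side 4r turns the off-diagonal integrals into squares of products of
    Dirichlet kernels, whose decay is summable (Schur test). *)
Lemma dual_large_sieve w (S r : R) : 0 < r ->
  (forall z s, uniq s -> (forall y, y \in s -> `|y - z| <= 1) -> \sum_(y <- s) normc (w y) <= S) ->
  exists2 B : R, 0 <= B & forall (s : seq V) (b : V -> C), uniq s ->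
    rint (cube r) (fun x => normc (\sum_(y <- s) Complex (normc (w y)) 0 * b y * chi y x) ^+ 2)
      <= B * \sum_(y <- s) normc (w y) * normc (b y) ^+ 2.
Proof.
move=> r0 HS; have S0 : 0 <= S by have := HS 0 [::] isT; rewrite big_nil; apply.
pose a := 2 * r; have a0 : 0 < a by rewrite mulr_gt0.
pose K := 8 * a ^+ 2 + 6; have K0 : 0 <= K by rewrite addr_ge0// mulr_ge0// sqr_ge0.
pose N := (2 * r) ^+ d; have N0 : 0 < N by rewrite exprn_gt0.
pose B := S * (2 * K) ^+ d; have B0 : 0 <= B by rewrite mulr_ge0// exprn_ge0// mulr_ge0.
exists (B / N); first by rewrite divr_ge0 ?(ltW N0).
move=> s b us; rewrite mulrAC ler_pdivlMr//.
pose c y := Complex (normc (w y)) 0 * b y.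
pose G x := \sum_(y <- s) c y * chi y x.
have bG : buc G by apply: buc_sum => y; apply: bucZ; exact: buc_chi.
pose G2 x : C := G x * conjc (G x).
have bG2 : buc G2 by apply: bucM => //; exact: buc_conj.
have G2E x : G2 x = Complex (normc (G x) ^+ 2) 0 by exact: mulcJ.
pose Q := rint (cube r) (fun x => complex.Re (G2 x)).
have -> : rint (cube r) (fun x => normc (\sum_(y <- s) Complex (normc (w y)) 0 * b y * chi y x) ^+ 2) = Q.
  by apply: rint_eq => x _; rewrite G2E.
pose J t := \sum_(y <- s) \sum_(y' <- s) c y * conjc (c y') * Complex (cube_kernel a (y - y')) 0 * chi (y - y') t.
have G2sum x : G2 x = \sum_(y <- s) \sum_(y' <- s) c y * conjc (c y') * chi (y - y') x.
  rewrite /G2 /G conjc_sum mulr_suml; apply: eq_bigr => y _; rewrite mulr_sumr; apply: eq_bigr => y' _.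
  by rewrite chiBl conjcM2; ring.
have JE t : integral_on (cube a) (fun x => G2 (x + t)) = J t.
  rewrite (integral_on_eq (g := fun x => \sum_(y <- s) \sum_(y' <- s) (c y * conjc (c y') * chi (y - y') t) * chi (y - y') x)); last first.
    move=> x _; rewrite G2sum; apply: eq_bigr => y _; apply: eq_bigr => y' _.
    by rewrite chiD; ring.
  have bi y : buc (fun x => \sum_(y' <- s) (c y * conjc (c y') * chi (y - y') t) * chi (y - y') x).
    by apply: buc_sum => y'; apply: bucZ; exact: buc_chi.
  rewrite integral_on_sum//; [|exact: borel_cube|exact: vol_cube_fin].
  apply: eq_bigr => y _; rewrite integral_on_sum; [|exact: borel_cube|exact: vol_cube_fin|]; last first.
    by move=> y'; apply: bucZ; exact: buc_chi.
  apply: eq_bigr => y' _; rewrite integral_onZ; [|exact: borel_cube|exact: vol_cube_fin|exact: buc_chi].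
  by rewrite integral_cube_chi ?(ltW a0)// -/(cube_kernel a (y - y')); ring.
have bJ : buc J.
  by apply: buc_sum => y; apply: buc_sum => y'; apply: bucZ; exact: buc_chi.
have G20 x : 0 <= complex.Re (G2 x) by rewrite G2E exprn_ge0// normc_ge0.
have low t : `|t| <= r -> Q <= complex.Re (J t).
  move=> tr; rewrite -JE Re_integral_on.
  have bt : bcont (fun x => complex.Re (G2 (x + t))).
    by have := buc_Re (buc_translate (- t) bG2); under eq_fun do rewrite opprK.
  have [mB _] := vol_translate t (borel_cube r).
  rewrite (rint_split (borel_cube a) mB (vol_cube_fin a) bt).
  apply: ler_wpDr; first by apply: rint_ge0 => x _; exact: G20.
  have -> : cube a `&` [set y | cube r (y + t)] = [set y | cube r (y + t)].
    apply/seteqP; split=> [y []//|y yr]; split=> //; rewrite /cube /= in yr *.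
    by have := ler_normB (y + t) t; rewrite addrK /a; lra.
  by rewrite (rint_translate t (borel_cube r) (vol_cube_fin r) (buc_Re bG2)).
have total : integral_on (cube a) J = \sum_(y <- s) \sum_(y' <- s) c y * conjc (c y') * Complex (cube_kernel a (y - y') ^+ 2) 0.
  rewrite integral_on_sum; [|exact: borel_cube|exact: vol_cube_fin|]; last first.
    by move=> y; apply: buc_sum => y'; apply: bucZ; exact: buc_chi.
  apply: eq_bigr => y _; rewrite integral_on_sum; [|exact: borel_cube|exact: vol_cube_fin|]; last first.
    by move=> y'; apply: bucZ; exact: buc_chi.
  apply: eq_bigr => y' _; rewrite integral_onZ; [|exact: borel_cube|exact: vol_cube_fin|exact: buc_chi].
  rewrite integral_cube_chi ?(ltW a0)// -/(cube_kernel a (y - y')) -[LHS]mulrA; congr (_ * _).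
  by rewrite expr2; simpc.
have QN : Q * N <= complex.Re (integral_on (cube a) J).
  have J0 t : 0 <= complex.Re (J t).
    by rewrite -JE Re_integral_on; apply: rint_ge0 => x _; exact: G20.
  rewrite Re_integral_on (rint_split (borel_cube a) (borel_cube r) (vol_cube_fin a) (buc_Re bJ)).
  apply: ler_wpDr; first by apply: rint_ge0 => x _; exact: J0.
  have -> : cube a `&` cube r = cube r :> set V.
    apply/seteqP; split=> [y []//|y yr]; split=> //; rewrite /cube /= in yr *.
    by apply: le_trans yr _; rewrite /a; lra.
  have -> : Q * N = rint (cube r : set V) (fun=> Q).
    by rewrite (rint_cst (borel_cube r)) vol_cube// ltW.
  apply: rint_le; [exact: borel_cube|exact: vol_cube_fin| |exact: buc_Re bJ|by move=> t tr; exact: low].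
  exact: (buc_Re (buc_cst (Complex Q 0 : C))).
apply: le_trans QN _; rewrite total.
apply: le_trans (le_trans (ler_norm _) (Re_le_normc _)) _.
apply: le_trans (normc_sum _ _ _) _.
pose v y := normc (w y); pose m y := normc (b y) ^+ 2; pose k y y' := kernel K y y'.
have v0 y : 0 <= v y := normc_ge0 _.
have k0 y y' : 0 <= k y y' by apply: prodr_ge0 => i _; exact: decay_ge0.
apply: (@le_trans _ _ (\sum_(y <- s) \sum_(y' <- s) (2^-1 * (v y * m y * (v y' * k y y')) + 2^-1 * (v y' * m y' * (v y * k y' y))))).
  apply: ler_sum => y _; apply: le_trans (normc_sum _ _ _) _; apply: ler_sum => y' _.
  rewrite !normcM2 normcJ !normcM2 !normc_real ger0_norm ?normc_ge0// ger0_norm ?normc_ge0// ger0_norm ?sqr_ge0//.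
  rewrite /k (kernelC K y' y) -/(v y) -/(v y').
  apply: (@le_trans _ _ (v y * normc (b y) * (v y' * normc (b y')) * kernel K y y')).
    by apply: ler_wpM2l; [rewrite !mulr_ge0 ?normc_ge0|exact: cube_kernel_le].
  have H : 0 <= v y * v y' * kernel K y y' by rewrite !mulr_ge0// k0.
  have := mulr_ge0 H (sqr_ge0 (normc (b y) - normc (b y'))); rewrite /m; move: H; clear.
  by move: (v y) (v y') (kernel K y y') (normc (b y)) (normc (b y')) => p q z u u' _; lra.
have Sch : \sum_(y <- s) \sum_(y' <- s) v y * m y * (v y' * k y y') <= B * \sum_(y <- s) v y * m y.
  rewrite mulr_sumr; apply: ler_sum => y _; rewrite -mulr_sumr mulrC.
  apply: ler_wpM2r; first by rewrite mulr_ge0// sqr_ge0.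
  exact: kernel_sum.
have Sch2 : \sum_(y <- s) \sum_(y' <- s) v y' * m y' * (v y * k y' y) <= B * \sum_(y <- s) v y * m y.
  by rewrite exchange_big.
rewrite -[leRHS]/(B * \sum_(y <- s) v y * m y).
apply: (@le_trans _ _ (2^-1 * (B * \sum_(y <- s) v y * m y) + 2^-1 * (B * \sum_(y <- s) v y * m y))); last by lra.
apply: le_trans (lerD (ler_wpM2l _ Sch) (ler_wpM2l _ Sch2)); rewrite ?invr_ge0//.
rewrite !mulr_sumr -big_split; apply: ler_sum => y _.
by rewrite !mulr_sumr -big_split.
Qed.

(** By duality: T is the integral of f against an exponential sum G whose square
    mean is at most B * T. Hence T^2 <= msq f * B * T by the inequality of Cauchy
    and Schwarz, which is used in the form 2 a b <= l a^2 + b^2 / l. *)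
Lemma large_sieve w (S : R) f : Cc f ->
  (forall z s, uniq s -> (forall y, y \in s -> `|y - z| <= 1) -> \sum_(y <- s) normc (w y) <= S) ->
  exists B : R, forall s, uniq s -> \sum_(y <- s) normc (w y) * normc (fcheck f y) ^+ 2 <= B.
Proof.
move=> cf HS; have [_ [r0 r00 vf]] := iffLR (CcP f) cf.
pose r := r0 + 1; have rp : 0 < r by rewrite /r; lra.
have {}vf : vanish r f by apply: vanish_le vf; rewrite /r; lra.
have [B B0 HB] := dual_large_sieve rp HS; pose l := B + 1; have l0 : 0 < l by rewrite /l; lra.
exists (l * msq f) => s us; pose b y := conjc (fcheck f y).
set T := \sum_(y <- s) _.
pose G x := \sum_(y <- s) Complex (normc (w y)) 0 * b y * chi y x.
have bG : buc G by apply: buc_sum => y; apply: bucZ; exact: buc_chi.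
have TE : T = rint (cube r) (fun x => complex.Re (f x * G x)).
  rewrite -Re_integral_on -(integral_Rd_cube (r := r)); last by move=> x /vf ->; rewrite mul0r.
  rewrite (integral_Rd_ext (g := fun x => \sum_(y <- s) Complex (normc (w y)) 0 * b y * (f x * chi y x))); last first.
    by move=> x; rewrite /G mulr_sumr; apply: eq_bigr => y _; rewrite mulrCA.
  have cfc y : Cc (fun x => f x * chi y x) by apply: CcM => //; exact: buc_chi.
  rewrite integral_Rd_sum; last by move=> y; exact: CcZ.
  rewrite Re_sum; apply: eq_bigr => y _; rewrite integral_RdZ// -/(fcheck f y) -mulrA /b [conjc _ * _]mulrC mulcJ.
  by rewrite ReZ.
have bf := Cc_buc cf.
pose f2 x : C := f x * conjc (f x); pose G2 x : C := G x * conjc (G x).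
have bf2 : bcont (fun x => complex.Re (f2 x)) by apply: buc_Re; apply: bucM => //; exact: buc_conj.
have bG2 : bcont (fun x => complex.Re (G2 x)) by apply: buc_Re; apply: bucM => //; exact: buc_conj.
have mE : msq f = rint (cube r) (fun x => complex.Re (f2 x)).
  by rewrite /msq (integral_Rd_cube (r := r)) ?Re_integral_on// => x /vf ->; rewrite mul0r.
have QB : rint (cube r) (fun x => complex.Re (G2 x)) <= B * T.
  have := HB s b us; under eq_bigr do rewrite normcJ.
  by rewrite (@rint_eq _ _ _ _ (fun x => complex.Re (G2 x)))// => x _; rewrite /G2 mulcJ.
have mC := @borel_cube R d r; have vC := @vol_cube_fin R d r.
have T0 : 0 <= T by apply: sumr_ge0 => y _; rewrite mulr_ge0 ?normc_ge0// sqr_ge0.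
have H : T <= l / 2 * msq f + (2 * l)^-1 * rint (cube r) (fun x => complex.Re (G2 x)).
  rewrite TE mE -!rintZ// -rintD//; try exact: bcontZ.
  apply: rint_le => //.
  - by apply: buc_Re; exact: bucM.
  - have := buc_Re (bucD (bucZ (Complex (l / 2) 0) (bucM bf (buc_conj bf))) (bucZ (Complex (2 * l)^-1 0) (bucM bG (buc_conj bG)))).
    by under eq_fun do rewrite ReD !ReZ.
  move=> x _; rewrite /f2 /G2 !mulcJ.
  apply: le_trans (le_trans (ler_norm _) (Re_le_normc _)) _; rewrite normcM2.
  rewrite -[complex.Re (Complex (normc (f x) ^+ 2) 0)]/(normc (f x) ^+ 2) -[complex.Re (Complex (normc (G x) ^+ 2) 0)]/(normc (G x) ^+ 2).
  move: (normc (f x)) (normc (G x)) => p q.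
  have := sqr_ge0 (l * p - q) => K; rewrite -(ler_pM2l (_ : 0 < 2 * l)) ?mulr_gt0//.
  have -> : 2 * l * (l / 2 * p ^+ 2 + (2 * l)^-1 * q ^+ 2) = l ^+ 2 * p ^+ 2 + q ^+ 2 by field; rewrite gt_eqF.
  by move: K; rewrite sqrrB exprMn; lra.
have H2 : (2 * l)^-1 * rint (cube r) (fun x => complex.Re (G2 x)) <= T / 2.
  apply: le_trans (ler_wpM2l _ QB) _; first by rewrite invr_ge0 mulr_ge0// ltW.
  rewrite ler_pdivrMl ?mulr_gt0//; have -> : 2 * l * (T / 2) = l * T by field.
  by rewrite ler_wpM2r// /l; lra.
lra.
Qed.

End sieve.
Section sufficiency.
Context {R : realType} {d : nat}.
Local Notation V := 'rV[R]_d.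
Local Notation C := (R[i]^o).
Implicit Types (f g h k u : V -> C) (x y t : V) (w : V -> C).

(** * Translation bounded Fourier-Bohr series are Fourier transforms *)

Definition sqr_fcheck f y : C := Complex (normc (fcheck f y) ^+ 2) 0.

Lemma buc_sqr_fcheck f : Cc f -> buc (sqr_fcheck f).
Proof.
move=> cf; have := buc_fcheck (Cc_conv cf (Cc_ftilde cf)).
rewrite (_ : fcheck _ = sqr_fcheck f)//; apply/funext => y; exact: fcheck_autocorrelation.
Qed.

Lemma normc_sqr_fcheck f y : normc (sqr_fcheck f y) = normc (fcheck f y) ^+ 2.
Proof. by rewrite normc_real ger0_norm// sqr_ge0. Qed.

(** The cut-offs of u at cubes that contain all but a small part of the sum
    approximate u in mean. *)
Lemma integral_is_formal_sum w u (z : C) : loc_summable w -> buc u ->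
  abs_summable (fun y => u y * w y) ->
  (forall Y (e : R), tail_le (fun y => u y * w y) Y e -> normc (z - \sum_(y <- Y) u y * w y) <= 2 * e) ->
  integral_is (formal_sum w) u z.
Proof.
move=> lw bu su Hz e e0; have e40 : 0 < e / 4 by rewrite divr_gt0.
have [Y tY] := summable_tail su e40.
have [L L0 HL] := seq_bound Y (fun y => `|y|).
pose h y := u y * bump L y; have ch : Cc h by apply: CcMl => //; exact: Cc_bump.
have hY y : y \in Y -> h y = u y by move=> yY; rewrite /h bump_in ?mulr1// HL.
exists h => //; split=> [g cg gu|].
  apply: formal_sum_bound => // s us.
  apply: (@le_trans _ _ (\sum_(y <- s | y \notin Y) normc (u y * w y))).
    rewrite (bigID (fun y => y \notin Y))/= [X in _ + X]big1 ?addr0 => [|y /negPn yY]; last first.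
      rewrite normcM2 (_ : normc (g y) = 0) ?mul0r//; apply/le_anti.
      by rewrite normc_ge0 andbT; have := gu y; rewrite hY// subrr normc0.
    apply: ler_sum => y _; rewrite !normcM2 ler_wpM2r ?normc_ge0//; apply: le_trans (gu y) _.
    rewrite /h -{1}[u y]mulr1 -mulrBr normcM2 -[leRHS]mulr1 ler_wpM2l ?normc_ge0//.
    rewrite /bump -[X in normc X]/(Complex (1 - clip (L + 1 - `|y|)) (0 - 0)) subrr normc_real.
    by have := clip_ge0 (L + 1 - `|y|); have := clip_le1 (L + 1 - `|y|); rewrite ler_norml => *; apply/andP; split; lra.
  rewrite -big_filter; apply: le_trans (tY.2 _ _ _) _; first exact: filter_uniq.
    by move=> y; rewrite mem_filter => /andP[].
  by lra.
have tH : tail_le (fun y => h y * w y) Y (e / 4).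
  apply: tail_le_mul tY _ => y; rewrite !normcM2 ler_wpM2r ?normc_ge0//.
  by rewrite -[leRHS]mulr1 ler_wpM2l ?normc_ge0 ?bump_le1.
apply: le_trans (normc_tri (\sum_(y <- Y) h y * w y) _ _) _.
have H1 := formal_sum_tail lw ch tH; have H2 := Hz Y _ tY.
have E : \sum_(y <- Y) h y * w y = \sum_(y <- Y) u y * w y.
  by rewrite big_seq [RHS]big_seq; apply: eq_bigr => y yY; rewrite hY.
by rewrite E in H1 *; rewrite normcBC in H2; lra.
Qed.

Lemma fourier_transform_fourier_bohr (mu : (V -> C) -> C) : strongly_ap mu ->
  loc_summable (fourier_bohr mu) -> translation_bounded (formal_sum (fourier_bohr mu)) ->
  is_fourier_transform mu (formal_sum (fourier_bohr mu)).
Proof.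
move=> hmu lw tw; split; first exact: is_measure_formal_sum.
move=> f cf; set w := fourier_bohr mu in lw tw *.
have mw := is_measure_formal_sum lw; have b2 := buc_sqr_fcheck cf.
have [S S0 HS] := translation_bounded_sums lw tw.
have [B HB] := large_sieve cf HS.
have sa : abs_summable (fun y => sqr_fcheck f y * w y).
  exists B => s us; apply: le_trans (HB s us); apply: ler_sum => y _.
  by rewrite normcM2 normc_sqr_fcheck mulrC.
have I : integral_is (formal_sum w) (sqr_fcheck f) (mu (convolution f (ftilde f))).
  apply: integral_is_formal_sum => // Y e tY; rewrite -(autocorrelation0 mu cf).
  have am y : amean (fun x => autocorrelation mu f x * conjc (chi y x)) (sqr_fcheck f y * w y).
    by rewrite mulrC; exact: amean_autocorrelation.
  have := ap_fourier_series (ap_autocorrelation hmu cf) sa am 0 tY.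
  by under eq_bigr do rewrite chi0 mulr1.
move=> f2; rewrite -[f2]/(sqr_fcheck f); split.
  by apply/(in_L1P _ b2); exact: integral_is_integrable I.
by rewrite (pairingP mw b2 I).
Qed.

End sufficiency.
Section necessity.
Context {R : realType} {d : nat}.
Local Notation V := 'rV[R]_d.
Local Notation C := (R[i]^o).
Implicit Types (f g h k p q : V -> C) (x y t : V) (w : V -> C).

(** * The Fourier transform of an almost periodic measure *)

Lemma ftilde_linear (c : C) p q : ftilde (fun x => p x + c * q x) = fun x => ftilde p x + conjc c * ftilde q x.
Proof. by apply/funext => x; rewrite /ftilde conjcD conjcM2. Qed.

Lemma convolution_linear_l (c : C) p q g x : Cc p -> Cc q -> Cc g ->
  convolution (fun x => p x + c * q x) g x = convolution p g x + c * convolution q g x.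
Proof.
move=> cp cq cg; rewrite /convolution -integral_RdZ -?integral_RdD; try exact: Cc_conv_integrand.
  by apply: integral_Rd_ext => y; rewrite mulrDl mulrA.
by apply: CcZ; exact: Cc_conv_integrand.
Qed.

Lemma convolution_linear_r (c : C) p q g x : Cc p -> Cc q -> Cc g ->
  convolution g (fun x => p x + c * q x) x = convolution g p x + c * convolution g q x.
Proof.
move=> cp cq cg; rewrite /convolution -integral_RdZ -?integral_RdD; try exact: Cc_conv_integrand.
  by apply: integral_Rd_ext => y; rewrite mulrDr mulrCA.
by apply: CcZ; exact: Cc_conv_integrand.
Qed.

Lemma fcheck_linear (c : C) p q y : Cc p -> Cc q ->
  fcheck (fun x => p x + c * q x) y = fcheck p y + c * fcheck q y.
Proof.
move=> cp cq; have cc f : Cc f -> Cc (fun x => f x * chi y x) by move=> cf; apply: CcM => //; exact: buc_chi.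
rewrite /fcheck -integral_RdZ -?integral_RdD; try exact: cc; last by apply: CcZ; exact: cc.
by apply: integral_Rd_ext => x; rewrite mulrDl mulrA.
Qed.

Lemma avg_chi_sums (l l' : seq V) y : avg (sums l l') (chi y) 0 = avg l (chi y) 0 * avg l' (chi y) 0.
Proof.
rewrite avg_sums mulrC -avgZ /avg; congr (_ * _); apply: eq_bigr => u _.
rewrite -mulrA; congr (_ * _); rewrite mulr_suml; apply: eq_bigr => u' _.
by rewrite chiB sub0r (sub0r u') mulrC [chi y (- u')]chiN.
Qed.

(** The average over 0 and half a period of a character annihilates that character
    and nearly annihilates those with close frequencies. By compactness finitely
    many such pairs suffice; the averages over their sums multiply. *)
Lemma small_chi_averages (del r e : R) : 0 < del -> 0 < e -> exists2 l : seq V, l != [::] &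
  forall y, del <= `|y| -> `|y| <= r -> normc (avg l (chi y) 0) <= e.
Proof.
move=> del0 e0.
have [rho rho0 Hrho] := @chi_near1 R d _ e0.
have /choice[t Ht] : forall c : V, exists t, c != 0 -> chi c t = -1.
  move=> c; have [->|c0] := eqVneq c 0; first by exists 0.
  by have [t Ht _] := chi_minus1 c0; exists t.
pose U c := [set y : V | `|y - c| < rho / (`|t c| + 1)].
pose A := [set y : V | `|y| <= r] `&` ~` [set y : V | `|y - 0| < del].
have cA : compact A.
  apply: compact_closedI; first exact: compact_ball.
  by apply: open_closedC; exact: open_ball_norm.
have [|s [sA HA]] := compact_net cA (U := U).
  move=> c _; split; first exact: open_ball_norm.
  by rewrite /U /= subrr normr0 divr_gt0// ltr_wpDl.
have M1 l y : l != [::] -> normc (avg l (chi y) 0) <= 1.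
  by move=> l0; apply: avg_le => // u _; rewrite normc_chi.
have [l l0 Hl] : exists2 l : seq V, l != [::] & forall c y, c \in s -> U c y -> normc (avg l (chi y) 0) <= e.
  elim: s sA {HA} => [|c s IH] sA; first by exists [:: 0].
  have [|l l0 Hl] := IH; first by move=> x xs; apply: sA; rewrite inE xs orbT.
  have c0 : c != 0.
    apply/eqP => E; have [_ H] := sA c (mem_head _ _).
    by apply: H; rewrite /= E subrr normr0.
  exists (sums [:: 0; t c] l); first exact: sums_neq0.
  move=> b y bs Uy; rewrite avg_chi_sums normcM2; move: bs; rewrite inE => /orP[/eqP bc|bs]; last first.
    rewrite -[leRHS]mul1r; apply: ler_pM; rewrite ?normc_ge0 ?M1//; exact: Hl Uy.
  rewrite -[leRHS]mulr1; apply: ler_pM; rewrite ?normc_ge0 ?M1//.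
  rewrite bc in Uy; rewrite /avg !big_cons big_nil addr0 subr0 sub0r chi0 chiN.
  rewrite -[y](subrK c) chiDl (Ht c c0) mulrN1 conjcN2.
  have -> : 1 - conjc (chi (y - c) (t c)) = - conjc (chi (y - c) (t c) - 1) :> R[i].
    by rewrite conjcB opprB; congr (_ - _); apply/eqP; rewrite eq_complex /= oppr0 !eqxx.
  rewrite normcM2 normcNE normcJ normc_real ger0_norm ?invr_ge0//= ler_pdivrMl//.
  have := Hrho (t c) (y - c); move=> /(_ _) K.
  apply: le_trans (K _) _; last by lra.
  apply: (@le_lt_trans _ _ ((`|t c| + 1) * `|y - c|)); first by rewrite ler_wpM2r// lerDl.
  by rewrite mulrC -ltr_pdivlMr// ltr_wpDl.
exists l => // y dy yr; have [|c cs Uc] := HA y; last exact: Hl Uc.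
by split=> //=; rewrite subr0 => K; move: (lt_le_trans K dy); rewrite ltxx.
Qed.

Variables (mu nu : (V -> C) -> C) (hmu : strongly_ap mu) (hnu : is_fourier_transform mu nu).

Let mmu : is_measure mu. Proof. by case: hmu. Qed.
Let mnu : is_measure nu. Proof. by case: hnu. Qed.

Lemma integrable_sqr_fcheck f : Cc f -> integrable nu (sqr_fcheck f).
Proof. by move=> cf; have [_ /(_ f cf)[+ _]] := hnu; move=> /(in_L1P _ (buc_sqr_fcheck cf)). Qed.

Lemma integral_sqr_fcheck f : Cc f -> integral_is nu (sqr_fcheck f) (mu (convolution f (ftilde f))).
Proof.
move=> cf; have b2 := buc_sqr_fcheck cf.
have [z Hz] := integral_is_exists mnu b2 (integrable_sqr_fcheck cf).
have [_ /(_ f cf)[_ ->]] := hnu.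
by rewrite -[X in pairing nu X]/(sqr_fcheck f) (pairingP mnu b2 Hz).
Qed.

Lemma mu_conv_expand (c : C) p q : Cc p -> Cc q ->
  mu (convolution (fun x => p x + c * q x) (ftilde (fun x => p x + c * q x))) =
  mu (convolution p (ftilde p)) + conjc c * mu (convolution p (ftilde q)) +
  c * (mu (convolution q (ftilde p)) + conjc c * mu (convolution q (ftilde q))).
Proof.
move=> cp cq; have cp' := Cc_ftilde cp; have cq' := Cc_ftilde cq.
have cs : Cc (fun x => ftilde p x + conjc c * ftilde q x) by apply: CcD => //; exact: CcZ.
rewrite ftilde_linear (_ : convolution _ _ = fun x =>
   (convolution p (ftilde p) x + conjc c * convolution p (ftilde q) x) +
   c * (convolution q (ftilde p) x + conjc c * convolution q (ftilde q) x)); last first.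
  by apply/funext => x; rewrite convolution_linear_l// !convolution_linear_r.
have c2 f g : Cc f -> Cc g -> Cc (convolution f g) by exact: Cc_conv.
have c3 f : Cc f -> Cc (fun x => convolution f (ftilde p) x + conjc c * convolution f (ftilde q) x).
  by move=> cf; apply: CcD; [exact: c2|apply: CcZ; exact: c2].
rewrite (measD mmu (c3 p cp) (CcZ c (c3 q cq))) (measZ mmu c (c3 q cq)).
have E f : Cc f -> mu (fun x => convolution f (ftilde p) x + conjc c * convolution f (ftilde q) x) =
    mu (convolution f (ftilde p)) + conjc c * mu (convolution f (ftilde q)).
  by move=> cf; rewrite (measD mmu (c2 _ _ cf cp') (CcZ (conjc c) (c2 _ _ cf cq'))) (measZ mmu (conjc c) (c2 _ _ cf cq')).
by rewrite (E p cp) (E q cq).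
Qed.

(** Polarization of the defining identity of the Fourier transform. *)
Lemma integral_fcheck_mul p q : Cc p -> Cc q ->
  integral_is nu (fun y => fcheck p y * conjc (fcheck q y)) (mu (convolution p (ftilde q))).
Proof.
move=> cp cq; pose j : C := Complex 0 1.
have jj : j * j = -1 by rewrite /j; simpc.
have cj : conjc j = - j by rewrite /j; apply/eqP; rewrite eq_complex /= oppr0 !eqxx.
have cjN : conjc (- j) = j by rewrite conjcN2 cj opprK.
have c1 : conjc (1 : C) = 1 by apply/eqP; rewrite eq_complex /= oppr0 !eqxx.
have cN1 : conjc (- 1 : C) = -1 by rewrite conjcN2 c1.
have four : (4 : C) != 0 by rewrite pnatr_eq0.
pose Q (c : C) := fun x => p x + c * q x.
have cQ c : Cc (Q c) by apply: CcD => //; exact: CcZ.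
(* The polarization identity for sesquilinear forms, over the fourth roots of
   unity. *)
pose L : seq C := [:: 1; -1; j; -j].
have := integral_is_sum mnu L (fun c => bucZ c (buc_sqr_fcheck (cQ c)))
  (fun c => integral_isZ mnu c (integral_sqr_fcheck (cQ c))).
move=> /(integral_isZ mnu 4^-1).
have pol (X Y Z W : C) : 4^-1 * \sum_(c <- L) c * (X + conjc c * Y + c * (Z + conjc c * W)) = Y.
  rewrite /L !big_cons big_nil addr0 c1 cN1 cj cjN.
  have -> : 1 * (X + 1 * Y + 1 * (Z + 1 * W)) +
    (-1 * (X + -1 * Y + -1 * (Z + -1 * W)) +
    (j * (X + - j * Y + j * (Z + - j * W)) + - j * (X + j * Y + - j * (Z + j * W)))) =
    2 * Y + 2 * Z - 2 * (j * j) * Y + 2 * (j * j) * Z :> C by ring.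
  rewrite jj; have -> : 2 * Y + 2 * Z - 2 * -1 * Y + 2 * -1 * Z = 4 * Y :> C by ring.
  by rewrite mulKf.
rewrite (_ : 4^-1 * _ = mu (convolution p (ftilde q))); last first.
  under eq_bigr do rewrite mu_conv_expand//; exact: pol.
apply: integral_is_ext => y; rewrite -[RHS](pol (fcheck p y * conjc (fcheck p y)) _ (fcheck q y * conjc (fcheck p y)) (fcheck q y * conjc (fcheck q y))).
congr (_ * _); apply: eq_bigr => c _; congr (_ * _).
rewrite /sqr_fcheck -mulcJ fcheck_linear// conjcD conjcM2; ring.
Qed.

(** Polarization for f and its translate by x, whose transforms differ by the
    factor chi x. *)
Lemma integral_chi_sqr_fcheck f x : Cc f ->
  integral_is nu (fun y => chi x y * sqr_fcheck f y) (autocorrelation mu f x).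
Proof.
move=> cf; have cp := Cc_translate x cf.
have := integral_fcheck_mul cp cf.
have -> : mu (convolution (fun z => f (z - x)) (ftilde f)) = autocorrelation mu f x.
  rewrite /autocorrelation /conv_measure; congr mu; apply/funext => z.
  rewrite -(opprB z x) autocorrelation_reflect// /convolution.
  rewrite -(integral_Rd_translate x); last by apply: Cc_conv_integrand => //; exact: Cc_ftilde.
  by apply: integral_Rd_ext => y; rewrite addrK; congr (_ * ftilde _ _); rewrite opprD addrA addrAC.
apply: integral_is_ext => y; rewrite /sqr_fcheck -mulcJ mulrA; congr (_ * _).
rewrite /fcheck -(integral_Rd_translate x); last by apply: CcM => //; exact: buc_chi.
rewrite -integral_RdZ; last by apply: CcM => //; exact: buc_chi.
by apply: integral_Rd_ext => z; rewrite addrK chiD [chi x y]chiC; ring.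
Qed.

Let coef f y : C := sqr_fcheck f y * fourier_bohr mu y.

Lemma amean_coef f y : Cc f -> amean (fun x => autocorrelation mu f x * conjc (chi y x)) (coef f y).
Proof. by move=> cf; rewrite /coef mulrC; exact: amean_autocorrelation. Qed.

(** Up to an error of 1, a combination of the coefficients on s with phases that
    make it the sum of their absolute values is the integral of F = |fcheck f|^2
    against a trigonometric polynomial K, which for a suitable list of
    translations is bounded by 2 on a compact set that carries all but a mass
    1 / n of F, and by n everywhere; so the integral is bounded independently of
    s. *)
Lemma abs_summable_coef f : Cc f -> abs_summable (coef f).
Proof.
move=> cf; have bF := buc_sqr_fcheck cf; set F := sqr_fcheck f in bF.
have iF : integrable nu F := integrable_sqr_fcheck cf.
have [E E0 HE] := upper_integrable mnu bF iF.
exists (2 * (E + 1) + 2) => s us.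
pose n : R := (size s)%:R + 1; have n0 : 0 < n by rewrite /n ltr_wpDl.
have in0 : 0 < n^-1 by rewrite invr_gt0.
have in1 : n^-1 <= 1 by rewrite invf_le1// /n lerDr.
have [h ch Hh] := iF _ in0.
have [_ [r r0 vh]] := iffLR (CcP h) ch.
have Hh1 : upper_le nu (fun x => normc (h x)) (E + 1).
  apply: upper_mono (upper_weaken _ (upper_add2 mnu bF HE Hh)) => [x|]; last by lra.
  by have := normc_dist (h x) (F x); rewrite (normcBC (h x)).
have [del [del0 _ Hdel]] := separation s.
have [Y Y0 HY] := seq_bound s (fun y => `|y|).
have [l2 l20 Hl2] := small_chi_averages (r + Y) (divr_gt0 del0 (ltr0Sn R 1)) in0.
pose a := coef f; pose T x := \sum_(y <- s) unphase (a y) * conjc (chi y x).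
pose H := autocorrelation mu f.
have aH : ap H := ap_autocorrelation hmu cf.
have mHT : amean (fun x => \sum_(y <- s) unphase (a y) * (H x * conjc (chi y x))) (\sum_(y <- s) unphase (a y) * a y).
  by apply: amean_sum => y; apply: ameanZ; exact: amean_coef.
have [l1 l10 Hl1] := mHT 1 ltr01.
pose l := sums l1 l2; have l0 : l != [::] := sums_neq0 l10 l20.
pose HT x := \sum_(y <- s) unphase (a y) * (H x * conjc (chi y x)).
have near_mean : normc (avg l HT 0 - \sum_(y <- s) unphase (a y) * a y) <= 1.
  rewrite /l avg_sums avg_sumsC -[X in avg _ _ _ - X](@avg_cst _ _ l2 _ 0)// -avgB.
  by apply: avg_le => // t _; exact: Hl1.
pose K xi := avg l (fun x => chi x xi * T x) 0.
have avg_chi_l y : normc (avg l (chi y) 0) <= normc (avg l2 (chi y) 0).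
  rewrite /l avg_chi_sums normcM2 -[leRHS]mul1r ler_wpM2r ?normc_ge0//.
  by apply: avg_le => // u _; rewrite normc_chi.
have KE xi : K xi = \sum_(y <- s) unphase (a y) * avg l (chi (xi - y)) 0.
  transitivity (avg l (fun x => \sum_(y <- s) unphase (a y) * chi (xi - y) x) 0).
    apply: avg_eq => x; rewrite /T mulr_sumr; apply: eq_bigr => y _.
    by rewrite chiBl [chi xi x]chiC; ring.
  rewrite /avg exchange_big mulr_sumr; apply: eq_bigr => y _.
  by rewrite -mulr_sumr mulrCA.
have Ksum xi : normc (K xi) <= \sum_(y <- s) normc (avg l2 (chi (xi - y)) 0).
  rewrite KE; apply: le_trans (normc_sum _ _ _) _; apply: ler_sum => y _.
  rewrite normcM2 -[leRHS]mul1r; apply: ler_pM; rewrite ?normc_ge0 ?normc_unphase//.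
have l2_1 y : normc (avg l2 (chi y) 0) <= 1.
  by apply: avg_le => // u _; rewrite normc_chi.
have Kn xi : normc (K xi) <= n.
  apply: le_trans (Ksum xi) _; apply: (@le_trans _ _ (\sum_(y <- s) 1)); first exact: ler_sum.
  by rewrite big_const_seq count_predT iter_addr_0 /n lerDl.
have K2 xi : `|xi| <= r -> normc (K xi) <= 2.
  move=> xir; apply: le_trans (Ksum xi) _.
  have small y : y \in s -> del / 2 <= `|xi - y| -> normc (avg l2 (chi (xi - y)) 0) <= n^-1.
    by move=> ys dy; apply: Hl2 => //; apply: le_trans (ler_normB _ _) _; apply: lerD => //; exact: HY.
  have rest (P : pred V) : (forall y, y \in s -> P y -> del / 2 <= `|xi - y|) ->
      \sum_(y <- s | P y) normc (avg l2 (chi (xi - y)) 0) <= 1.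
    move=> HP; apply: (@le_trans _ _ (\sum_(y <- s) n^-1)).
      rewrite [leRHS](bigID P) /= big_seq_cond [X in _ <= X + _]big_seq_cond.
      apply: ler_wpDr; first by apply: sumr_ge0 => y _; exact: ltW.
      by apply: ler_sum => y /andP[ys Py]; apply: small => //; exact: HP.
    rewrite big_const_seq count_predT iter_addr_0 -mulr_natl ler_pdivrMr// mul1r /n lerDl//.
  have [[y0 y0s zy]|no] := pselect (exists2 y0, y0 \in s & `|xi - y0| < del / 2).
    rewrite (bigD1_seq y0)//=; have := l2_1 (xi - y0).
    suff : \sum_(i <- s | i != y0) normc (avg l2 (chi (xi - i)) 0) <= 1 by lra.
    apply: rest => y ys yy0; have := Hdel y y0 ys y0s yy0.
    by have := ler_normD (y - xi) (xi - y0); rewrite addrA subrK (distrC y xi); lra.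
  apply: le_trans (rest xpredT _) _; last by lra.
  by move=> y ys _; rewrite leNgt; apply/negP => Hy; apply: no; exists y.
have bK : buc K.
  rewrite (_ : K = fun xi => \sum_(y <- s) unphase (a y) * avg l (chi (xi - y)) 0); last exact/funext.
  apply: buc_sum => y; apply: bucZ; apply: bucZ; apply: buc_sum => u.
  rewrite (_ : (fun x => chi (x - y) (0 - u)) = fun x => chi (0 - u) (x - y)); last first.
    by apply/funext => x; rewrite chiC.
  by apply: buc_translate; exact: buc_chi.
have IK : integral_is nu (fun xi => K xi * F xi) (avg l HT 0).
  have base t : integral_is nu (fun xi => T (0 - t) * (chi (0 - t) xi * F xi)) (T (0 - t) * H (0 - t)).
    by apply: integral_isZ => //; exact: integral_chi_sqr_fcheck.
  have bb t : buc (fun xi => T (0 - t) * (chi (0 - t) xi * F xi)).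
    by apply: bucZ; apply: bucM => //; exact: buc_chi.
  have := integral_isZ mnu (Complex (size l)%:R^-1 0) (integral_is_sum mnu l bb base).
  rewrite (_ : Complex _ 0 * _ = avg l HT 0); last first.
    rewrite /avg; congr (_ * _); apply: eq_bigr => t _; rewrite /HT /T mulr_suml; apply: eq_bigr => y _.
    by rewrite -mulrA [conjc _ * _]mulrC.
  apply: integral_is_ext => xi; rewrite /K /avg -mulrA; congr (_ * _); rewrite mulr_suml.
  by apply: eq_bigr => t _; ring.
have UK : upper_le nu (fun xi => normc (K xi * F xi)) (2 * (E + 1) + 1).
  have b2h : buc (fun xi => Complex 2 0 * h xi) by apply: bucZ; exact: Cc_buc.
  have E2 : normc (Complex 2 0 : C) = 2 by rewrite normc_real ger0_norm.
  have u1 : upper_le nu (fun xi => normc (Complex 2 0 * h xi)) (2 * (E + 1)).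
    apply: upper_mono (upper_scale mnu _ _ Hh1) => [x||]; [|by []|by lra].
    by rewrite normcM2 E2.
  have u2 : upper_le nu (fun xi => n * normc (F xi - h xi)) 1.
    by have := upper_scale mnu (ltW n0) (ltW in0) Hh; rewrite mulfV// gt_eqF.
  apply: upper_mono (upper_add mnu b2h _ u1 u2) => [xi|xi]; last by rewrite mulr_ge0 ?(ltW n0) ?normc_ge0.
  rewrite (normcM2 (K xi)) (normcM2 (Complex 2 0)) E2; have [xr|xr] := leP `|xi| r.
    have A := normc_dist (F xi) (h xi).
    have B1 : normc (K xi) * normc (h xi) <= 2 * normc (h xi) by rewrite ler_wpM2r ?normc_ge0// K2.
    have B2 : normc (K xi) * normc (F xi - h xi) <= n * normc (F xi - h xi) by rewrite ler_wpM2r ?normc_ge0.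
    have B3 : normc (K xi) * normc (F xi) <= normc (K xi) * (normc (h xi) + normc (F xi - h xi)) by rewrite ler_wpM2l ?normc_ge0.
    by move: B3; rewrite mulrDr; lra.
  by rewrite vh// subr0 normc0 mulr0 add0r ler_wpM2r ?normc_ge0.
have HL : normc (avg l HT 0) <= 2 * (E + 1) + 1 by apply: integral_is_bound UK IK => //; exact: bucM.
have SE : \sum_(y <- s) unphase (a y) * a y = Complex (\sum_(y <- s) normc (a y)) 0.
  rewrite (eq_bigr (fun y => Complex (normc (a y)) 0)); last by move=> y _; exact: unphaseE.
  by elim: (s) => [|y l' IH]; rewrite ?big_nil// !big_cons IH; simpc.
have := normc_dist (\sum_(y <- s) unphase (a y) * a y) (avg l HT 0).
rewrite SE in near_mean *; rewrite normc_real ger0_norm ?sumr_ge0// => [|y _]; last exact: normc_ge0.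
rewrite (normcBC (Complex _ _)); lra.
Qed.

(** For a trigonometric polynomial P in place of phi, the integral is a combination
    of values of [autocorrelation mu f], which is the sum of its Fourier series,
    and so equals the sum over all coefficients. The polynomial is close to phi
    on a large cube only, but it is bounded by the same constant everywhere, and
    F has little mass outside of that cube. *)
Lemma integral_mul_coef f (phi : V -> C) : Cc f -> Cc phi -> exists2 D : R, 0 <= D &
  forall Y e, 0 < e -> e <= 1 -> tail_le (coef f) Y e ->
    normc (nu (fun y => phi y * sqr_fcheck f y) - \sum_(y <- Y) phi y * coef f y) <= D * e.
Proof.
move=> cf cphi; have bF := buc_sqr_fcheck cf; set F := sqr_fcheck f in bF *.
have iF : integrable nu F := integrable_sqr_fcheck cf.
have [E E0 HE] := upper_integrable mnu bF iF.
have sa := abs_summable_coef cf; have [A HA] := sa.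
have A0 : 0 <= A by have := HA [::] isT; rewrite big_nil.
have [B B0 phiB] := Cc_bound cphi; have [uphi [rho rho0 vphi]] := iffLR (CcP phi) cphi.
pose D := (E + 1) + 2 * B + 2 + 2 * B + A.
exists D; first by rewrite /D; lra.
move=> Y e e0 e1 tY; have [h ch Hh] := iF _ e0.
have Hh1 : upper_le nu (fun x => normc (h x)) (E + 1).
  apply: upper_mono (upper_weaken _ (upper_add2 mnu bF HE Hh)) => [x|]; last by lra.
  by have := normc_dist (h x) (F x); rewrite (normcBC (h x)).
have [_ [rh rh0 vh]] := iffLR (CcP h) ch.
have [L L0 HL] := seq_bound Y (fun y => `|y|).
pose r := rho + rh + L + 1; have r0 : 0 < r by rewrite /r; lra.
have rr : rho < r by rewrite /r; lra.
have [s [_ PB Pphi]] := fejer_approx r0 uphi vphi rho0 rr e0 phiB.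
pose P := trig_poly s; pose H := autocorrelation mu f.
pose zP := \sum_(p <- s) p.1 * H p.2.
have bP : buc P by exact: buc_trig_poly.
have IP : integral_is nu (fun y => P y * F y) zP.
  have bb (p : C * V) : buc (fun y => p.1 * (chi p.2 y * F y)).
    by apply: bucZ; apply: bucM => //; exact: buc_chi.
  have ib (p : C * V) := integral_isZ mnu p.1 (integral_chi_sqr_fcheck p.2 cf).
  have := integral_is_sum mnu s bb ib.
  apply: integral_is_ext => y; rewrite /P /trig_poly mulr_suml.
  by apply: eq_bigr => p _; rewrite mulrA.
have cpF : Cc (fun y => phi y * F y) by exact: CcM.
have H1 : normc (nu (fun y => phi y * F y) - zP) <= e * (E + 1) + 2 * B * e.
  have bd : buc (fun y => phi y * F y + -1 * (P y * F y)).
    by apply: bucD; [exact: Cc_buc|apply: bucZ; exact: bucM].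
  have Id := integral_isD mnu (Cc_buc cpF) (integral_is_Cc mnu cpF) (integral_isZ mnu (-1) IP).
  rewrite -[- zP]mulN1r; apply: integral_is_bound Id => //.
  have be : buc (fun y => Complex e 0 * h y) by apply: bucZ; exact: Cc_buc.
  have u1 : upper_le nu (fun y => normc (Complex e 0 * h y)) (e * (E + 1)).
    apply: upper_mono (upper_scale mnu (ltW e0) _ Hh1) => [x|]; last by lra.
    by rewrite normcM2 normc_real (gtr0_norm e0).
  have B20 : 0 <= 2 * B by lra.
  have u2 := upper_scale mnu B20 (ltW e0) Hh.
  apply: upper_mono (upper_add mnu be _ u1 u2) => [y|y]; last by rewrite mulr_ge0 ?normc_ge0.
  have -> : phi y * F y + -1 * (P y * F y) = (phi y - P y) * F y by ring.
  rewrite (normcM2 (phi y - P y)) (normcM2 (Complex e 0)) (normc_real e) (gtr0_norm e0).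
  have d2B : normc (phi y - P y) <= 2 * B.
    by apply: le_trans (normcB _ _) _; have := phiB y; have := PB y; rewrite -/P; lra.
  have B1 : normc (phi y - P y) * normc (h y) <= e * normc (h y).
    have [yr|yr] := leP `|y| rh; last by rewrite vh// normc0 !mulr0.
    by rewrite ler_wpM2r ?normc_ge0//; apply: Pphi; rewrite /r; lra.
  have B2 : normc (phi y - P y) * normc (F y - h y) <= 2 * B * normc (F y - h y).
    by rewrite ler_wpM2r ?normc_ge0.
  have B3 : normc (phi y - P y) * normc (F y) <= normc (phi y - P y) * (normc (h y) + normc (F y - h y)).
    by rewrite ler_wpM2l ?normc_ge0//; exact: normc_dist.
  by move: B3; rewrite mulrDr; lra.
pose cp := \sum_(p <- s) normc p.1; have cp0 : 0 <= cp by apply: sumr_ge0 => p _; exact: normc_ge0.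
have cp1 : 0 < cp + 1 by lra.
pose e2 := e / (cp + 1); have e20 : 0 < e2 by rewrite divr_gt0.
have e2e : e2 <= e by rewrite /e2 ler_pdivrMr// ler_peMr ?(ltW e0)//; lra.
have [Y' tY'] := summable_tail sa e20.
have H2 : normc (zP - \sum_(y <- Y') P y * coef f y) <= 2 * e.
  have -> : \sum_(y <- Y') P y * coef f y = \sum_(p <- s) p.1 * \sum_(y <- Y') coef f y * chi y p.2.
    rewrite /P /trig_poly; under eq_bigr do rewrite mulr_suml.
    rewrite exchange_big; apply: eq_bigr => p _; rewrite mulr_sumr; apply: eq_bigr => y _.
    by rewrite [chi y p.2]chiC; ring.
  rewrite -sumrB; apply: le_trans (normc_sum _ _ _) _.
  apply: (@le_trans _ _ (\sum_(p <- s) normc p.1 * (2 * e2))).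
    apply: ler_sum => p _; rewrite -mulrBr normcM2 ler_wpM2l ?normc_ge0//.
    by apply: ap_fourier_series => // [|y]; [exact: ap_autocorrelation|exact: amean_coef].
  rewrite -mulr_suml -/cp mulrCA ler_pM2l// /e2 mulrA ler_pdivrMr// mulrC ler_pM2l//; lra.
have tail_P Z b : tail_le (coef f) Z b -> 0 <= b -> tail_le (fun y => P y * coef f y) Z (B * b).
  move=> [uZ HZ] b0; split=> // t ut tZ; apply: le_trans (_ : B * \sum_(y <- t) normc (coef f y) <= _).
    by rewrite mulr_sumr; apply: ler_sum => y _; rewrite normcM2 ler_wpM2r ?normc_ge0// PB.
  by rewrite ler_wpM2l// HZ.
have H3 := tail_compare (tail_P _ _ tY' (ltW e20)) (tail_P _ _ tY (ltW e0)).
have H3' : B * e2 + B * e <= 2 * B * e by have := ler_wpM2l B0 e2e; lra.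
have H4 : normc (\sum_(y <- Y) P y * coef f y - \sum_(y <- Y) phi y * coef f y) <= e * A.
  rewrite -sumrB; apply: le_trans (normc_sum _ _ _) _.
  apply: (@le_trans _ _ (e * \sum_(y <- Y) normc (coef f y))).
    rewrite mulr_sumr big_seq [leRHS]big_seq; apply: ler_sum => y yY.
    rewrite -mulrBl normcM2 ler_wpM2r ?normc_ge0// normcBC; apply: Pphi.
    by have := HL y yY; rewrite /r; lra.
  by rewrite ler_wpM2l ?(ltW e0)// HA// tY.1.
apply: le_trans (normc_tri zP _ _) _.
apply: le_trans (lerD H1 (normc_tri (\sum_(y <- Y') P y * coef f y) _ _)) _.
have H5 := normc_tri (\sum_(y <- Y) P y * coef f y) (\sum_(y <- Y') P y * coef f y) (\sum_(y <- Y) phi y * coef f y).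
have -> : D * e = (e * (E + 1) + 2 * B * e) + (2 * e + (2 * B * e + e * A)) by rewrite /D; ring.
by rewrite lerD2l; apply: lerD H2 _; apply: le_trans H5 _; apply: lerD H4; exact: le_trans H3 H3'.
Qed.

Lemma nint_spike_gt0 (del : R) : 0 < del -> 0 < nint (spike del : V -> C).
Proof.
move=> d0; have cs : Cc (spike del : V -> C).
  by have := @Cc_spike R d del 0 d0; under eq_fun do rewrite subr0.
apply: lt_le_trans (nint_ge_cube (del / 2) cs).
have d20 : 0 <= del / 2 by rewrite divr_ge0// ltW.
apply: (@lt_le_trans _ _ (rint (cube (del / 2) : set V) (fun=> 2^-1))).
  by rewrite (rint_cst (borel_cube _)) vol_cube//= mulr_gt0// exprn_gt0// mulr_gt0// divr_gt0.
apply: rint_le; [exact: borel_cube|exact: vol_cube_fin| |exact: (buc_Re (buc_normc (Cc_buc cs)))|].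
  exact: (buc_Re (buc_cst (Complex 2^-1 0 : C))).
move=> x; rewrite /cube /= => xd; rewrite normc_real ger0_norm ?clip_ge0//.
have H : `|x| / del <= 2^-1 by rewrite ler_pdivrMr// mulrC.
have := divr_ge0 (normr_ge0 x) (ltW d0) => H0.
rewrite /clip (min_idPr _); last by lra.
by rewrite (max_idPr _); lra.
Qed.

(** The transform of a nonnegative function that is supported close to the origin
    nearly equals its integral on the given cube. *)
Lemma fcheck_lower_bound (r : R) : 0 <= r ->
  exists f, Cc f /\ exists2 kap, 0 < kap & forall y, `|y| <= r -> kap <= normc (fcheck f y).
Proof.
move=> r0; have h0 : 0 < (2^-1 : R) by [].
have [rho rho0 Hrho] := @chi_near1 R d _ h0.
pose del := rho / (r + 1); have r1 : 0 < r + 1 by lra.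
have d0 : 0 < del by rewrite divr_gt0.
have cs : Cc (spike del : V -> C).
  by have := @Cc_spike R d del 0 d0; under eq_fun do rewrite subr0.
exists (spike del); split=> //; exists (nint (spike del : V -> C) / 2); first by rewrite divr_gt0// nint_spike_gt0.
move=> y yr.
have K : normc (integral_Rd (spike del : V -> C) - fcheck (spike del) y) <= 2^-1 * nint (spike del : V -> C).
  have cc : Cc (fun x => spike del x * chi y x) by apply: CcM => //; exact: buc_chi.
  rewrite /fcheck -integral_RdB//.
  rewrite (integral_Rd_ext (g := fun x => spike del x * (1 - chi y x))); last by move=> x; rewrite mulrBr mulr1.
  apply: normc_integral_mul => // [|x xs].
    by apply: CcM => //; apply: bucB; [exact: buc_cst|exact: buc_chi].
  rewrite normcBC; apply: Hrho.
  have xd : `|x| < del by rewrite ltNge; apply: contra xs => /(spike_out d0) ->.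
  apply: (@le_lt_trans _ _ (`|x| * (r + 1))); first by rewrite ler_wpM2l//; lra.
  by rewrite -ltr_pdivlMr.
have K2 : nint (spike del : V -> C) <= normc (integral_Rd (spike del : V -> C)).
  apply: le_trans (le_trans (ler_norm _) (Re_le_normc _)).
  rewrite /nint (integral_Rd_ext (g := spike del))// => x.
  by rewrite normc_real ger0_norm// clip_ge0.
have := normc_dist (integral_Rd (spike del : V -> C)) (fcheck (spike del) y); lra.
Qed.

Lemma loc_summable_fourier_bohr : loc_summable (fourier_bohr mu).
Proof.
move=> r; have [f [cf [kap kap0 Hkap]]] := fcheck_lower_bound (normr_ge0 r).
have [A HA] := abs_summable_coef cf.
exists (A / kap ^+ 2) => s us sr; rewrite ler_pdivlMr ?exprn_gt0// mulr_suml.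
apply: le_trans (HA s us); rewrite big_seq [leRHS]big_seq; apply: ler_sum => y ys.
rewrite /coef normcM2 mulrC ler_wpM2r ?normc_ge0// normc_sqr_fcheck.
rewrite lerXn2r ?nnegrE ?normc_ge0 ?(ltW kap0)//; apply: Hkap.
by apply: le_trans (sr y ys) (ler_norm r).
Qed.

(** By [integral_mul_coef] for psi = phi / F, where F = |fcheck f|^2 is bounded
    below on the support of phi; the maximum in the definition of m keeps the
    denominator positive outside of it. *)
Lemma fourier_transform_formal_sum : eq_on_Cc nu (formal_sum (fourier_bohr mu)).
Proof.
move=> phi cphi; have [_ [r r0 vphi]] := iffLR (CcP phi) cphi.
have lw := loc_summable_fourier_bohr.
have [f [cf [kap kap0 Hkap]]] := fcheck_lower_bound r0.
have bF := buc_sqr_fcheck cf; set F := sqr_fcheck f in bF.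
pose k2 := kap ^+ 2; have k20 : 0 < k2 by rewrite exprn_gt0.
pose m y : C := Complex (Num.max 0 (complex.Re (F y - Complex k2 0))) 0.
have bm : buc m.
  apply: (@buc_lipschitz _ _ (Num.max 0)); first exact: max0_lipschitz.
  by apply: bucB => //; exact: buc_cst.
pose psi y := phi y * Complex (complex.Re (m y) + k2)^-1 0.
have cpsi : Cc psi.
  by apply: CcM => //; apply: buc_inv_shift => // y; rewrite le_max lexx.
have E : phi = fun y => psi y * F y.
  apply/funext => y; have [yr|yr] := leP `|y| r; last by rewrite /psi vphi// !mul0r.
  have kF : k2 <= complex.Re (F y).
    by rewrite /= lerXn2r ?nnegrE ?normc_ge0 ?(ltW kap0)// Hkap.
  have -> : psi y = phi y * Complex (complex.Re (F y))^-1 0.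
    have mE : complex.Re (m y) = complex.Re (F y) - k2.
      by rewrite -[LHS]/(Num.max 0 (complex.Re (F y) - k2)) (max_idPr _)// subr_ge0.
    by rewrite /psi mE subrK.
  have -> : F y = Complex (complex.Re (F y)) 0 by [].
  rewrite -mulrA [X in _ * X](_ : _ = 1) ?mulr1//; simpc.
  by rewrite mulVf// gt_eqF// (lt_le_trans k20).
have [D D0 HD] := integral_mul_coef cf cpsi; rewrite -/F -E in HD.
have [B B0 psiB] := Cc_bound cpsi.
apply/subr0_eq/normc_le0/ler_addgt0Pl => e e0; rewrite addr0.
pose K := D + 2 * B + 1; have K0 : 0 < K by rewrite /K; lra.
pose e' := Num.min 1 (e / K).
have e'0 : 0 < e' by rewrite lt_min ltr01 divr_gt0.
have e'1 : e' <= 1 by rewrite ge_min lexx.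
have e'K : e' * K <= e by rewrite -ler_pdivlMr// ge_min lexx orbT.
have [Y tY] := summable_tail (abs_summable_coef cf) e'0.
have H1 := HD _ _ e'0 e'1 tY.
have T2 : tail_le (fun y => phi y * fourier_bohr mu y) Y (B * e').
  split=> [|s us sY]; first exact: tY.1.
  apply: le_trans (_ : B * \sum_(y <- s) normc (coef f y) <= _).
    rewrite mulr_sumr; apply: ler_sum => y _; rewrite [in leLHS]E /coef -mulrA normcM2.
    by rewrite ler_wpM2r ?normc_ge0.
  by rewrite ler_wpM2l// tY.2.
have H2 := formal_sum_tail lw cphi T2.
have E2 : \sum_(y <- Y) phi y * fourier_bohr mu y = \sum_(y <- Y) psi y * coef f y.
  by apply: eq_bigr => y _; rewrite [in LHS]E /coef mulrA.
rewrite E2 normcBC in H2.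
apply: le_trans (normc_tri (\sum_(y <- Y) psi y * coef f y) _ _) _.
by have := ltW e'0; move: e'K; rewrite /K; lra.
Qed.

(** The translation of f by half a period of chi y, which is short, changes the
    sign of the transform at y. *)
Lemma riemann_lebesgue f (e : R) : Cc f -> 0 < e ->
  exists2 rho : R, 0 <= rho & forall y, rho <= `|y| -> normc (fcheck f y) <= e.
Proof.
move=> cf e0; have [uf [r r0 vf]] := iffLR (CcP f) cf.
pose W : R := (2 * (r + 1)) ^+ d; have W0 : 0 < W by rewrite exprn_gt0//; lra.
have eW : 0 < 2 * e / W by rewrite divr_gt0// mulr_gt0.
have [del del0 Hdel] := uf _ eW; pose m := Num.min 1 del.
have m0 : 0 < m by rewrite lt_min ltr01.
exists m^-1; first by rewrite invr_ge0 ltW.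
move=> y ym; have y0 : 0 < `|y| by apply: lt_le_trans ym; rewrite invr_gt0.
have yn : y != 0 by rewrite -normr_gt0.
have [t Ht tn] := chi_minus1 yn.
have tm : `|t| < m.
  apply: le_lt_trans tn _; rewrite -[m]invrK ltf_pV2 ?posrE ?invr_gt0 ?mulr_gt0//.
  by apply: le_lt_trans ym _; lra.
have t1 : `|t| < 1 by apply: lt_le_trans tm _; rewrite ge_min lexx.
have td : `|t| < del by apply: lt_le_trans tm _; rewrite ge_min lexx orbT.
have cft : Cc (fun x => f (x + t)).
  by have := Cc_translate (- t) cf; under eq_fun do rewrite opprK.
have cc g : Cc g -> Cc (fun x => g x * chi y x) by move=> cg; apply: CcM => //; exact: buc_chi.
pose g x := f x - f (x + t); have cg : Cc g by exact: CcB.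
have E : fcheck f y = Complex 2^-1 0 * integral_Rd (fun x => g x * chi y x).
  rewrite (integral_Rd_ext (g := fun x => f x * chi y x - f (x + t) * chi y x)); last by move=> x; rewrite mulrBl.
  rewrite integral_RdB; [|exact: cc|exact: cc].
  have -> : integral_Rd (fun x => f (x + t) * chi y x) = - fcheck f y.
    rewrite /fcheck -(integral_Rd_translate t (cc f cf)) -integral_RdN; last first.
      by have := Cc_translate (- t) (cc f cf); under eq_fun do rewrite opprK.
    by apply: integral_Rd_ext => x; rewrite chiD Ht mulrN1 mulrN opprK.
  rewrite opprK -[integral_Rd _]/(fcheck f y); case: (fcheck f y) => a b; simpc.
  by congr Complex; field.
have vg : vanish (r + 1) g.
  move=> x xr; rewrite /g !vf ?subrr//; last by lra.
  by have := ler_normB (x + t) t; rewrite addrK; lra.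
have ng : nint g <= 2 * e.
  rewrite (nintE vg); apply: (@le_trans _ _ (rint (cube (r + 1) : set V) (fun=> 2 * e / W))).
    apply: rint_le; [exact: borel_cube|exact: vol_cube_fin|exact: (buc_Re (buc_normc (Cc_buc cg)))| |].
      exact: (buc_Re (buc_cst (Complex (2 * e / W) 0 : C))).
    by move=> x _; apply: Hdel; rewrite opprD addrA subrr sub0r normrN.
  by rewrite (rint_cst (borel_cube _)) vol_cube/= ?divfK ?gt_eqF//; lra.
rewrite E normcM2 normc_real ger0_norm ?invr_ge0// ler_pdivrMl//; apply: le_trans ng.
by rewrite -[leRHS]mul1r; apply: normc_integral_mul => // [|x _]; [exact: cc|rewrite normc_chi].
Qed.

(** Multiplication by u superposes the translates of a transform by the points t n
    with weights 2^-n; see [fcheck_superposition]. *)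
Lemma superposition (t : nat -> V) : exists u : V -> C, buc u /\ forall N x,
  normc (u x - \sum_(n < N) Complex (2^-1 ^+ n) 0 * chi (- t n) x) <= 4 * 2^-1 ^+ N.
Proof.
pose m x (N : nat) : C := \sum_(n < N) Complex (2^-1 ^+ n) 0 * chi (- t n) x.
pose q (n : nat) : R := 2^-1 ^+ n; have q0 n : 0 < q n by rewrite exprn_gt0.
have step x i (k : nat) : normc (m x i - m x (i + k)%N) <= 2 * q i - 2 * q (i + k)%N.
  elim: k => [|k IH]; first by rewrite addn0 !subrr normc0.
  apply: le_trans (normc_tri (m x (i + k)%N) _ _) _.
  have -> : m x (i + k)%N - m x (i + k.+1)%N = - (Complex (q (i + k)%N) 0 * chi (- t (i + k)%N) x).
    by rewrite /m addnS big_ord_recr /= opprD addrA subrr sub0r.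
  rewrite normcNE normcM2 normc_chi mulr1 normc_real (gtr0_norm (q0 _)).
  have : q (i + k.+1)%N = 2^-1 * q (i + k)%N by rewrite addnS /q exprS.
  lra.
have /choice[u Hu] : forall x, exists z : C, forall N, normc (z - m x N) <= 2 * (2 * q N).
  move=> x; apply: (compatible_limit 0%N (m := m x) (e := fun N => 2 * q N)) => i j; have qi := q0 i; have qj := q0 j.
  have [ij|/ltnW ij] := leqP i j.
    by rewrite -(subnKC ij); apply: le_trans (step x i (j - i)%N) _; rewrite subnKC//; lra.
  by rewrite normcBC -(subnKC ij); apply: le_trans (step x j (i - j)%N) _; rewrite subnKC//; lra.
have Hu4 N x : normc (u x - m x N) <= 4 * q N by apply: le_trans (Hu x N) _; lra.
exists u; split; last by move=> N x; exact: Hu4.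
suff : ap u by case.
apply: ap_uniform_limit => e e0.
have [|||N HN] := @geometric_small R 2^-1 4 e; [by rewrite invr_ge0|lra|by []|].
exists (fun x => m x N); last by move=> x; apply: le_trans (Hu4 N x) _; rewrite mulrC.
by apply: ap_sum => n; apply: apZ; exact: ap_chi.
Qed.

Lemma fcheck_superposition f (t : nat -> V) (u : V -> C) N y (b : R) : Cc f -> buc u ->
  (forall x, normc (u x - \sum_(n < N) Complex (2^-1 ^+ n) 0 * chi (- t n) x) <= b) ->
  normc (fcheck (fun x => f x * u x) y - \sum_(n < N) Complex (2^-1 ^+ n) 0 * fcheck f (y - t n)) <= b * nint f.
Proof.
move=> cf bu Hu; have cc g : Cc g -> Cc (fun x => g x * chi y x) by move=> cg; apply: CcM => //; exact: buc_chi.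
pose m x : C := \sum_(n < N) Complex (2^-1 ^+ n) 0 * chi (- t n) x.
have bm : buc m by apply: buc_sum => n; apply: bucZ; exact: buc_chi.
have -> : \sum_(n < N) Complex (2^-1 ^+ n) 0 * fcheck f (y - t n) = fcheck (fun x => f x * m x) y.
  rewrite /fcheck.
  rewrite (integral_Rd_ext (g := fun x => \sum_(n < N) Complex (2^-1 ^+ n) 0 * (f x * chi (y - t n) x))); last first.
    move=> x; rewrite /m mulr_sumr mulr_suml; apply: eq_bigr => n _; rewrite chiDl; ring.
  have cn (n : 'I_N) : Cc (fun x => f x * chi (y - t n) x) by apply: CcM => //; exact: buc_chi.
  rewrite integral_Rd_sum; last by move=> n; apply: CcZ; exact: cn.
  by apply: eq_bigr => n _; rewrite integral_RdZ//; exact: cn.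
rewrite /fcheck -integral_RdB; last 2 first.
- by apply: cc; exact: CcM.
- by apply: cc; exact: CcM.
rewrite (integral_Rd_ext (g := fun x => f x * ((u x - m x) * chi y x))); last by move=> x; ring.
apply: normc_integral_mul => // [|x _]; last by rewrite normcM2 normc_chi mulr1.
by apply: CcM => //; apply: bucM; [exact: bucB|exact: buc_chi].
Qed.

(** Gliding hump. If the sums over translates of a cube were unbounded, one
    could choose translates t_n, far apart from each other, with sums larger
    than n 4^n; the superposition of the functions 2^(-n) f chi_(-t_n) has a
    transform of size 2^(-n) near each t_n, because the transform of f decays,
    and violates the summability of its coefficients. *)
Lemma fourier_bohr_translates (r : R) : 0 <= r -> exists S : R, forall x s, uniq s ->
  (forall y, y \in s -> `|y - x| <= r) -> \sum_(y <- s) normc (fourier_bohr mu y) <= S.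
Proof.
move=> r0; apply: contrapT => /forallNP unb.
have lw := loc_summable_fourier_bohr.
have [f [cf [kap kap0 Hkap]]] := fcheck_lower_bound r0.
pose q (n : nat) : R := 2^-1 ^+ n; have q0 n : 0 < q n by rewrite exprn_gt0.
(* Near t m the other copies add up to at most 2 * eps m, which is a quarter of
   the m-th one. *)
pose eps n := q n * (kap / 8); have eps0 n : 0 < eps n by rewrite mulr_gt0// divr_gt0.
have /choice[rho Hrho] : forall n, exists rho : R, 0 <= rho /\ forall y, rho <= `|y| -> normc (fcheck f y) <= eps n.
  by move=> n; have [rho rho0 H] := riemann_lebesgue cf (eps0 n); exists rho.
have far (D B : R) : exists ts : V * seq V, [/\ D <= `|ts.1|, uniq ts.2,
    forall y, y \in ts.2 -> `|y - ts.1| <= r & B < \sum_(y <- ts.2) normc (fourier_bohr mu y)].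
  have [S HS] := lw (D + r); have /existsNP[x /existsNP[s]] := unb (Num.max B S).
  move=> /not_implyP[us /not_implyP[sx]] /negP; rewrite -ltNge gt_max => /andP[Bs Ss].
  exists (x, s); split=> //; rewrite leNgt; apply/negP => /= xD.
  suff : \sum_(y <- s) normc (fourier_bohr mu y) <= S by rewrite leNgt Ss.
  apply: HS => // y ys; have := ler_normD (y - x) x; rewrite subrK; have := sx y ys; lra.
have /choice[g Hg] := fun p : R * R => far p.1 p.2.
pose B n : R := n%:R / (q n) ^+ 2.
pose fix ts n := if n is k.+1 then g (`|(ts k).1| + rho k.+1 + r, B k.+1) else g (0, 0).
pose t n := (ts n).1; pose s n := (ts n).2.
have tS n : `|t n| + rho n.+1 + r <= `|t n.+1| by have [] := Hg (`|t n| + rho n.+1 + r, B n.+1).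
have us n : uniq (s n) by case: n => [|n]; rewrite /s /=; [have [] := Hg (0, 0)|have [] := Hg (`|t n| + rho n.+1 + r, B n.+1)].
have sr n y : y \in s n -> `|y - t n| <= r.
  by case: n => [|n]; rewrite /s /t /=; [have [_ _ H _] := Hg (0, 0); exact: H|
    have [_ _ H _] := Hg (`|t n| + rho n.+1 + r, B n.+1); exact: H].
have sB n : B n.+1 < \sum_(y <- s n.+1) normc (fourier_bohr mu y).
  by have [] := Hg (`|t n| + rho n.+1 + r, B n.+1).
have apart n (k : nat) : (k < n)%N -> `|t k| + rho n + r <= `|t n|.
  case: n => // n; rewrite ltnS => kn; apply: le_trans (tS n); rewrite !lerD2r.
  elim: n kn => [|n IH]; first by rewrite leqn0 => /eqP ->.
  rewrite leq_eqVlt => /orP[/eqP -> //|]; rewrite ltnS => /IH; move/le_trans; apply.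
  by apply: le_trans (tS n); have := (Hrho n.+1).1; lra.
have small n m y : n != m -> y \in s m -> normc (fcheck f (y - t n)) <= eps m.
  move=> nm ys; have := sr m y ys => yr.
  have [lt|gt|E] := ltngtP n m; last by rewrite E eqxx in nm.
    apply: (Hrho m).2; have := apart _ _ lt.
    have := ler_normD (t m - y) (y - t n); have := ler_normD (t m - t n) (t n).
    by rewrite !subrK addrA subrK (distrC (t m) y); lra.
  apply: (@le_trans _ _ (eps n)).
    apply: (Hrho n).2; have := apart _ _ gt.
    have := ler_normD (t n - y) (y - t m); have := ler_normD (t n - t m) (t m).
    by rewrite !subrK addrA subrK (distrC (t n) y) (distrC y (t n)); lra.
  rewrite /eps ler_pM2r ?divr_gt0// /q -(subnKC (ltnW gt)) exprD ger_pMr ?exprn_gt0//.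
  by apply: exprn_ile1; rewrite ?invr_ge0// invf_le1//; lra.
have [u [bu Hu]] := superposition t.
have cfu : Cc (fun x => f x * u x) by exact: CcM.
have sum_q N : \sum_(n < N) q n <= 2.
  suff : \sum_(n < N) q n = 2 - 2 * q N by have := q0 N; lra.
  elim: N => [|N IH]; first by rewrite big_ord0 /q expr0; lra.
  by rewrite big_ord_recr /= IH /q exprS; lra.
have big_on m y : y \in s m -> q m * kap / 2 <= normc (fcheck (fun x => f x * u x) y).
  move=> ys; apply/ler_addgt0Pr => e e0.
  have [|||N0 HN0] := @geometric_small R 2^-1 (4 * nint f) e; [by rewrite invr_ge0|lra|by []|].
  pose N := (N0 + m.+1)%N; have mN : (m < N)%N by rewrite /N addnS ltnS leq_addl.
  have H1 := fcheck_superposition y cf bu (Hu N).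
  have H2 : 4 * 2^-1 ^+ N * nint f <= e.
    apply: le_trans HN0; rewrite (_ : 4 * 2^-1 ^+ N * nint f = 2^-1 ^+ N * (4 * nint f)); last by ring.
    rewrite ler_wpM2r ?mulr_ge0 ?nint_ge0//.
    rewrite /N exprD ger_pMr ?exprn_gt0//.
    by apply: exprn_ile1; rewrite ?invr_ge0// invf_le1//; lra.
  rewrite (bigD1 (Ordinal mN))//= in H1.
  have H3 : q m * kap <= normc (Complex (2^-1 ^+ m) 0 * fcheck f (y - t m)).
    rewrite normcM2 normc_real (gtr0_norm (q0 m)) ler_wpM2l ?(ltW (q0 m))// Hkap//; exact: sr.
  set X := Complex (2^-1 ^+ m) 0 * _ in H1 H3.
  set Y := \sum_(i < N | _) _ in H1.
  have H4 : normc Y <= 2 * eps m.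
    apply: le_trans (normc_sum _ _ _) _.
    apply: (@le_trans _ _ (\sum_(i < N | i != Ordinal mN) q i * eps m)).
      apply: ler_sum => i im; rewrite normcM2 normc_real (gtr0_norm (q0 i)).
      by rewrite ler_wpM2l ?(ltW (q0 i))// small.
    rewrite -mulr_suml ler_wpM2r ?(ltW (eps0 m))//; apply: le_trans (sum_q N).
    by rewrite [leRHS](bigD1 (Ordinal mN))//= lerDr ltW.
  have := normc_dist X (X + Y); rewrite opprD addrA subrr sub0r normcNE.
  have := normc_dist (X + Y) (fcheck (fun x => f x * u x) y); rewrite (normcBC (X + Y)).
  by move: H4; rewrite /eps; have := mulr_gt0 (q0 m) kap0; lra.
have [A HA] := abs_summable_coef cfu.
have key m : m.+1%:R * (kap ^+ 2 / 4) <= A.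
  apply: le_trans (HA _ (us m.+1)).
  apply: (@le_trans _ _ ((q m.+1 * kap / 2) ^+ 2 * \sum_(y <- s m.+1) normc (fourier_bohr mu y))); last first.
    rewrite mulr_sumr big_seq [leRHS]big_seq; apply: ler_sum => y ys.
    rewrite /coef normcM2 normc_sqr_fcheck ler_wpM2r ?normc_ge0//.
    have p0 : 0 <= q m.+1 * kap / 2 by rewrite divr_ge0// mulr_ge0 ?(ltW (q0 _)) ?(ltW kap0).
    by rewrite lerXn2r ?nnegrE ?normc_ge0//; exact: big_on.
  apply: (@le_trans _ _ ((q m.+1 * kap / 2) ^+ 2 * B m.+1)); last by rewrite ler_wpM2l ?sqr_ge0// ltW.
  rewrite /B le_eqVlt; apply/orP; left; apply/eqP; field.
  by rewrite gt_eqF// q0.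
have kk : 0 < kap ^+ 2 / 4 by rewrite divr_gt0// exprn_gt0.
have A0 : 0 <= A by have := HA [::] isT; rewrite big_nil.
have := archi_boundP (divr_ge0 A0 (ltW kk)); set M := Num.bound _ => HM.
have := key M; rewrite -ler_pdivlMr// leNgt => /negP; apply.
by apply: lt_trans HM _; rewrite ltr_nat.
Qed.

(** The variation of the set x + K is at most the upper integral of a continuous
    cut-off around x. *)
Lemma translation_bounded_fourier_bohr : translation_bounded (formal_sum (fourier_bohr mu)).
Proof.
have lw := loc_summable_fourier_bohr; move=> K cK.
have [r r0 Kr] : exists2 r : R, 0 <= r & forall k : V, K k -> `|k| <= r.
  have [M [_ HM]] := compact_bounded cK; exists (`|M| + 1); first by rewrite addr_ge0.
  by move=> k Kk; apply: (HM (`|M| + 1)) => //; apply: le_lt_trans (ler_norm _) _; rewrite ltrDl.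
have r1 : 0 <= r + 1 by lra.
have [S HS] := fourier_bohr_translates r1.
apply: (@le_lt_trans _ _ S%:E); last exact: ltry.
apply: ge_ereal_sup => _ [x _ <-].
have cb : Cc (fun y => bump r (y - x)) by apply: Cc_translate; exact: Cc_bump.
have cR : continuous (fun y => complex.Re (bump r (y - x))) := (buc_Re (Cc_buc cb)).1.
have b0 y : 0 <= complex.Re (bump r (y - x)) by exact: clip_ge0.
have H : upper_le (formal_sum (fourier_bohr mu)) (fun y => complex.Re (bump r (y - x))) S.
  move=> h ch hb; apply: formal_sum_bound => // s us.
  apply: (@le_trans _ _ (\sum_(y <- s | `|y - x| <= r + 1) normc (fourier_bohr mu y))).
    rewrite (bigID (fun y => `|y - x| <= r + 1))/= [X in _ + X]big1 ?addr0 => [|y]; last first.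
      rewrite -ltNge => yr; rewrite normcM2 (_ : normc (h y) = 0) ?mul0r//.
      by apply/le_anti; rewrite normc_ge0 andbT; have := hb y; rewrite (vanish_bump yr).
    apply: ler_sum => y _; rewrite normcM2 -[leRHS]mul1r ler_wpM2r ?normc_ge0//.
    by apply: le_trans (hb y) _; exact: clip_le1.
  rewrite -big_filter; apply: (HS x); first exact: filter_uniq.
  by move=> y; rewrite mem_filter => /andP[].
apply: le_trans (upper_integral_le cR b0 H).
apply: ereal_inf_le_tmp => _ [G [lG GG] <-]; exists G => //; split=> // y.
apply: le_trans (GG y); rewrite lee_fin indicE.
have [|_] := boolP (y \in [set (x + k)%R | k in K]); last exact: b0.
by move=> /set_mem[k Kk <-]; rewrite [x + k]addrC addrK bump_in//; exact: Kr.
Qed.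

End necessity.
Theorem theorem7p2 (R : realType) (d : nat)
    (mu : ('rV[R]_d -> (R[i]^o)%type) -> (R[i]^o)%type)
    (hmu : strongly_ap mu) :
  (fourier_transformable mu <->
     formal_sum_is_measure (fourier_bohr mu) /\
     translation_bounded (formal_sum (fourier_bohr mu))) /\
  (fourier_transformable mu ->
     is_fourier_transform mu (formal_sum (fourier_bohr mu)) /\
     forall nu, is_fourier_transform mu nu ->
       eq_on_Cc nu (formal_sum (fourier_bohr mu))).
Proof.
split; first split.
- move=> [nu hnu]; split; last exact: translation_bounded_fourier_bohr hmu hnu.
  by apply/formal_sum_is_measureP; exact: loc_summable_fourier_bohr hmu hnu.
- move=> [/formal_sum_is_measureP lw tw]; exists (formal_sum (fourier_bohr mu)).
  exact: fourier_transform_fourier_bohr.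
move=> [nu hnu]; split; last first.
  by move=> nu' hnu'; exact: fourier_transform_formal_sum hmu hnu'.
apply: (is_fourier_transform_eq_on_Cc (fourier_transform_formal_sum hmu hnu) _ hnu).
exact: is_measure_formal_sum (loc_summable_fourier_bohr hmu hnu).
Qed.
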